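(* Let $K\subset\mathbb{R}^d$ be a self-similar set satisfying the open set condition, and let $s$ be the Hausdorff dimension of $K$. Then there exists a $G_\delta$ set $\Omega$ of $\mathcal{M}(K)$ (that is, a countable intersection of dense open subsets of $\mathcal{M}(K)$) such that for all $\mu\in\Omega$: \begin{itemize} \item for all $h>s$, $E_\mu(h)=\emptyset$; \item for all $h\in[0,s]$, $d_\mu(h)=h$. \end{itemize} In particular, for every $\mu\in\Omega$ and every $q\in[0,1]$, $\tau_\mu(q)=s(q-1)$, and $\mu$ satisfies the multifractal formalism at every $h\in[0,s]$, i.e. $d_\mu(h)=(\tau_\mu)^*(h)$ for every $h\in[0,s]$.
   Context: Self-similar sets: let $S_1,\dots,S_m:\mathbb{R}^d\to\mathbb{R}^d$ ($d\ge 1$) be contractive similitudes, $|S_i(x)-S_i(y)|=\alpha_i|x-y|$ with $0<\alpha_i<1$, $|\cdot|$ the Euclidean norm. The associated self-similar set $K$ is the unique nonempty compact set with $K=\bigcup_{i=1}^m S_i(K)$. It satisfies the open set condition if there is a nonempty open set $U\subset\mathbb{R}^d$ with $S_i(U)\subset U$ for all $i$ and $S_i(U)\cap S_j(U)=\emptyset$ for $i\ne j$. $\mathcal{M}(K)$ is the space of Borel probability measures on $K$ with the weak topology, induced by the complete separable metric $$\varrho(\mu,\nu)=\sup\Big\{\Big|\int f\,d\mu-\int f\,d\nu\Big| : f:K\to\mathbb{R}\text{ Lipschitz},\ \sup_K|f|\le 1,\ \mathrm{Lip}(f)\le 1\Big\},$$ where $\mathrm{Lip}(f)$ is the Lipschitz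 constant of $f$. In a complete metric space, ''$G_\delta$ set'' means here a countable intersection of dense open sets. For $\mu\in\mathcal{M}(K)$ and $x\in K$, the local Hölder exponent is $h_\mu(x)=\liminf_{r\to 0}\frac{\log\mu(B(x,r))}{\log r}$, where $B(x,r)$ is the ball of center $x$ and radius $r$. For $h\ge 0$, $E_\mu(h)=\{x\in K: h_\mu(x)=h\}$ and $d_\mu(h)=\dim_{\mathcal{H}}(E_\mu(h))$, where $\dim_{\mathcal{H}}$ is the Hausdorff dimension. For $j\ge 1$, $\mathcal{G}_j$ is the set of all half-open dyadic cubes $\prod_{i=1}^d[k_i2^{-j},(k_i+1)2^{-j})$, $(k_1,\dots,k_d)\in\mathbb{Z}^d$. The $L^q$ spectrum of $\mu\in\mathcal{M}(K)$ is, for $q\in\mathbb{R}$, $$\tau_\mu(q)=\liminf_{j\to+\infty}-\frac{\log\sum_{Q\in\mathcal{G}_j,\ \mu(Q)\ne 0}\mu(Q)^q}{j\log 2},$$ and its Legendre transform is $(\tau_\mu)^*(h)=\inf_{q\in\mathbb{R}}(qh-\tau_\mu(q))$. *)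

(* Defs.v *)
From HB Require Import structures.
From mathcomp Require Import all_boot all_order all_algebra.
From mathcomp Require Import all_classical all_reals all_analysis.
From mathcomp Require Import borel_hierarchy.

Set Implicit Arguments.
Unset Strict Implicit.
Unset Printing Implicit Defensive.
Import Order.TTheory GRing.Theory Num.Theory.
Import numFieldNormedType.Exports.
Local Open Scope classical_set_scope.
Local Open Scope ring_scope.

(* The library norm on 'rV[R]_d is the sup norm; it induces the same topology,
   but similitudes, balls, diameters and Lipschitz constants below refer to the
   Euclidean norm. *)
Definition enorm (R : realType) (d : nat) (x : 'rV[R]_d) : R :=
  Num.sqrt (\sum_i x ord0 i ^+ 2).

Definition ecball (R : realType) (d : nat) (x : 'rV[R]_d) (r : R) :
    set 'rV[R]_d :=
  [set y | enorm (y - x) <= r].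

Definition contractive_similitude (R : realType) (d : nat) (a : R)
    (f : 'rV[R]_d -> 'rV[R]_d) : Prop :=
  0 < a < 1 /\ forall x y, enorm (f x - f y) = a * enorm (x - y).

Definition self_similar_set (R : realType) (d m : nat)
    (S : 'I_m -> 'rV[R]_d -> 'rV[R]_d) (K : set 'rV[R]_d) : Prop :=
  [/\ K !=set0, compact K & K = \bigcup_i (S i @` K)].

Definition open_set_condition (R : realType) (d m : nat)
    (S : 'I_m -> 'rV[R]_d -> 'rV[R]_d) : Prop :=
  exists U : set 'rV[R]_d,
    [/\ U !=set0, open U,
        forall i, S i @` U `<=` U &
        forall i j, i != j -> S i @` U `&` S j @` U = set0].

Section Hausdorff.
Context {R : realType} {d : nat}.
Implicit Types A U : set 'rV[R]_d.
Local Open Scope ereal_scope.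

Definition ediam U : \bar R :=
  ereal_sup [set (enorm (p.1 - p.2))%:E | p in U `*` U].

(* The case split matters for t = 0 only: poweR x 0 = 1, also at x = 0, while
   an empty piece of a cover must not contribute. *)
Definition hausdorff_gauge (t : R) U : \bar R :=
  if U == set0 then 0 else poweR (ediam U) t.

Definition hausdorff_premeasure (t delta : R) A : \bar R :=
  ereal_inf [set \sum_(k <oo) hausdorff_gauge t (U k) |
    U in [set U : nat -> set 'rV[R]_d |
      (forall k, ediam (U k) <= delta%:E) /\ A `<=` \bigcup_k U k]].

Definition hausdorff_measure (t : R) A : \bar R :=
  ereal_sup [set hausdorff_premeasure t delta A |
    delta in [set delta : R | (0 < delta)%R]].

Definition hausdorff_dim A : \bar R :=
  ereal_inf [set t%:E | t in [set t : R |
    (0 <= t)%R /\ hausdorff_measure t A = 0]].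

End Hausdorff.

(* R^d with its Borel sigma-algebra. *)
Definition borel_rV (R : realType) (d : nat) :=
  g_sigma_algebraType (@open 'rV[R]_d).

(* Borel probability measures on K, identified with the Borel probability
   measures on R^d giving mass 1 to K. *)
Record prob_on (R : realType) (d : nat) (K : set 'rV[R]_d) := ProbOn {
  prob_of :> probability (borel_rV R d) R ;
  prob_onK : prob_of K = 1%E }.

Section ProbOnMetric.
Context {R : realType} {d : nat} {K : set 'rV[R]_d}.
Local Notation M := (prob_on K).
Implicit Types mu nu : M.

Definition lip1_on (f : 'rV[R]_d -> R) : Prop :=
  (forall x, K x -> `|f x| <= 1) /\
  (forall x y, K x -> K y -> `|f x - f y| <= enorm (x - y)).

(* Only the values of f on K matter in lip1_on and in the integrals. *)
Definition rho mu nu : \bar R :=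
  ereal_sup [set (`| \int[mu]_(x in K) f x - \int[nu]_(x in K) f x |)%:E |
    f in lip1_on].

Definition rho_ball mu (e : R) : set M := [set nu | (rho mu nu < e%:E)%E].

Lemma rho_ball_center mu (e : R) : 0 < e -> rho_ball mu e mu.
Proof.
move=> e0; rewrite /rho_ball /=; apply: (@le_lt_trans _ _ 0%E).
  by apply: ge_ereal_sup => _ [f _ <-]; rewrite subrr normr0.
by rewrite lte_fin.
Qed.

Lemma rhoC mu nu : rho mu nu = rho nu mu.
Proof.
by rewrite /rho; congr ereal_sup; apply: eq_imagel => f _; rewrite distrC.
Qed.

Lemma rho_ball_sym mu nu (e : R) : rho_ball mu e nu -> rho_ball nu e mu.
Proof. by rewrite /rho_ball /= rhoC. Qed.

Lemma rho_triangle mu nu pi : (rho mu pi <= rho mu nu + rho nu pi)%E.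
Proof.
apply: ge_ereal_sup => _ [f Lf <-].
apply: (@le_trans _ _ ((`| \int[mu]_(x in K) f x - \int[nu]_(x in K) f x |)%:E
  + (`| \int[nu]_(x in K) f x - \int[pi]_(x in K) f x |)%:E)%E).
  by rewrite -EFinD lee_fin ler_distD.
by apply: leeD; apply: ereal_sup_ubound; exists f.
Qed.

Lemma rho_ball_triangle mu nu pi (e1 e2 : R) :
  rho_ball mu e1 nu -> rho_ball nu e2 pi -> rho_ball mu (e1 + e2) pi.
Proof.
rewrite /rho_ball /= => h1 h2; apply: (le_lt_trans (rho_triangle mu nu pi)).
by rewrite EFinD; apply: lteD.
Qed.

End ProbOnMetric.

Section ProbOnTopology.
Context (R : realType) (d : nat) (K : set 'rV[R]_d).

HB.instance Definition _ := gen_eqMixin (prob_on K).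
HB.instance Definition _ := gen_choiceMixin (prob_on K).
HB.instance Definition _ := hasNbhs.Build (prob_on K)
  (nbhs_ (entourage_ (@rho_ball R d K))).
(* A library measure also takes (meaningless) values on non-measurable sets,
   so rho separates points only up to equality on the Borel sets: prob_on K is
   a pseudometric space, whose metric quotient is the space of Borel
   probability measures on K. *)
HB.instance Definition _ := @Nbhs_isPseudoMetric.Build R (prob_on K)
  (entourage_ (@rho_ball R d K)) erefl (@rho_ball R d K)
  (@rho_ball_center R d K) (@rho_ball_sym R d K)
  (@rho_ball_triangle R d K) erefl.

End ProbOnTopology.

Section Multifractal.
Context {R : realType} {d : nat} {K : set 'rV[R]_d}.
Implicit Types mu : prob_on K.
Local Open Scope ereal_scope.

(* +oo when mu (ecball x r) = 0 for small r, since lne 0 = -oo. *)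
Definition local_holder mu (x : 'rV[R]_d) : \bar R :=
  limf_einf (fun r : R => lne (mu (ecball x r)) * ((ln r)^-1)%:E) 0^'+.

Definition level_set mu (h : R) : set 'rV[R]_d :=
  [set x | K x /\ local_holder mu x = h%:E].

Definition spectrum mu (h : R) : \bar R := hausdorff_dim (level_set mu h).

Definition dyadic_cube (j : nat) (k : 'rV[int]_d) : set 'rV[R]_d :=
  [set x | forall i, ((k ord0 i)%:~R / 2 ^+ j <= x ord0 i
                      < (k ord0 i + 1)%:~R / 2 ^+ j)%R].

Definition dyadic_cubes (j : nat) : set (set 'rV[R]_d) :=
  range (dyadic_cube j).

Definition Lq_spectrum mu (q : R) : \bar R :=
  limn_einf (fun j : nat =>
    - (lne (\esum_(Q in dyadic_cubes j `&` [set Q | mu Q != 0])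
              poweR (mu Q) q)
       * ((j%:R * ln 2)^-1)%:E)).

Definition legendre (tau : R -> \bar R) (h : R) : \bar R :=
  ereal_inf (range (fun q : R => (q * h)%:E - tau q)).

End Multifractal.

(* Main.v *)
Require Import Defs.
From HB Require Import structures.
From mathcomp Require Import all_boot all_order all_algebra.
From mathcomp Require Import all_classical all_reals all_analysis.
From mathcomp Require Import borel_hierarchy.
From mathcomp Require Import measurable_realfun.
From mathcomp Require Import ring lra zify.
Set Implicit Arguments.
Unset Strict Implicit.
Unset Printing Implicit Defensive.
Import Order.TTheory GRing.Theory Num.Theory.
Import numFieldNormedType.Exports.
Local Open Scope classical_set_scope.
Local Open Scope ring_scope.

(* Cutting words at the contraction ratio 2^-j yields about 2^(js) pieces
   S_w(K), each of size about 2^-j, and boundedly many of them meet a given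
   ball of that radius.  Call mu good at level j if every point S_w(y0), w cut
   at 2^-j, has a ball of the far smaller radius 2^-(j^2) of mass more than
   about 2^-(js) / (j+1).  Tested against Lipschitz bumps this is an open
   condition, and adding small equal atoms at the S_w(y0) makes any measure
   good at all large j; so the measures good at infinitely many levels form a
   dense G_delta set.

   Fix such a mu.  Every point of K is within O(2^-j) of some S_w(y0), whence
   h_mu <= s.  If 0 < h <= s, the points lying within O(2^(-js/h)) of some
   S_w(y0) for infinitely many good j satisfy h_mu <= h, and they contain a
   Cantor set carrying a measure of dimension h.  For any measure, covering by
   the heavy pieces shows dim {h_mu <= g} <= g; hence that Cantor measure
   charges {h_mu = h}, and dim E_mu(h) = h.

   At a good level about 2^(js) dyadic cubes have mass at least
   2^(-js) / O(j+1), and K meets no more than O(2^(js)) of them; hence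
   tau_mu(q) = s(q-1) on [0,1] and tau_mu(q) <= s(q-1) for q < 0.
   For q > 1, some cube of side 2^-(jn), n arbitrary, has mass >= 2^(-j(s+1)),
   so tau_mu(q) <= 0, and the Legendre transform at h <= s is h. *)

(** * Euclidean geometry *)

(** The radius [tiny j] is eventually below every fixed power of [2^-j]; this lets one set of
    measures serve all exponents [h] in ]0, s], where balls of radius about [2^(-js/h)] are
    examined. The factor [1/(j+1)] in the threshold tends to zero, so that equal atoms of
    arbitrarily small total mass eventually exceed it, yet it is subexponential and changes no
    exponent.

    The number [s] is given as a Hausdorff dimension, while all counting rests on
    [sum alpha_i^s = 1]. The equality of the two dimensions is therefore proved on the way, by the
    same Cantor construction with every level allowed and [h] equal to the similarity dimension.

    The good levels cannot be chosen, only awaited. Each generation of the Cantor set waits for a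
    level so deep that all constants inherited from the earlier generations are absorbed by a
    slightly reduced exponent. *)

Section EuclideanNorm.
Context {R : realType} {d : nat}.
Implicit Types x y z : 'rV[R]_d.

Definition dot x y : R := \sum_i x ord0 i * y ord0 i.

Lemma dotC x y : dot x y = dot y x.
Proof. by apply: eq_bigr => i _; rewrite mulrC. Qed.

Lemma dotDl x y z : dot (x + y) z = dot x z + dot y z.
Proof. by rewrite /dot -big_split; apply: eq_bigr => i _; rewrite mxE mulrDl. Qed.

Lemma dotZl (a : R) x y : dot (a *: x) y = a * dot x y.
Proof. by rewrite /dot mulr_sumr; apply: eq_bigr => i _; rewrite mxE mulrA. Qed.

Lemma dotBl x y z : dot (x - y) z = dot x z - dot y z.
Proof. by rewrite dotDl -scaleN1r dotZl mulN1r. Qed.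

Lemma dot_ge0 x : 0 <= dot x x.
Proof. by apply: sumr_ge0 => i _; rewrite -expr2 sqr_ge0. Qed.

Lemma enormE x : enorm x = Num.sqrt (dot x x).
Proof. by congr Num.sqrt; apply: eq_bigr => i _; rewrite expr2. Qed.

Lemma enorm_ge0 x : 0 <= enorm x.
Proof. exact: sqrtr_ge0. Qed.

Lemma enorm_sqr x : enorm x ^+ 2 = dot x x.
Proof. by rewrite enormE sqr_sqrtr ?dot_ge0. Qed.

Lemma dot_subE x y : dot (x - y) (x - y) = dot x x - dot x y *+ 2 + dot y y.
Proof.
rewrite dotBl dotC dotBl (dotC y (x - y)) dotBl (dotC y x) mulr2n; ring.
Qed.

Lemma enorm0 : enorm (0 : 'rV[R]_d) = 0.
Proof.
rewrite enormE /dot big1 ?sqrtr0// => i _.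
by rewrite mxE mul0r.
Qed.

Lemma coord_le_enorm x i : `|x ord0 i| <= enorm x.
Proof.
rewrite -(sqrtr_sqr (x ord0 i)) ler_wsqrtr// (bigD1 i)//= lerDl.
by apply: sumr_ge0 => j _; rewrite sqr_ge0.
Qed.

Lemma enorm_eq0 x : enorm x = 0 -> x = 0.
Proof.
move=> x0; apply/rowP => i; rewrite mxE; apply/eqP; rewrite -normr_eq0.
by apply/eqP/le_anti; rewrite normr_ge0 andbT -x0 coord_le_enorm.
Qed.

Lemma enormN x : enorm (- x) = enorm x.
Proof. by congr Num.sqrt; apply: eq_bigr => i _; rewrite mxE sqrrN. Qed.

Lemma enormBC x y : enorm (x - y) = enorm (y - x).
Proof. by rewrite -enormN opprB. Qed.

(** Cauchy-Schwarz, from the nonnegative square of [enorm y *: x - enorm x *: y]; zero vectors are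
    set aside so that [enorm x * enorm y] can be cancelled. *)
Lemma dot_le_enorm x y : dot x y <= enorm x * enorm y.
Proof.
have [x0|x0] := eqVneq (enorm x) 0.
  rewrite (enorm_eq0 x0) enorm0 mul0r /dot big1// => i _.
  by rewrite mxE mul0r.
have [y0|y0] := eqVneq (enorm y) 0.
  rewrite (enorm_eq0 y0) enorm0 mulr0 /dot big1// => i _.
  by rewrite mxE mulr0.
have xy_gt0 : 0 < enorm x * enorm y.
  by rewrite mulr_gt0// lt0r ?x0 ?y0 enorm_ge0.
have := dot_ge0 (enorm y *: x - enorm x *: y).
rewrite dot_subE !dotZl ![dot _ (_ *: _)]dotC !dotZl -!enorm_sqr (dotC y x).
move=> H; rewrite -(ler_pM2l xy_gt0) -subr_ge0 -(pmulrn_lge0 _ (ltn0Sn 1)).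
apply: le_trans H _; rewrite le_eqVlt; apply/orP; left; apply/eqP.
by rewrite !mulr2n; ring.
Qed.

Lemma enormD x y : enorm (x + y) <= enorm x + enorm y.
Proof.
rewrite -ler_sqr ?nnegrE ?addr_ge0 ?enorm_ge0// enorm_sqr dotDl dotC dotDl.
rewrite (dotC y (x + y)) dotDl (dotC y x) sqrrD -!enorm_sqr.
by have := dot_le_enorm x y; lra.
Qed.

Lemma enorm_triangle y x z : enorm (x - z) <= enorm (x - y) + enorm (y - z).
Proof. by apply: le_trans (enormD _ _); rewrite subrKA. Qed.

Lemma mx_norm_le_enorm x : `|x| <= enorm x.
Proof.
rewrite [leLHS]/Num.norm/= mx_normrE; apply: bigmax_le; first exact: enorm_ge0.
by move=> [i j] _ /=; rewrite ord1 coord_le_enorm.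
Qed.

Lemma coord_le_mx_norm x i : `|x ord0 i| <= `|x|.
Proof.
rewrite [leRHS]/Num.norm/= mx_normrE.
exact: (le_bigmax _ (fun ij : 'I_1 * 'I_d => `|x ij.1 ij.2|) (ord0, i)).
Qed.

Lemma enorm_le_sum x : enorm x <= \sum_i `|x ord0 i|.
Proof.
have s0 : 0 <= \sum_i `|x ord0 i| by apply: sumr_ge0.
rewrite -ler_sqr ?nnegrE ?enorm_ge0// enorm_sqr /dot expr2 mulr_suml.
apply: ler_sum => i _; apply: (le_trans (ler_norm _)).
rewrite normrM ler_wpM2l// (bigD1 i)//= lerDl.
by apply: sumr_ge0.
Qed.

Lemma enorm_le_mx_norm x : enorm x <= d%:R * `|x|.
Proof.
apply: le_trans (enorm_le_sum x) _.
apply: (@le_trans _ _ (\sum_(i < d) `|x|)).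
  by apply: ler_sum => i _; exact: coord_le_mx_norm.
by rewrite sumr_const card_ord mulr_natl.
Qed.

Lemma enorm_lip x y z : `|enorm (x - z) - enorm (y - z)| <= enorm (x - y).
Proof.
rewrite ler_norml; apply/andP; split.
  by have := enorm_triangle x y z; rewrite (enormBC y x); lra.
by have := enorm_triangle y x z; lra.
Qed.

Lemma open_enormP (A : set 'rV[R]_d) : (0 < d)%N ->
  (forall x, A x -> exists2 e, 0 < e & forall y, enorm (y - x) < e -> A y) ->
  open A.
Proof.
move=> d0 hA; rewrite openE => x /hA [e e0 he]; apply/nbhs_ballP.
have de0 : 0 < e / d%:R by rewrite divr_gt0// ltr0n.
exists (e / d%:R) => // y; rewrite -ball_normE /= distrC => xy.
apply: he; apply: le_lt_trans (enorm_le_mx_norm _) _.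
by rewrite mulrC -ltr_pdivlMr ?ltr0n.
Qed.

Lemma open_enorm_ball (A : set 'rV[R]_d) x : open A -> A x ->
  exists2 e, 0 < e & forall y, enorm (y - x) < e -> A y.
Proof.
rewrite openE => oA /oA /nbhs_ballP [e /= e0 he]; exists e => // y yx.
apply: he; rewrite -ball_normE /= distrC.
exact: le_lt_trans (mx_norm_le_enorm _) yx.
Qed.

Lemma closed_ecball x (r : R) : (0 < d)%N -> closed (ecball x r).
Proof.
move=> d0; rewrite -[ecball x r]setCK; apply: open_closedC.
apply: open_enormP => // y /= /negP; rewrite -ltNge => yx.
exists (enorm (y - x) - r); first by rewrite subr_gt0.
move=> z zy; apply/negP; rewrite /ecball /= -ltNge.
by have := enorm_triangle z y x; rewrite (enormBC y z); lra.
Qed.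

End EuclideanNorm.

Section Similitude.
Context {R : realType} {d : nat}.
Implicit Types x y z : 'rV[R]_d.

(* Preserving distances up to a factor forces the linear part to be a multiple
   of an orthogonal matrix, whence surjectivity. *)
Lemma similitude_surj (a : R) (f : 'rV[R]_d -> 'rV[R]_d) : 0 < a ->
  (forall x y, enorm (f x - f y) = a * enorm (x - y)) ->
  forall z, exists x, f x = z.
Proof.
move=> a0 hf z; pose g x := a^-1 *: (f x - f 0).
have an0 : a != 0 by rewrite gt_eqF.
have gB x y : enorm (g x - g y) = enorm (x - y).
  rewrite /g -scalerBr opprB addrA subrK.
  rewrite enormE dotZl dotC dotZl mulrA -expr2 -enorm_sqr hf.
  by rewrite -exprMn mulrA mulVf// mul1r sqrtr_sqr ger0_norm// enorm_ge0.
have g0 : g 0 = 0 by rewrite /g subrr scaler0.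
have gn x : dot (g x) (g x) = dot x x.
  by have := gB x 0; rewrite g0 !subr0 -!enorm_sqr => ->.
have gd x y : dot (g x) (g y) = dot x y.
  have : dot (g x - g y) (g x - g y) = dot (x - y) (x - y).
    by rewrite -!enorm_sqr gB.
  rewrite !dot_subE !gn !mulr2n; lra.
pose A : 'M[R]_d := \matrix_i g (delta_mx ord0 i).
have AE x : g x *m A^T = x.
  apply/rowP => j; rewrite mxE.
  have := gd x (delta_mx ord0 j).
  rewrite /dot [RHS](bigD1 j)//= [X in _ = _ + X]big1.
    rewrite mxE !eqxx/= mulr1 addr0 => <-.
    by apply: eq_bigr => i _; rewrite !mxE.
  by move=> i ij; rewrite mxE (negbTE ij) andbF mulr0.
have AAT : A *m A^T = 1%:M.
  apply/row_matrixP => i.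
  by rewrite row_mul rowK AE row1.
have ATA := mulmx1C AAT.
pose w := a^-1 *: (z - f 0); exists (w *m A^T).
have : g (w *m A^T) = w.
  have gA x : g x = x *m A.
    by rewrite -{2}(AE x) -mulmxA ATA mulmx1.
  by rewrite gA -mulmxA ATA mulmx1.
rewrite /g /w => /(congr1 (fun u => a *: u)); rewrite !scalerA mulfV// !scale1r.
by move=> /addIr.
Qed.

End Similitude.

(** * Words and stopping times *)

Section Words.
Context {R : realType} {d m : nat}.
Variables (S : 'I_m -> 'rV[R]_d -> 'rV[R]_d) (alpha : 'I_m -> R).
Hypothesis hS : forall i, contractive_similitude (alpha i) (S i).
Implicit Types (u v w : seq 'I_m) (rho : R) (n : nat).

Definition wmap w x := foldr S x w.

Definition ratio w : R := \prod_(i <- w) alpha i.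

Definition amax : R := \big[Num.max/0]_i alpha i.
Definition amin : R := \big[Num.min/1]_i alpha i.

Lemma alpha_gt0 i : 0 < alpha i. Proof. by case: (hS i) => /andP[]. Qed.
Lemma alpha_lt1 i : alpha i < 1. Proof. by case: (hS i) => /andP[]. Qed.

Lemma alpha_le_amax i : alpha i <= amax.
Proof. exact: le_bigmax. Qed.

Lemma amin_le_alpha i : amin <= alpha i.
Proof. exact: bigmin_le. Qed.

Lemma amax_ge0 : 0 <= amax.
Proof. exact: bigmax_ge_id. Qed.

Lemma amax_lt1 : amax < 1.
Proof. by apply: bigmax_lt => // i _; exact: alpha_lt1. Qed.

Lemma amin_gt0 : 0 < amin.
Proof. by apply: lt_bigmin => // i _; exact: alpha_gt0. Qed.

Lemma amin_le1 : amin <= 1.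
Proof. exact: bigmin_le_id. Qed.

Lemma wmap_cat v u x : wmap (v ++ u) x = wmap v (wmap u x).
Proof. by rewrite /wmap foldr_cat. Qed.

Lemma wmap_rcons v i x : wmap (rcons v i) x = wmap v (S i x).
Proof. by rewrite -cats1 wmap_cat. Qed.

Lemma ratio_cat v u : ratio (v ++ u) = ratio v * ratio u.
Proof. by rewrite /ratio big_cat. Qed.

Lemma ratio_rcons v i : ratio (rcons v i) = ratio v * alpha i.
Proof. by rewrite -cats1 ratio_cat /ratio big_seq1. Qed.

Lemma ratio_nil : ratio [::] = 1.
Proof. by rewrite /ratio big_nil. Qed.

Lemma ratio_gt0 w : 0 < ratio w.
Proof. by apply: prodr_gt0 => i _; exact: alpha_gt0. Qed.

Lemma ratio_le1 w : ratio w <= 1.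
Proof.
apply: prodr_ile1 => i _.
by rewrite (ltW (alpha_gt0 _)) (ltW (alpha_lt1 _)).
Qed.

Lemma ratio_cat_le v u : ratio (v ++ u) <= ratio v.
Proof. by rewrite ratio_cat ler_piMr// ?ratio_le1// ltW// ratio_gt0. Qed.

Lemma wmap_dist w x y : enorm (wmap w x - wmap w y) = ratio w * enorm (x - y).
Proof.
elim: w x y => [|i w IH] x y; first by rewrite ratio_nil mul1r.
by rewrite /= (proj2 (hS i)) IH mulrA /ratio big_cons.
Qed.

Lemma wmap_inj w : injective (wmap w).
Proof.
move=> x y xy; apply/eqP; rewrite -subr_eq0; apply/eqP/enorm_eq0.
have := wmap_dist w x y; rewrite xy subrr enorm0 => /esym/eqP.
by rewrite mulf_eq0 gt_eqF ?ratio_gt0//= => /eqP.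
Qed.

Lemma wmap_surj w z : exists x, wmap w x = z.
Proof. exact: similitude_surj (ratio_gt0 w) (wmap_dist w) z. Qed.

(* The words below [v] at which the contraction ratio first drops to [rho],
   provided the fuel [n] suffices. *)
Fixpoint cut n rho v : seq (seq 'I_m) :=
  if n is n'.+1 then
    if ratio v <= rho then [:: v]
    else flatten [seq cut n' rho (rcons v i) | i <- enum 'I_m]
  else [:: v].

Definition fuelled n rho v := ratio v * amax ^+ n <= rho.

Lemma fuelled_rcons n rho v i :
  fuelled n.+1 rho v -> fuelled n rho (rcons v i).
Proof.
apply: le_trans; rewrite ratio_rcons exprS -mulrA.
rewrite ler_wpM2l ?(ltW (ratio_gt0 v))// ler_wpM2r ?alpha_le_amax//.
by rewrite exprn_ge0// amax_ge0.
Qed.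

Lemma cut_prefix n rho v w : w \in cut n rho v -> exists u, w = v ++ u.
Proof.
elim: n v => [|n IH] v /=.
  by rewrite inE => /eqP ->; exists [::]; rewrite cats0.
case: ifP => _; first by rewrite inE => /eqP ->; exists [::]; rewrite cats0.
move=> /flatten_mapP[i _ /IH[u ->]]; exists (i :: u).
by rewrite -cats1 -catA.
Qed.

Lemma cut_le n rho v w : fuelled n rho v -> w \in cut n rho v -> ratio w <= rho.
Proof.
elim: n v => [|n IH] v /= fv.
  by rewrite inE => /eqP ->; move: fv; rewrite /fuelled mulr1.
case: ifP => [vr|_]; first by rewrite inE => /eqP ->.
by move=> /flatten_mapP[i _]; apply: IH; exact: fuelled_rcons.
Qed.

Lemma cut_gt n rho v w : 0 < rho -> amin * rho < ratio v ->
  w \in cut n rho v -> amin * rho < ratio w.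
Proof.
move=> r0; elim: n v => [|n IH] v vr /=; first by rewrite inE => /eqP ->.
case: ifP => [_|/negbT]; first by rewrite inE => /eqP ->.
rewrite -ltNge => vr' /flatten_mapP[i _]; apply: IH.
rewrite ratio_rcons mulrC.
apply: (@lt_le_trans _ _ (ratio v * amin)); first by rewrite ltr_pM2r// amin_gt0.
by rewrite ler_pM2l ?ratio_gt0// amin_le_alpha.
Qed.

Lemma cut_cover n rho v (K : set 'rV[R]_d) y : K = \bigcup_i (S i @` K) ->
  (wmap v @` K) y -> exists2 w, w \in cut n rho v & (wmap w @` K) y.
Proof.
move=> hK; elim: n v => [|n IH] v /= vy; first by exists v => //; rewrite inE.
case: ifP => _; first by exists v => //; rewrite inE.
case: vy => z; rewrite {1}hK => -[i _ [z' z'K <-]] vy.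
have [|w wc wy] := IH (rcons v i).
  by exists z' => //; rewrite wmap_rcons.
exists w => //; apply/flatten_mapP; exists i => //.
by rewrite mem_enum.
Qed.

Lemma cut_uniq n rho v : uniq (cut n rho v).
Proof.
elim: n v => [|n IH] v //=; case: ifP => // _.
have : uniq (enum 'I_m) by exact: enum_uniq.
elim: (enum 'I_m) => //= i s IHs /andP[si us].
rewrite cat_uniq IH IHs// andbT /=; apply/hasPn => w /flatten_mapP[j js].
move=> /cut_prefix[u ->]; apply/negP => /cut_prefix[u'].
rewrite -!cats1 -!catA => /eqP; rewrite eqseq_cat// eqxx /= => /eqP[ij _].
by move: si; rewrite -ij js.
Qed.

(** Two words of one cut part at some letter. The common prefix acts injectively and the tails map
    [U] into itself, so the disjointness at that letter carries over. *)
Lemma cut_disjoint n rho v w w' (U : set 'rV[R]_d) :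
  (forall i, S i @` U `<=` U) ->
  (forall i j, i != j -> S i @` U `&` S j @` U = set0) ->
  w \in cut n rho v -> w' \in cut n rho v -> w != w' ->
  wmap w @` U `&` wmap w' @` U = set0.
Proof.
move=> hU hdisj.
have subU u x : U x -> U (wmap u x).
  by elim: u => //= i u IH /IH Ux; apply: (hU i); exists (wmap u x).
elim: n v => [|n IH] v /=.
  by rewrite !inE => /eqP -> /eqP -> /eqP.
case: ifP => _; first by rewrite !inE => /eqP -> /eqP -> /eqP.
move=> /flatten_mapP[i _ wi] /flatten_mapP[j _ wj] ww'.
have [ij|ij] := eqVneq i j; first by apply: (IH (rcons v i)) => //; rewrite ij.
have [u wE] := cut_prefix wi; have [u' wE'] := cut_prefix wj.
rewrite -subset0 => _ [[x Ux <-] [x' Ux' /=]].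
rewrite wE wE' !wmap_cat !wmap_rcons => /wmap_inj E.
have /seteqP[+ _] := hdisj _ _ ij; apply; split.
  by exists (wmap u x) => //; exact: subU.
by exists (wmap u' x') => //; exact: subU.
Qed.

(** Frees the cut from its recursion: below [v], the ratio is at most [rho] for the first time. Cuts
    with different starting words and fuels become comparable. *)
Lemma cutP n rho v w : fuelled n rho v ->
  w \in cut n rho v <-> (exists u, w = v ++ u) /\ ratio w <= rho /\
    forall k, (size v <= k < size w)%N -> rho < ratio (take k w).
Proof.
move=> fv; split.
  move=> wc; split; first exact: cut_prefix wc.
  split; first exact: cut_le fv wc.
  elim: n v fv wc => [|n IH] v fv /=.
    by rewrite inE => /eqP -> k; case: leqP => //= *; rewrite ltnNge.
  case: ifP => [_|/negbT vr].
    by rewrite inE => /eqP -> k /andP[? ?]; lia.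
  move=> /flatten_mapP[i _ wi] k.
  have [u wE] := cut_prefix wi.
  case: (ltngtP (size v) k) => //= vk kw.
    by apply: IH wi _ _; [exact: fuelled_rcons|rewrite size_rcons vk].
  rewrite -vk wE -cats1 -catA take_size_cat//.
  by rewrite ltNge.
move=> [[u ->] [wr wk]].
elim: n v u fv wr wk => [|n IH] v u fv wr wk /=.
  case: u wr wk => [|i u] wr wk; first by rewrite cats0 inE.
  have := wk (size v); rewrite size_cat /= leqnn -{1}(addn0 (size v)) ltn_add2l.
  move=> /(_ isT); rewrite take_size_cat// ltNge.
  by move: fv; rewrite /fuelled mulr1 => ->.
case: ifP => [vr|/negbT vr].
  case: u wr wk => [|i u] wr wk; first by rewrite cats0 inE.
  have := wk (size v); rewrite size_cat /= leqnn -{1}(addn0 (size v)) ltn_add2l.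
  by move=> /(_ isT); rewrite take_size_cat// ltNge vr.
case: u wr wk => [|i u] wr wk; first by rewrite -(cats0 v) wr in vr.
apply/flatten_mapP; exists i; first by rewrite mem_enum.
rewrite -cat_rcons in wr wk *; apply: IH => //; first exact: fuelled_rcons.
by move=> k /andP[vk kw]; apply: wk; rewrite kw andbT; rewrite size_rcons in vk; lia.
Qed.

Lemma ratio_take w k : ratio w <= ratio (take k w).
Proof. by rewrite -{1}(cat_take_drop k w) ratio_cat_le. Qed.

(** Since [v] is still above [rho], so are its prefixes, and the first passage below [rho] is the
    same from [v] as from the empty word. *)
Lemma cut_root n n' rho v w : fuelled n rho v -> fuelled n' rho [::] ->
  rho < ratio v -> w \in cut n rho v -> w \in cut n' rho [::].
Proof.
move=> fv fn vr /cutP-/(_ fv) [[u wE] [wr wk]].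
apply/cutP => //; split; first by exists w.
split=> // k /andP[_ kw]; case: (leqP (size v) k) => vk.
  by apply: wk; rewrite vk.
rewrite wE takel_cat ?(ltnW vk)//.
exact: lt_le_trans vr (ratio_take _ _).
Qed.

Section Weights.
Variable (t : R).
Hypothesis ht : \sum_i alpha i `^ t = 1.

Lemma cut_split_sum v : \sum_i ratio (rcons v i) `^ t = ratio v `^ t.
Proof.
rewrite -[RHS]mulr1 -ht mulr_sumr; apply: eq_bigr => i _.
by rewrite ratio_rcons powRM// ltW// ?ratio_gt0// alpha_gt0.
Qed.

Lemma big_cut_rec (F : seq 'I_m -> R) (P : pred (seq 'I_m)) n rho v :
  \sum_(w <- flatten [seq cut n rho (rcons v i) | i <- enum 'I_m] | P w) F w
  = \sum_i \sum_(w <- cut n rho (rcons v i) | P w) F w.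
Proof. by rewrite big_flatten /= big_map big_enum. Qed.

Lemma cut_sum n rho v : \sum_(w <- cut n rho v) ratio w `^ t = ratio v `^ t.
Proof.
elim: n v => [|n IH] v /=; first by rewrite big_seq1.
case: ifP => _; first by rewrite big_seq1.
by rewrite big_cut_rec -cut_split_sum; apply: eq_bigr => i _; exact: IH.
Qed.

(** By [cut_sum] the fine words below a coarse one carry exactly its weight, and a fine word in [P]
    has its coarse prefix in [P]. *)
Lemma cut_refine n n' rho rho' v (P : pred (seq 'I_m)) : rho <= rho' ->
  fuelled n rho v -> fuelled n' rho' v ->
  (forall w u, P (w ++ u) -> P w) ->
  \sum_(w <- cut n rho v | P w) ratio w `^ t <=
  \sum_(w <- cut n' rho' v | P w) ratio w `^ t.
Proof.
move=> rr fn fn' hP.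
have base k u : \sum_(w <- cut k rho u | P w) ratio w `^ t <=
   \sum_(w <- [:: u] | P w) ratio w `^ t.
  rewrite [leRHS]big_mkcond big_seq1; case: ifP => [Pv|/negbT nPv].
    rewrite -(cut_sum k rho u) [leRHS](bigID P)/= lerDl.
    by apply: sumr_ge0 => *; exact: powR_ge0.
  rewrite big_seq_cond big_pred0// => z; apply: contraNF nPv.
  by move=> /andP[/cut_prefix[u' ->]] /hP.
elim: n' v n fn fn' => [|n' IH] v n fn fn' /=; first exact: base.
case: ifP => [_|/negbT vr]; first exact: base.
case: n fn => [|n] fn.
  move: vr; rewrite -ltNge ltNge (le_trans _ rr)//.
  by move: fn; rewrite /fuelled mulr1.
rewrite /= ifF; last first.
  by apply/negbTE; move: vr; rewrite -!ltNge; exact: le_lt_trans.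
rewrite !big_cut_rec; apply: ler_sum => i _.
by apply: IH; exact: fuelled_rcons.
Qed.

End Weights.
End Words.

(** * Packing bounds for stopped words *)

Section Packing.
Context {R : realType} {d : nat}.

(** Pigeonhole on a grid of mesh [e / (d + 1)]: two points of one cell differ by at most the mesh in
    each of the [d] coordinates, hence by less than [e] in norm. *)
Lemma packing (T : eqType) (s : seq T) (p : T -> 'rV[R]_d) (x : 'rV[R]_d)
    (e q : R) : 0 < e -> 0 <= q -> uniq s ->
  {in s &, forall w w', w != w' -> e <= enorm (p w - p w')} ->
  {in s, forall w, enorm (p w - x) <= q * e} ->
  (size s <= (Num.truncn (2 * q * d.+1%:R)).+1 ^ d)%N.
Proof.
move=> e0 q0 us sep near; set B := Num.truncn _.
have d0 : 0 < d.+1%:R :> R by rewrite ltr0n.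
pose eta := e / d.+1%:R.
have eta0 : 0 < eta by rewrite divr_gt0.
pose g w i := ((p w - x) ord0 i + q * e) / eta.
have gP w i : w \in s -> 0 <= g w i <= 2 * q * d.+1%:R.
  move=> /near; have := coord_le_enorm (p w - x) i.
  rewrite ler_norml => /andP[h1 h2] h3; apply/andP; split.
    by apply: divr_ge0; [lra|exact: ltW].
  rewrite /g ler_pdivrMr//.
  have -> : 2 * q * d.+1%:R * eta = 2 * q * e by rewrite /eta; field; rewrite gt_eqF.
  lra.
pose c w : {ffun 'I_d -> 'I_B.+1} := [ffun i => inord (Num.truncn (g w i))].
have cinj : {in s &, injective c}.
  move=> w w' ws ws' cc; apply: contrapT => /eqP ww'.
  have := sep _ _ ws ws' ww'; apply/negP; rewrite -ltNge.
  apply: le_lt_trans (enorm_le_sum _) _.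
  apply: (@le_lt_trans _ _ (\sum_(i < d) eta)); last first.
    rewrite sumr_const card_ord -[ltLHS]mulr_natl /eta mulrA ltr_pdivrMr//.
    by rewrite mulrC ltr_pM2l// ltr_nat.
  apply: ler_sum => i _.
  have /andP[g0 g1] := gP w i ws; have /andP[g0' g1'] := gP w' i ws'.
  have : c w i = c w' i by rewrite cc.
  rewrite !ffunE => /(congr1 val) /=; rewrite !inordK ?ltnS ?le_truncn// => tE.
  have /andP[t1 t2] := truncn_itv g0; have /andP[] := truncn_itv g0'.
  rewrite -tE => t1' t2'.
  have : `|g w i - g w' i| <= 1.
    by rewrite ler_norml; move: t2 t2'; rewrite -natr1; lra.
  rewrite /g -mulrBl normrM normfV (gtr0_norm eta0) ler_pdivrMr// mul1r.
  by apply: le_trans; rewrite !mxE le_eqVlt; apply/orP; left; apply/eqP; congr `|_|; lra.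
rewrite -(size_map c).
have -> : (B.+1 ^ d = #|{ffun 'I_d -> 'I_B.+1}|)%N.
  by rewrite card_ffun !card_ord.
rewrite cardT; apply: uniq_leq_size; first by rewrite map_inj_in_uniq.
by move=> z _; rewrite mem_enum.
Qed.

End Packing.

Section StoppedWords.
Context {R : realType} {d m : nat}.
Variables (S : 'I_m -> 'rV[R]_d -> 'rV[R]_d) (alpha : 'I_m -> R).
Hypothesis hS : forall i, contractive_similitude (alpha i) (S i).
Variable K : set 'rV[R]_d.
Hypothesis hd : (0 < d)%N.
Hypothesis hK : self_similar_set S K.
Implicit Types (u v w : seq 'I_m) (rho : R).
Local Notation wmap := (wmap S).
Local Notation ratio := (ratio alpha).
Local Notation amin := (amin alpha).
Local Notation amax := (amax alpha).

Definition stop_fuel rho := xget 0%N [set n | amax ^+ n <= rho].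
Definition stop rho v := cut alpha (stop_fuel rho) rho v.

Lemma stop_fuelP rho v : 0 < rho -> fuelled alpha (stop_fuel rho) rho v.
Proof.
move=> r0; have [n nr] : exists n, amax ^+ n <= rho.
  have : `|amax| < 1.
    by rewrite ger0_norm ?(amax_lt1 hS)// (amax_ge0 alpha).
  move=> /cvg_expr /cvgrPdist_lt /(_ _ r0) [n _ /(_ n (leqnn n))].
  rewrite /= sub0r normrN ger0_norm ?exprn_ge0 ?(amax_ge0 alpha)// => h.
  by exists n; exact: ltW.
have := @xgetPex _ 0%N [set n | amax ^+ n <= rho] (ex_intro _ n nr).
rewrite /= -/(stop_fuel rho); apply: le_trans.
by rewrite ler_piMl ?exprn_ge0 ?(amax_ge0 alpha)// (ratio_le1 hS).
Qed.

Lemma stop_le rho v w : 0 < rho -> w \in stop rho v -> ratio w <= rho.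
Proof. by move=> r0; apply: (cut_le hS); exact: stop_fuelP. Qed.

Lemma stop_gt rho v w : 0 < rho -> amin * rho < ratio v ->
  w \in stop rho v -> amin * rho < ratio w.
Proof. exact: (cut_gt hS). Qed.

Lemma amin_lt1 : amin < 1.
Proof.
case: hK => -[x Kx] _ KE; move: Kx; rewrite KE => -[i _ _].
exact: le_lt_trans (amin_le_alpha alpha i) (alpha_lt1 hS i).
Qed.

Lemma stop0_gt rho w : 0 < rho <= 1 -> w \in stop rho [::] ->
  amin * rho < ratio w.
Proof.
move=> /andP[r0 r1]; apply: stop_gt => //; rewrite ratio_nil.
by apply: le_lt_trans amin_lt1; rewrite ler_piMr// ltW// (amin_gt0 hS).
Qed.

Lemma stop_cover rho v y : (wmap v @` K) y ->
  exists2 w, w \in stop rho v & (wmap w @` K) y.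
Proof. by case: hK => _ _ hK'; apply: cut_cover. Qed.

Lemma wmap_subK w : wmap w @` K `<=` K.
Proof.
case: hK => _ _ KE; elim: w => [|i w IH] x [z Kz <-] //=.
by rewrite KE; exists i => //; exists (wmap w z) => //; apply: IH; exists z.
Qed.

Lemma exists_diameter (x : 'rV[R]_d) :
  exists2 D, 1 <= D & forall y, K y -> enorm (y - x) <= D.
Proof.
case: hK => _ /compact_bounded [M [_ hM]] _.
exists (Num.max 1 (d%:R * (`|M| + 1) + enorm x)).
  by rewrite le_max lexx.
move=> y Ky; rewrite le_max; apply/orP; right.
apply: le_trans (enormD _ _) _; rewrite enormN lerD2r.
apply: le_trans (enorm_le_mx_norm _) _; rewrite ler_wpM2l//.
by apply: (hM (`|M| + 1)) => //; have := ler_norm M; lra.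
Qed.

Lemma closed_wmapK w : closed (wmap w @` K).
Proof.
case: hK => _ cK _.
have clK : closed K by apply: compact_closed cK; exact: norm_hausdorff.
rewrite -[_ @` K]setCK; apply: open_closedC; apply: open_enormP => // y.
have [z <-] := wmap_surj hS w y => nKz.
have nz : (~` K) z by move=> Kz; apply: nKz; exists z.
have [e e0 he] := open_enorm_ball (closed_openC clK) nz.
exists (ratio w * e); first by rewrite mulr_gt0// (ratio_gt0 hS).
move=> y' + [z' Kz' zE]; rewrite -zE (wmap_dist hS).
by rewrite ltr_pM2l ?(ratio_gt0 hS)// => /he; apply.
Qed.

Section OpenSet.
Variables (U : set 'rV[R]_d) (y1 : 'rV[R]_d) (a : R).
Hypothesis Usub : forall i, S i @` U `<=` U.
Hypothesis Udisj : forall i j, i != j -> S i @` U `&` S j @` U = set0.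
Hypothesis a0 : 0 < a.
Hypothesis Uball : forall y, enorm (y - y1) < a -> U y.

(** Being onto, [wmap w] carries the ball of radius [a] about [y1] onto the ball of radius
    [a * ratio w] about [wmap w y1]; the latter lies in the image of [U], so it misses
    [wmap w' y1]. *)
Lemma disjoint_separated w w' : wmap w @` U `&` wmap w' @` U = set0 ->
  a * ratio w <= enorm (wmap w y1 - wmap w' y1).
Proof.
move=> ww; rewrite leNgt; apply/negP => lt.
have [z zE] := wmap_surj hS w (wmap w' y1).
have : (wmap w @` U `&` wmap w' @` U) (wmap w' y1).
  split; last by exists y1 => //; apply: Uball; rewrite subrr enorm0.
  exists z => //; apply: Uball.
  rewrite enormBC -(ltr_pM2l (ratio_gt0 hS w)) -(wmap_dist hS) zE.
  by rewrite [ltRHS]mulrC.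
by rewrite ww.
Qed.

Variable y0 : 'rV[R]_d.

(** The separated points are the [wmap w y1], because the ball inside [U] sits at [y1]; passing
    there from [y0] costs at most [enorm (y1 - y0) * rho], whence the numerator of [q]. *)
Lemma stop_packing (L : R) : 0 <= L -> exists C : nat, forall rho x,
  0 < rho <= 1 -> forall s, uniq s -> {subset s <= stop rho [::]} ->
  {in s, forall w, enorm (wmap w y0 - x) <= L * rho} -> (size s <= C)%N.
Proof.
move=> L0; have ami := amin_gt0 hS.
pose q := (L + enorm (y1 - y0)) / (a * amin).
exists ((Num.truncn (2 * q * d.+1%:R)).+1 ^ d)%N => rho x rho01 s us sub near.
have /andP[r0 r1] := rho01.
apply: (@packing _ _ _ s (fun w => wmap w y1) x (a * amin * rho)) => //.
- by rewrite !mulr_gt0.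
- by rewrite divr_ge0 ?addr_ge0 ?enorm_ge0// ltW// mulr_gt0.
- move=> w w' ws ws' ww'.
  apply: (@le_trans _ _ (a * ratio w)).
    by rewrite -mulrA ler_pM2l// ltW// stop0_gt// sub.
  apply: disjoint_separated; apply: cut_disjoint => //; first exact: sub.
  exact: sub.
- move=> w ws; apply: le_trans (enorm_triangle (wmap w y0) _ _) _.
  rewrite /q -mulrA mulKf; last by rewrite gt_eqF// mulr_gt0.
  rewrite (wmap_dist hS) mulrDl addrC lerD//; first exact: near.
  rewrite mulrC ler_wpM2l ?enorm_ge0//.
  exact: stop_le r0 (sub _ ws).
Qed.

Variable t : R.
Hypothesis t0 : 0 <= t.
Hypothesis ht : \sum_i alpha i `^ t = 1.
Hypothesis Ky0 : K y0.

Definition meets (A : set 'rV[R]_d) w := `[< wmap w @` K `&` A !=set0 >].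

(* Cutting at the coarser scale [r] first bounds the number of pieces of size
   [rho] near a set of diameter [r] by [(r / rho)^t], not only [(r / rho)^d]. *)
Lemma stop_count : exists2 C, 0 < C & forall rho r A, 0 < rho <= r -> r <= 1 ->
  (forall x y, A x -> A y -> enorm (x - y) <= r) ->
  (size [seq w <- stop rho [::] | meets A w])%:R <= C * (r / rho) `^ t.
Proof.
have [D D1 hD] := exists_diameter y0.
have [C hC] := @stop_packing (D + 1) ltac:(lra).
have ami := amin_gt0 hS.
exists ((C%:R + 1) * amin `^ (- t)).
  by rewrite mulr_gt0 ?powR_gt0// ltr_wpDl.
move=> rho r A /andP[rho0 rhor] r1 diamA.
have r0 : 0 < r by exact: lt_le_trans rhor.
have mA w u : meets A (w ++ u) -> meets A w.
  move=> /asboolP[x [[z Kz <-] Ax]]; apply/asboolP; exists (wmap (w ++ u) z).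
  split=> //; exists (wmap u z); last by rewrite wmap_cat.
  by apply: wmap_subK; exists z.
have := @cut_refine _ _ _ S _ hS t ht (stop_fuel rho) (stop_fuel r) rho r
  [::] (meets A) rhor (stop_fuelP _ rho0) (stop_fuelP _ r0) mA.
rewrite -/(stop rho _) -/(stop r _) => ref.
have sz : (size [seq w <- stop r [::] | meets A w] <= C)%N.
  have [->|] := eqVneq [seq w <- stop r [::] | meets A w] [::] => //.
  rewrite -has_filter => /hasP[w0 w0r /asboolP[x [_ Ax]]].
  apply: (hC r x); [by rewrite r0|by rewrite filter_uniq// cut_uniq| |].
    by move=> w; rewrite mem_filter => /andP[].
  move=> w; rewrite mem_filter => /andP[/asboolP[y [[z Kz <-] Ay]] ws].
  apply: le_trans (enorm_triangle (wmap w z) _ _) _.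
  rewrite (wmap_dist hS) mulrDl mul1r lerD ?diamA// mulrC enormBC.
  apply: ler_pM; rewrite ?enorm_ge0 ?(ltW (ratio_gt0 hS _))//.
    exact: hD.
  exact: stop_le r0 ws.
have lo : (size [seq w <- stop rho [::] | meets A w])%:R * (amin * rho) `^ t
    <= \sum_(w <- stop rho [::] | meets A w) ratio w `^ t.
  rewrite -big_filter -sum1_size natr_sum mulr_suml big_seq [leRHS]big_seq.
  apply: ler_sum => w; rewrite mem_filter => /andP[_ ws]; rewrite mul1r.
  apply: ge0_ler_powR => //; rewrite ?nnegrE ?mulr_ge0 ?(ltW ami) ?(ltW rho0)//.
    by rewrite ltW// (ratio_gt0 hS).
  by rewrite ltW// stop0_gt// rho0 (le_trans rhor r1).
have up : \sum_(w <- stop r [::] | meets A w) ratio w `^ t <= C%:R * r `^ t.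
  apply: (@le_trans _ _ (\sum_(w <- stop r [::] | meets A w) r `^ t)).
    rewrite big_seq_cond [leRHS]big_seq_cond; apply: ler_sum => w /andP[ws _].
    apply: ge0_ler_powR => //; rewrite ?nnegrE ?(ltW r0)//.
      by rewrite ltW// (ratio_gt0 hS).
    exact: stop_le r0 ws.
  rewrite -big_filter big_const_seq count_predT iter_addr_0 -[leLHS]mulr_natl.
  by rewrite ler_wpM2r ?powR_ge0// ler_nat.
have pos : 0 < (amin * rho) `^ t by rewrite powR_gt0// mulr_gt0.
rewrite -(ler_pM2r pos); apply: le_trans lo _; apply: le_trans ref _.
apply: le_trans up _.
have -> : (C%:R + 1) * amin `^ (- t) * (r / rho) `^ t * (amin * rho) `^ t
   = (C%:R + 1) * r `^ t.
  rewrite (powRM _ (ltW ami) (ltW rho0)).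
  rewrite [(r / rho) `^ t]powRM ?invr_ge0 ?(ltW r0) ?(ltW rho0)//.
  rewrite -[rho^-1]powR_inv1 ?(ltW rho0)// -powRrM mulN1r !powRN.
  have p1 : amin `^ t != 0 by rewrite gt_eqF// powR_gt0.
  have p2 : rho `^ t != 0 by rewrite gt_eqF// powR_gt0.
  by field; rewrite p1 p2.
by rewrite ler_wpM2r ?powR_ge0// lerDl.
Qed.

End OpenSet.
End StoppedWords.

(** * Hausdorff measure: coverings and mass distribution *)

Section PowR.
Context {R : realType}.
Implicit Types x t : R.

Lemma powRXn x n t : 0 <= x -> (x ^+ n) `^ t = (x `^ t) ^+ n.
Proof.
move=> x0; rewrite -powR_mulrn// -powRrM mulrC powRrM powR_mulrn//.
exact: powR_ge0.
Qed.

Lemma powRVl x t : 0 <= x -> x^-1 `^ t = (x `^ t)^-1.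
Proof. by move=> x0; rewrite -powR_inv1// -powRrM mulN1r powRN. Qed.

End PowR.

Section Hausdorff.
Context {R : realType} {d : nat}.
Implicit Types (A U : set 'rV[R]_d) (t r e : R).

Lemma ediam_leP U r :
  (forall x y, U x -> U y -> enorm (x - y) <= r) <-> (ediam U <= r%:E)%E.
Proof.
split=> [h|h x y Ux Uy].
  by apply: ge_ereal_sup => _ [[x y] [/= Ux Uy] <-]; rewrite lee_fin h.
by rewrite -lee_fin; apply: le_trans h; apply: ereal_sup_ubound; exists (x, y).
Qed.

Lemma ediam_ge0 U : U !=set0 -> (0 <= ediam U)%E.
Proof.
move=> [x Ux]; apply: ereal_sup_ubound; exists (x, x) => //=.
by rewrite subrr enorm0.
Qed.

Lemma hausdorff_gauge_ge0 t U : (0 <= hausdorff_gauge t U)%E.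
Proof. by rewrite /hausdorff_gauge; case: ifP => // _; exact: poweR_ge0. Qed.

Lemma hausdorff_gauge_le t U r : 0 <= t -> 0 <= r ->
  (forall x y, U x -> U y -> enorm (x - y) <= r) ->
  (hausdorff_gauge t U <= (r `^ t)%:E)%E.
Proof.
move=> t0 r0 /ediam_leP Ur; rewrite /hausdorff_gauge.
case: eqVneq => [_|/set0P U0]; first by rewrite lee_fin powR_ge0.
rewrite -poweR_EFin; apply: gt0_ler_poweR => //.
  by rewrite in_itv/= ediam_ge0// leey.
by rewrite in_itv/= lee_fin r0 leey.
Qed.

Lemma hausdorff_premeasure_ge0 t e A : (0 <= hausdorff_premeasure t e A)%E.
Proof.
apply: le_ereal_inf_tmp => _ [U _ <-]; apply: nneseries_ge0 => k _ _.
exact: hausdorff_gauge_ge0.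
Qed.

Lemma hausdorff_measure0P t A : hausdorff_measure t A = 0%E <->
  forall delta e, 0 < delta -> 0 < e -> exists U : nat -> set 'rV[R]_d,
  [/\ forall k, (ediam (U k) <= delta%:E)%E, A `<=` \bigcup_k U k &
      (\sum_(k <oo) hausdorff_gauge t (U k) < e%:E)%E].
Proof.
split=> [h delta e delta0 e0|h].
  have : (hausdorff_premeasure t delta A < e%:E)%E.
    apply: (@le_lt_trans _ _ 0%E); last by rewrite lte_fin.
    by rewrite -h; apply: ereal_sup_ubound; exists delta.
  by move=> /ereal_inf_lt [_ [U [Ud AU] <-] Ue]; exists U.
apply/eqP; rewrite eq_le; apply/andP; split.
  apply: ge_ereal_sup => _ [delta /= delta0 <-].
  apply/lee_addgt0Pr => e e0; rewrite add0e.
  have [U [Ud AU Ue]] := h delta e delta0 e0.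
  by apply: le_trans (ltW Ue); apply: ereal_inf_lbound; exists U.
apply: le_trans (hausdorff_premeasure_ge0 t 1 A) _.
by apply: ereal_sup_ubound; exists 1 => //=.
Qed.

Lemma hausdorff_measure0_mono t t' A : 0 <= t -> t <= t' ->
  hausdorff_measure t A = 0%E -> hausdorff_measure t' A = 0%E.
Proof.
move=> t0 tt' /hausdorff_measure0P h; apply/hausdorff_measure0P => delta e d0 e0.
have m0 : 0 < Num.min delta 1 by rewrite lt_min d0 ltr01.
have [U [Ud AU Ue]] := h (Num.min delta 1) e m0 e0.
exists U; split=> //.
  by move=> k; apply: le_trans (Ud k) _; rewrite lee_fin ge_min lexx.
apply: le_lt_trans Ue; apply: lee_nneseries => k *.
  exact: hausdorff_gauge_ge0.
rewrite /hausdorff_gauge; case: eqVneq => // /set0P U0.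
have := Ud k; have := ediam_ge0 U0; case: (ediam (U k)) => // r.
rewrite !lee_fin => r0; rewrite le_min => /andP[_ r1].
(* Diameter 0 is treated apart because of [0 ^ 0 = 1]: for [t = 0] the old gauge is already 1,
   otherwise both gauges vanish. *)
have [->|rn0] := eqVneq r 0.
  have [->|tn0] := eqVneq t 0.
    rewrite powRr0; by have [->|tn0] := eqVneq t' 0; [rewrite powRr0|rewrite powR0].
  by rewrite !powR0//; apply/eqP => E; case/eqP: tn0; lra.
by apply: ger_powR => //; rewrite r1 lt_neqAle eq_sym rn0 r0.
Qed.

Lemma hausdorff_dim_le t A : 0 <= t -> hausdorff_measure t A = 0%E ->
  (hausdorff_dim A <= t%:E)%E.
Proof. by move=> t0 h; apply: ereal_inf_lbound; exists t. Qed.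

Lemma hausdorff_dim_ge t A :
  (forall t', 0 <= t' < t -> hausdorff_measure t' A <> 0%E) ->
  (t%:E <= hausdorff_dim A)%E.
Proof.
move=> h; apply: le_ereal_inf_tmp => _ [t' [t'0 At'] <-].
by rewrite lee_fin leNgt; apply/negP => tt'; apply: (h t') => //; rewrite t'0.
Qed.

(** A Borel-Cantelli argument: level [j] contributes at most [C * D ^ t * q ^ j] with
    [q = 2 ^ (g - t) < 1], so the tails are arbitrarily small, while each tail still covers [A]. *)
Lemma limsup_cover_null (A : set 'rV[R]_d) (L : nat -> seq (set 'rV[R]_d))
    (C D g t : R) : 0 < D -> 0 <= g -> g < t ->
  (forall j V, V \in L j -> forall x y, V x -> V y ->
     enorm (x - y) <= D * (2^-1) ^+ j) ->
  (forall j, (size (L j))%:R <= C * (2 `^ g) ^+ j) ->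
  (forall J x, A x -> exists j V, [/\ (J <= j)%N, V \in L j & V x]) ->
  hausdorff_measure t A = 0%E.
Proof.
move=> D0 g0 gt diamL sizeL coverL; apply/hausdorff_measure0P => delta e delta0 e0.
have t0 : 0 < t by exact: le_lt_trans gt.
have C0 : 0 <= C.
  by apply: le_trans (_ : (size (L 0%N))%:R <= _) => //; have := sizeL 0%N; rewrite expr0 mulr1.
pose q : R := 2 `^ (g - t).
have q0 : 0 < q by exact: powR_gt0.
have q1 : q < 1.
  by rewrite -(powRr0 2) /q /powR !pnatr_eq0/= ltr_expR ltr_pM2r ?ln_gt0 ?ltr1n//; lra.
have qn : `|q| < 1 by rewrite gtr0_norm.
have Dt0 : 0 < D `^ t by exact: powR_gt0.
have [J [J1 J2]] : exists J : nat, D * (2^-1) ^+ J <= delta /\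
    C * D `^ t * q ^+ J / (1 - q) < e.
  have h1 : `|2^-1 : R| < 1 by rewrite ger0_norm ?invf_lt1// ltr1n.
  have /cvgrPdist_lt /(_ (delta / D)) := cvg_expr h1.
  move=> /(_ (divr_gt0 delta0 D0)) [J1 _ hJ1].
  have e'0 : 0 < e * (1 - q) / (C * D `^ t + 1).
    rewrite divr_gt0 ?mulr_gt0 ?subr_gt0// ltr_wpDl// mulr_ge0// ltW//.
  have /cvgrPdist_lt /(_ _ e'0) := cvg_expr qn.
  move=> [J2 _ hJ2]; exists (maxn J1 J2); split.
    have := hJ1 (maxn J1 J2) (leq_maxl _ _).
    rewrite /= sub0r normrN ger0_norm ?exprn_ge0// ltr_pdivlMr// mulrC.
    exact: ltW.
  have := hJ2 (maxn J1 J2) (leq_maxr _ _).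
  rewrite /= sub0r normrN ger0_norm ?exprn_ge0 ?(ltW q0)//.
  rewrite ltr_pdivlMr; last by rewrite ltr_wpDl// mulr_ge0// ltW.
  rewrite ltr_pdivrMr ?subr_gt0//; apply: le_lt_trans.
  by rewrite mulrC ler_pM2l ?exprn_gt0// lerDl.
(* The tail is enumerated by pairs of a level and a rank; ranks beyond the end of a list give the
   empty set, whose gauge is 0. *)
pose V (p : nat * nat) : set 'rV[R]_d := nth set0 (L (J + p.1)%N) p.2.
have diamV p x y : V p x -> V p y -> enorm (x - y) <= D * (2^-1) ^+ (J + p.1).
  rewrite /V; have [lt|ge] := ltnP p.2 (size (L (J + p.1)%N)).
    by apply: diamL; exact: mem_nth.
  by rewrite nth_default.
have /card_esym/ppcard_eqP[f] := card_nat2.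
exists (V \o f); split.
- move=> k; apply/ediam_leP => x y /diamV h /h; move=> h'; apply: le_trans h' _.
  apply: le_trans J1; rewrite ler_pM2l// exprD ler_piMr ?exprn_ge0//.
  by rewrite exprn_ile1//; lra.
- move=> x Ax; have [j [W [Jj WL Wx]]] := coverL J x Ax.
  have [k _ fk] : exists2 k, True & f k = ((j - J)%N, index W (L j)).
    have [k _ <-] := 'surj_f (I : [set: nat * nat] ((j - J)%N, index W (L j))).
    by exists k.
  by exists k => //=; rewrite fk /V /= subnKC// nth_index.
have V0 p : (0 <= hausdorff_gauge t (V p))%E by exact: hausdorff_gauge_ge0.
rewrite nneseries_esumT; last by move=> n; exact: V0.
rewrite [X in (X < _)%E](_ : _ = \esum_(p in [set: nat * nat]) hausdorff_gauge t (V p)); last first.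
  by rewrite (reindex_esum [set: nat] [set: nat * nat] f)//; exact: 'bij_f.
have -> : [set: nat * nat] = [set: nat] `*`` (fun=> [set: nat]).
  by apply/seteqP; split.
rewrite -(@esum_esum _ _ _ _ _ (fun i j => hausdorff_gauge t (V (i, j))))//.
have row i : (\esum_(j in [set: nat]) hausdorff_gauge t (V (i, j)) <=
    (C * D `^ t * q ^+ J * q ^+ i)%:E)%E.
  rewrite -nneseries_esumT//.
  rewrite (@nneseries_split _ _ 0 (size (L (J + i)%N)))// add0n.
  rewrite [X in (_ + X <= _)%E]eseries0 ?adde0; last first.
    by move=> j sj _; rewrite /V nth_default// /hausdorff_gauge eqxx.
  apply: (@le_trans _ _ (\sum_(0 <= k < size (L (J + i)%N))
      ((D * (2^-1) ^+ (J + i)) `^ t)%:E)%E).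
    apply: lee_sum => k _; apply: hausdorff_gauge_le; first exact: ltW.
      by rewrite mulr_ge0 ?exprn_ge0// ltW.
    by move=> x y; exact: (diamV (i, k)).
  rewrite sumEFin lee_fin sumr_const_nat subn0.
  rewrite -[leLHS]mulr_natl powRM ?exprn_ge0 ?(ltW D0)//.
  apply: (@le_trans _ _ (C * (2 `^ g) ^+ (J + i) * (D `^ t * ((2^-1) ^+ (J + i)) `^ t))).
    by rewrite ler_wpM2r// mulr_ge0 ?powR_ge0.
  rewrite le_eqVlt; apply/orP; left; apply/eqP.
  have -> : ((2^-1 : R) ^+ (J + i)) `^ t = (2 `^ (- t)) ^+ (J + i).
    by rewrite powRXn ?invr_ge0// powRVl// powRN.
  rewrite -[RHS]mulrA -exprD /q powRD ?pnatr_eq0 ?implybT// exprMn; ring.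
apply: le_lt_trans (_ : ((C * D `^ t * q ^+ J / (1 - q))%:E < e%:E)%E); last by rewrite lte_fin.
apply: (@le_trans _ _ (\esum_(i in [set: nat]) (C * D `^ t * q ^+ J * q ^+ i)%:E)%E).
  by apply: le_esum => i _; exact: row.
have pos i : (0 <= (C * D `^ t * q ^+ J * q ^+ i)%:E)%E.
  by rewrite lee_fin !mulr_ge0 ?exprn_ge0 ?powR_ge0// ltW.
rewrite -nneseries_esumT//; apply: lime_le; first exact: is_cvg_nneseries.
apply: nearW => n; rewrite sumEFin lee_fin -[leLHS]/(series (geometric _ q) n).
by apply: geometric_le_lim => //; rewrite !mulr_ge0 ?exprn_ge0 ?powR_ge0// ltW.
Qed.

(** Each piece of a cover pulls back to mass at most [C] times its gauge, and countable
    subadditivity adds these up; an outer measure is all this asks for. *)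
Lemma mass_distribution (T : Type) (nu : {outer_measure set T -> \bar R})
    (B : set T) (f : T -> 'rV[R]_d) (A : set 'rV[R]_d) (C t r0 : R) :
  0 < t -> 0 <= C -> 0 < r0 ->
  (forall U r, 0 < r < r0 -> (forall x y, U x -> U y -> enorm (x - y) <= r) ->
     (nu (B `&` f @^-1` U) <= (C * r `^ t)%:E)%E) ->
  hausdorff_measure t A = 0%E -> nu (B `&` f @^-1` A) = 0%E.
Proof.
move=> t0 C0 r00 hU /hausdorff_measure0P hA.
apply/eqP; rewrite eq_le outer_measure_ge0 andbT.
apply/lee_addgt0Pr => e e0; rewrite add0e.
have r20 : 0 < r0 / 2 by lra.
have e10 : 0 < e / (C + 1) by rewrite divr_gt0//; lra.
have [U [Ud AU Ue]] := hA _ _ r20 e10.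
have gaugeU k : (nu (B `&` f @^-1` U k) <= C%:E * hausdorff_gauge t (U k))%E.
  rewrite /hausdorff_gauge; case: eqVneq => [->|/set0P U0].
    by rewrite preimage_set0 setI0 outer_measure0 mule0.
  have := Ud k; have := ediam_ge0 U0.
  case E : (ediam (U k)) => [r| |] //; rewrite !lee_fin => r_ge0 r_le.
  have Ur : forall x y, U k x -> U k y -> enorm (x - y) <= r.
    by apply/ediam_leP; rewrite E.
  have [r0E|rn0] := eqVneq r 0; last first.
    by rewrite poweR_EFin -EFinM; apply: hU => //; rewrite lt_neqAle eq_sym rn0 r_ge0; lra.
  rewrite r0E poweR_EFin powR0 ?gt_eqF// mule0.
  apply/lee_addgt0Pr => e' e'0; rewrite add0e.
  (* The mass bound concerns positive radii. A piece of diameter 0 fits every such radius, and this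
     one makes [C * r' ^ t] at most [e']. *)
  pose r' := Num.min (r0 / 2) ((e' / (C + 1)) `^ t^-1).
  have e'1 : 0 < e' / (C + 1) by rewrite divr_gt0//; lra.
  have r'0 : 0 < r' by rewrite lt_min r20 powR_gt0.
  have r'1 : r' < r0 by rewrite gt_min; apply/orP; left; lra.
  apply: le_trans (hU (U k) r' _ _) _; first by rewrite r'0.
    by move=> x y Ux Uy; apply: le_trans (Ur _ _ Ux Uy) _; rewrite r0E ltW.
  rewrite lee_fin; have : r' `^ t <= e' / (C + 1).
    have -> : e' / (C + 1) = ((e' / (C + 1)) `^ t^-1) `^ t.
      by rewrite -powRrM mulVf ?gt_eqF// powRr1// ltW.
    apply: ge0_ler_powR; rewrite ?nnegrE ?powR_ge0 ?(ltW t0) ?(ltW r'0)//.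
    by rewrite ge_min lexx orbT.
  rewrite ler_pdivlMr; last lra.
  by have := powR_ge0 r' t; nra.
apply: (@le_trans _ _ (\sum_(k <oo) nu (B `&` f @^-1` U k))%E).
  apply: le_trans (outer_measure_sigma_subadditive nu _).
  apply: le_outer_measure => x [Bx /AU [k _ Ukx]].
  by exists k.
apply: (@le_trans _ _ (\sum_(k <oo) C%:E * hausdorff_gauge t (U k))%E).
  by apply: lee_nneseries => k *; [exact: outer_measure_ge0|exact: gaugeU].
rewrite nneseriesZl; last by move=> k _; exact: hausdorff_gauge_ge0.
apply: (@le_trans _ _ (C%:E * (e / (C + 1))%:E)%E).
  by apply: lee_wpmul2l => //; exact: ltW.
rewrite -EFinM lee_fin mulrCA ler_piMr ?(ltW e0)// ler_pdivrMr; lra.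
Qed.

End Hausdorff.

(** * Cantor subsets *)

Section UniformSubdivision.
Context {R : realType}.

(* The outer measure is used because no measurability is known for the maps
   [0,1[ -> R^d along which it is transported. *)
Definition leb_outer : set R -> \bar R := (wlength idfun)^*%mu.
HB.instance Definition _ := OuterMeasure.copy leb_outer ((wlength idfun)^*%mu).

Lemma leb_outer_itv (a b : R) : a <= b -> leb_outer `[a, b[%classic = (b - a)%:E.
Proof.
move=> ab; have := @lebesgue_measure_itv R `[a, b[.
rewrite /lebesgue_measure /lebesgue_stieltjes_measure /measure_extension /=.
rewrite -/leb_outer => -> /=; rewrite lte_fin.
case: ltP => // ba; congr _%:E; lra.
Qed.

(** When each interval is split into [n], this recovers the index of the parent interval from that
    of the child. *)
Lemma truncn_divn (y : R) (n : nat) : 0 <= y -> (0 < n)%N ->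
  (Num.truncn (y * n%:R) %/ n = Num.truncn y)%N.
Proof.
move=> y0 n0; apply/esym/truncn_def.
have yn0 : 0 <= y * n%:R by rewrite mulr_ge0.
have nR : 0 < n%:R :> R by rewrite ltr0n.
have /andP[m1 m2] := truncn_itv yn0.
rewrite -(ler_pM2r nR) -(ltr_pM2r nR) -!natrM; apply/andP; split.
  by apply: le_trans m1; rewrite ler_nat leq_trunc_div.
apply: lt_le_trans m2 _; rewrite ler_nat.
by rewrite mulnC mulnS mulnC ltn_ceil.
Qed.

Lemma leb_outer_index (N : nat) (a : pred nat) (B : set R) : (0 < N)%N ->
  (forall x, B x -> 0 <= x < 1 /\ a (Num.truncn (x * N%:R))) ->
  (leb_outer B <= ((count a (iota 0 N))%:R / N%:R)%:E)%E.
Proof.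
move=> N0 hB; have NR : 0 < N%:R :> R by rewrite ltr0n.
pose F i : set R := if a i then `[i%:R / N%:R, i.+1%:R / N%:R[%classic else set0.
apply: (@le_trans _ _ (leb_outer (\big[setU/set0]_(i < N) F i))).
  apply: le_outer_measure => x /hB[/andP[x0 x1] ax].
  rewrite -bigcup_mkord; exists (Num.truncn (x * N%:R)) => /=.
    by rewrite truncn_lt_nat ?mulr_ge0// gtr_pMl.
  rewrite /F ax /= in_itv /= ler_pdivrMr// ltr_pdivlMr//.
  by apply: truncn_itv; rewrite mulr_ge0.
apply: le_trans (outer_measure_subadditive _ _ _) _.
rewrite -sum1_count natr_sum mulr_suml -sumEFin.
rewrite -(big_mkord xpredT (fun i => leb_outer (F i))) /index_iota subn0.
rewrite [leRHS]big_mkcond /=; apply: lee_sum => i _; rewrite /F.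
case: ifP => _; last by rewrite outer_measure0.
rewrite leb_outer_itv; last by rewrite ler_pM2r ?invr_gt0// ler_nat.
by rewrite lee_fin -mulrBl -natr1 addrAC subrr add0r.
Qed.

End UniformSubdivision.

Lemma nested_compact (T : topologicalType) (K : set T) (A : nat -> set T) :
  compact K -> (forall k, closed (A k)) -> (forall k, A k !=set0) ->
  (forall k, A k `<=` K) -> (forall k, A k.+1 `<=` A k) ->
  exists p, forall k, A k p.
Proof.
move=> cK clA ne subA decA.
have [y hy] := choice ne.
have dec k n : A (k + n)%N `<=` A k.
  by elim: n => [|n IH]; [rewrite addn0|rewrite addnS => x /decA /IH].
have yA k : (y @ \oo) (A k).
  exists k => // n /= kn; rewrite -(subnKC kn).
  by apply: dec; exact: hy.
have [|p [_ clp]] := cK (y @ \oo) _.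
  by apply: filterS (yA 0%N); exact: subA.
exists p => k; apply: (clA k) => B Bp.
exact: (clp (A k) B (yA k) Bp).
Qed.

(** Meant for radii between the atom scale [ell] and the parent size [rr]. The proportion of pieces
    hit is at most [C / c * (r / rr) ^ t / n1], where [1 / n1 <= rr ^ e] is the mass of a parent; as
    [e <= t] and [r <= rr], the powers of [rr] cancel. *)
Lemma parent_cell_count (R : realType) (C n1 rr r ell t e c N : R) :
  0 < C -> 0 < c -> 0 < n1 -> 0 < r -> 0 < ell -> r <= rr -> e <= t ->
  n1^-1 <= rr `^ e -> c * n1 * (rr / ell) `^ t <= N ->
  C * (r / ell) `^ t / N <= C / c * r `^ e.
Proof.
move=> C0 c0 n0 r0 ell0 rrr et n1e Nlow.
have rr0 : 0 < rr by exact: lt_le_trans rrr.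
have re0 : 0 < (r / ell) `^ t by rewrite powR_gt0// divr_gt0.
have rre0 : 0 < (rr / ell) `^ t by rewrite powR_gt0// divr_gt0.
have pos1 : 0 < c * n1 * (rr / ell) `^ t by rewrite !mulr_gt0.
apply: (@le_trans _ _ (C * (r / ell) `^ t / (c * n1 * (rr / ell) `^ t))).
  rewrite ler_pM2l; last exact: mulr_gt0.
  by rewrite lef_pV2 ?posrE//; exact: lt_le_trans Nlow.
have e1 : ell `^ t != 0 by rewrite gt_eqF// powR_gt0.
have e2 : rr `^ t != 0 by rewrite gt_eqF// powR_gt0.
have -> : C * (r / ell) `^ t / (c * n1 * (rr / ell) `^ t)
  = C / c * ((r / rr) `^ t * n1^-1).
  rewrite !powRM ?invr_ge0 ?(ltW r0) ?(ltW ell0) ?(ltW rr0)//.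
  rewrite !powRVl ?(ltW ell0) ?(ltW rr0)//; field.
  by rewrite e1 e2 !gt_eqF.
rewrite ler_pM2l ?divr_gt0//.
apply: (@le_trans _ _ ((r / rr) `^ e * rr `^ e)).
  apply: ler_pM => //; rewrite ?powR_ge0 ?invr_ge0 ?(ltW n0)//.
  by apply: ger_powR => //; rewrite divr_gt0//= ler_pdivrMr// mul1r.
by rewrite -powRM ?divr_ge0 ?(ltW r0) ?(ltW rr0)// divfK ?gt_eqF.
Qed.

Section CantorSubset.
Context {R : realType} {d m : nat}.
Variables (S : 'I_m -> 'rV[R]_d -> 'rV[R]_d) (alpha : 'I_m -> R).
Hypothesis hS : forall i, contractive_similitude (alpha i) (S i).
Variable K : set 'rV[R]_d.
Hypothesis hd : (0 < d)%N.
Hypothesis hK : self_similar_set S K.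
Variables (U : set 'rV[R]_d) (y1 : 'rV[R]_d) (a : R).
Hypothesis Usub : forall i, S i @` U `<=` U.
Hypothesis Udisj : forall i j, i != j -> S i @` U `&` S j @` U = set0.
Hypothesis a0 : 0 < a.
Hypothesis Uball : forall y, enorm (y - y1) < a -> U y.
Variables (y0 : 'rV[R]_d) (t : R).
Hypothesis ht : \sum_i alpha i `^ t = 1.
Hypothesis Ky0 : K y0.
Variables (J : set nat) (h : R).
Hypothesis infJ : forall N, exists2 j, (N <= j)%N & J j.
Hypothesis h0 : 0 < h.
Hypothesis hlet : h <= t.
Implicit Types (u v w : seq 'I_m) (rho : R).
Local Notation wmap := (wmap S).
Local Notation ratio := (ratio alpha).
Local Notation amin := (amin alpha).
Local Notation stop := (stop alpha).

Definition scale (j : nat) : R := 2^-1 ^+ j.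
(** Mass about [scale j ^ t] found within this distance produces the local exponent [h]. *)
Definition rad (j : nat) : R := scale j `^ (t / h).
(** Increases to [h]; the gap pays for the constants of generation [k]. The shift by 2 makes
    [expo 0 = h / 2] positive. *)
Definition expo (k : nat) : R := h * (1 - k.+2%:R^-1).

Let t0 : 0 < t. Proof. exact: lt_le_trans hlet. Qed.

Lemma scale_gt0 j : 0 < scale j.
Proof. by rewrite exprn_gt0. Qed.

Lemma scale_le1 j : scale j <= 1.
Proof. by rewrite exprn_ile1//; lra. Qed.

Lemma scale_small (e : R) : 0 < e -> exists N, forall j, (N <= j)%N -> scale j < e.
Proof.
move=> e0; have h1 : `|2^-1 : R| < 1 by rewrite ger0_norm ?invf_lt1// ltr1n.
have /cvgrPdist_lt /(_ _ e0) [N _ hN] := cvg_expr h1.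
exists N => j /hN /=; rewrite sub0r normrN ger0_norm ?exprn_ge0//.
Qed.

Lemma rad_gt0 j : 0 < rad j.
Proof. by rewrite powR_gt0// scale_gt0. Qed.

Lemma rad_le_scale j : rad j <= scale j.
Proof.
rewrite -[leRHS]powRr1 ?(ltW (scale_gt0 _))//.
apply: ger_powR; first by rewrite scale_gt0 scale_le1.
by rewrite ler_pdivlMr// mul1r.
Qed.

Lemma expo_le k : expo k <= h.
Proof. by rewrite /expo ger_pMr// gerBl invr_ge0. Qed.

Lemma expo_gt0 k : 0 < expo k.
Proof. by rewrite /expo mulr_gt0// subr_gt0 invf_lt1 ?ltr1n. Qed.

Lemma expo_mono k k' : (k <= k')%N -> expo k <= expo k'.
Proof.
by move=> kk; rewrite /expo ler_pM2l// lerB// lef_pV2 ?posrE// ler_nat.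
Qed.

Lemma expo_cvg h' : h' < h -> exists k, h' <= expo k.
Proof.
move=> hh; exists (Num.truncn (h / (h - h'))).
have hh0 : 0 < h - h' by rewrite subr_gt0.
set n := Num.truncn _; have : h / (h - h') < n.+2%:R.
  by apply: lt_le_trans (truncnS_gt _) _; rewrite ler_nat.
rewrite ltr_pdivrMr// /expo => H.
have : h * n.+2%:R^-1 <= h - h'.
  by rewrite ler_pdivrMr// mulrC ltW.
by rewrite mulrBr mulr1 lerBrDl -lerBrDr.
Qed.

(* The [k]-th generation of the Cantor set consists of [num] pieces
   [wmap (node i) @` K], [i < num], of size about [rad lev]. *)
Record stage := Stage { lev : nat; num : nat; node : nat -> seq 'I_m }.

Definition stage_ok (k : nat) (s : stage) :=
  [/\ (0 < num s)%N,
      forall i, (i < num s)%N ->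
        amin * rad (lev s) < ratio (node s i) <= rad (lev s),
      forall i i', (i < num s)%N -> (i' < num s)%N -> i != i' ->
        wmap (node s i) @` U `&` wmap (node s i') @` U = set0 &
      (num s)%:R^-1 <= rad (lev s) `^ expo k].

(* Every piece has [n] children, the [i]-th piece being a child of the
   [i %/ n]-th one, so that index [i] corresponds to the interval
   [[i/num, (i+1)/num[]: the natural measure on the Cantor set is the image of
   Lebesgue measure.  The child [node s' i] is centred at [wmap (g i) y0],
   with [g i] a word cut at the scale [lev s'] belonging to [J]. *)
Definition stage_next (k : nat) (s s' : stage) := [/\ J (lev s'), (k < lev s')%N,
  scale (lev s') <= rad (lev s) &
  exists (n : nat) (g : nat -> seq 'I_m),
  [/\ (0 < n)%N, num s' = (num s * n)%N,
      amin `^ t / 2 * (num s)%:R * (rad (lev s) / scale (lev s')) `^ t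
        <= (num s')%:R,
      forall i, (i < num s')%N -> [/\ g i \in stop (scale (lev s')) [::],
        exists u, node s' i = node s (i %/ n) ++ u,
        exists u, node s' i = g i ++ u &
        (wmap (node s' i) @` K) (wmap (g i) y0)] &
      forall i i', (i < num s')%N -> (i' < num s')%N -> g i = g i' -> i = i']].

Lemma wmap_subU w x : U x -> U (wmap w x).
Proof.
by elim: w => //= i w IH /IH Ux; apply: (@Usub i); exists (wmap w x).
Qed.

Lemma wmap_disjoint_cat v u v' u' :
  wmap v @` U `&` wmap v' @` U = set0 ->
  wmap (v ++ u) @` U `&` wmap (v' ++ u') @` U = set0.
Proof.
move=> vv; rewrite -subset0 => _ [[x Ux <-] [x' Ux' /=]].
rewrite !wmap_cat => E; have /seteqP[+ _] := vv; apply; split.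
  by exists (wmap u x) => //; exact: wmap_subU.
by exists (wmap u' x') => //; exact: wmap_subU.
Qed.

Lemma wmap_disjoint_neq v u v' u' :
  wmap v @` U `&` wmap v' @` U = set0 -> v ++ u <> v' ++ u'.
Proof.
move=> /(wmap_disjoint_cat u u') + E; rewrite -E setIid => E0.
have : (wmap (v ++ u) @` U) (wmap (v ++ u) y1).
  by exists y1 => //; apply: Uball; rewrite subrr enorm0.
by rewrite E0.
Qed.

Lemma stage_step k s : stage_ok k s ->
  exists s', stage_ok k.+1 s' /\ stage_next k s s'.
Proof.
case: s => j N f [/= N0 fr fdisj fexp].
have ami := amin_gt0 hS.
have NR : 0 < N%:R :> R by rewrite ltr0n.
have rj0 := rad_gt0 j.
pose B := amin `^ t / 2 * N%:R * rad j `^ t.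
have at0 : 0 < amin `^ t by exact: powR_gt0.
have B0 : 0 < B by apply: mulr_gt0; [nra|exact: powR_gt0].
(* The first bound puts the new scale below the ratio of every node, so that [cut_root] applies. The
   second gives [scale j' ^ (t / (k + 3)) <= B], which is exactly the room between [t] and
   [t / h * expo k.+1]. *)
pose e := Num.min (amin * rad j) (B `^ (k.+3%:R / t)).
have e0 : 0 < e by rewrite /e lt_min; apply/andP; split; [exact: mulr_gt0|exact: powR_gt0].
have [M hM] := scale_small e0.
have [j' j'M Jj'] := infJ (maxn M k.+1).
have kj' : (k < j')%N by apply: leq_trans j'M; rewrite leq_maxr.
have : scale j' < e by apply: hM; apply: leq_trans j'M; rewrite leq_maxl.
rewrite /e lt_min => /andP[sc1 sc2].
have s0 := scale_gt0 j'.
pose X := (amin * rad j / scale j') `^ t.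
have X1 : 1 <= X.
  rewrite /X -[leLHS](powRr0 (amin * rad j / scale j')).
  by apply: ler_powR; [rewrite ler_pdivlMr// mul1r ltW|exact: ltW].
(* Every node has at least [X] words below it at the new scale; exactly [n] are kept, so that all
   pieces get the same mass. As [X >= 1], truncation costs at most the factor 2 in
   [amin ^ t / 2]. *)
pose n := Num.truncn X.
have n0 : (0 < n)%N by rewrite truncn_gt0.
have X0 : 0 <= X by lra.
have /andP[nX Xn] := truncn_itv X0.
have X2n : X <= 2 * n%:R.
  rewrite -natr1 in Xn; have : 1 <= n%:R :> R by rewrite ler1n.
  by rewrite -/n in Xn *; lra.
have sz i : (i < N)%N -> (n <= size (stop (scale j') (f i)))%N.
  move=> /fr /andP[fi1 fi2]; rewrite -(ler_nat R).
  apply: le_trans nX _; rewrite /X powRM ?invr_ge0 ?mulr_ge0 ?(ltW ami) ?(ltW rj0) ?(ltW s0)//.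
  rewrite powRVl ?(ltW s0)// ler_pdivrMr ?powR_gt0//.
  apply: (@le_trans _ _ (ratio (f i) `^ t)).
    apply: ge0_ler_powR; rewrite ?nnegrE; first exact: ltW.
    - by rewrite mulr_ge0 ?(ltW ami) ?(ltW rj0).
    - by rewrite ltW// (ratio_gt0 hS).
    - exact: ltW.
  rewrite -(cut_sum hS ht (stop_fuel alpha (scale j')) (scale j')) -/(stop _ _).
  rewrite -sum1_size natr_sum mulr_suml big_seq [leRHS]big_seq.
  apply: ler_sum => w wf; rewrite mul1r; apply: ge0_ler_powR; first exact: ltW.
  - by rewrite nnegrE ltW// (ratio_gt0 hS).
  - by rewrite nnegrE ltW.
  - exact: (stop_le hS s0 wf).
pose g i := nth [::] (stop (scale j') (f (i %/ n)%N)) (i %% n)%N.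
have gin i : (i < N * n)%N -> g i \in stop (scale j') (f (i %/ n)%N).
  move=> iN; apply: mem_nth; apply: leq_trans (sz _ _); first by rewrite ltn_mod.
  by rewrite ltn_divLR.
have groot i : (i < N * n)%N -> g i \in stop (scale j') [::].
  move=> iN; apply: (cut_root hS _ _ _ (gin _ iN)); try exact: (stop_fuelP hS).
  have /fr /andP[fi1 _] : (i %/ n < N)%N by rewrite ltn_divLR.
  exact: lt_trans sc1 fi1.
have ginj i i' : (i < N * n)%N -> (i' < N * n)%N -> g i = g i' -> i = i'.
  move=> iN iN' gg.
  have [q|q] := eqVneq (i %/ n)%N (i' %/ n)%N.
    have mm : (i %% n = i' %% n)%N.
      apply/eqP; rewrite -(@nth_uniq _ [::] (stop (scale j') (f (i %/ n)%N))).
      - by apply/eqP; move: gg; rewrite /g -q.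
      - by apply: leq_trans (sz _ _); [rewrite ltn_mod|rewrite ltn_divLR].
      - by apply: leq_trans (sz _ _); [rewrite ltn_mod|rewrite ltn_divLR].
      - exact: cut_uniq.
    by rewrite (divn_eq i n) (divn_eq i' n) q mm.
  have [u1 E1] := cut_prefix (gin _ iN); have [u2 E2] := cut_prefix (gin _ iN').
  exfalso; move: gg; rewrite E1 E2; apply: wmap_disjoint_neq.
  by apply: fdisj => //; rewrite ltn_divLR.
have rs : rad j' <= scale j' := rad_le_scale j'.
(* A word at the new scale is prolonged to a piece of size about [rad j'] that still contains
   [wmap w y0], the point near which good measures have mass. *)
have /choice[child hchild] : forall w, exists w',
    w' \in stop (rad j') w /\ (wmap w' @` K) (wmap w y0).
  move=> w; have [|w' w'1 w'2] := @stop_cover _ _ _ S alpha K hK (rad j') w (wmap w y0).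
    by exists y0.
  by exists w'.
have rj'0 := rad_gt0 j'.
exists (Stage j' (N * n) (child \o g)); split; last first.
  split=> //=; first by apply: ltW; apply: lt_le_trans sc1 _; rewrite ler_piMl ?(amin_le1 alpha)// ltW.
  exists n, g; split=> //.
  - have XE : X = amin `^ t * (rad j / scale j') `^ t.
      by rewrite /X -mulrA powRM// ?(ltW ami)// divr_ge0// ltW.
    have -> : amin `^ t / 2 * N%:R * (rad j / scale j') `^ t = N%:R * (X / 2).
      by rewrite XE; ring.
    by rewrite natrM ler_pM2l// ler_pdivrMr// mulrC.
  - move=> i iN; split.
    + exact: groot.
    + have [u1 E1] := cut_prefix (gin _ iN).
      have [/cut_prefix [u2 E2] _] := hchild (g i).
      by exists (u1 ++ u2); rewrite catA -E1.
    + by have [/cut_prefix [u2 E2] _] := hchild (g i); exists u2.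
    + exact: (hchild (g i)).2.
split=> /=.
- by rewrite muln_gt0 N0.
- move=> i iN; have [wc _] := hchild (g i).
  rewrite (stop_le hS rj'0 wc) andbT; apply: (stop_gt hS rj'0 _ wc).
  apply: le_lt_trans (stop0_gt hS hK _ (groot _ iN)).
    by rewrite ler_pM2l.
  by rewrite s0 scale_le1.
- move=> i i' iN iN' ii'.
  have [/cut_prefix [u2 ->] _] := hchild (g i).
  have [/cut_prefix [u2' ->] _] := hchild (g i').
  apply: wmap_disjoint_cat; apply: (cut_disjoint hS Usub Udisj (groot _ iN) (groot _ iN')).
  by apply/eqP => /ginj => /(_ iN iN'); exact/eqP.
have Nn0 : 0 < (N * n)%:R :> R by rewrite ltr0n muln_gt0 N0.
have lowN : B / scale j' `^ t <= (N * n)%:R.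
  have -> : B / scale j' `^ t = N%:R * (X / 2).
    rewrite /B /X powRM ?invr_ge0 ?mulr_ge0 ?(ltW ami) ?(ltW rj0) ?(ltW s0)//.
    by rewrite powRVl ?(ltW s0)// powRM ?(ltW ami) ?(ltW rj0)//; ring.
  by rewrite natrM ler_pM2l// ler_pdivrMr// mulrC.
have st0 : 0 < scale j' `^ t by rewrite powR_gt0.
apply: (@le_trans _ _ (scale j' `^ t / B)).
  by rewrite -(invf_div B) lef_pV2 ?posrE// divr_gt0.
rewrite ler_pdivrMr// /rad -powRrM.
have -> : t / h * expo k.+1 = t - t / k.+3%:R.
  by rewrite /expo mulrA divfK ?gt_eqF// mulrBr mulr1.
have sn : scale j' != 0 by rewrite gt_eqF.
rewrite powRB ?sn ?implybT// -mulrA ler_pMr// mulrC ler_pdivlMr ?powR_gt0// mul1r.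
have -> : B = (B `^ (k.+3%:R / t)) `^ (t / k.+3%:R).
  rewrite -powRrM mulrA divfK ?gt_eqF// divff ?pnatr_eq0// powRr1//; exact: ltW.
by apply: ge0_ler_powR; rewrite ?nnegrE ?divr_ge0 ?powR_ge0 ?(ltW t0) ?(ltW s0) ?(ltW sc2).
Qed.

Lemma stage_sequence : exists st : nat -> stage,
  forall k, stage_ok k (st k) /\ stage_next k (st k) (st k.+1).
Proof.
pose s0 := Stage 0 1 (fun=> [::]).
have ok0 : stage_ok 0 s0.
  split=> //=.
  - move=> i _; rewrite ratio_nil /rad /scale expr0 powR1 mulr1 lexx andbT.
    exact: (amin_lt1 hS hK).
  - by move=> i i'; rewrite !ltnS !leqn0 => /eqP -> /eqP ->.
  - by rewrite invr1 /rad /scale expr0 !powR1.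
pose T := {p : nat * stage | stage_ok p.1 p.2}.
pose rel (p q : T) := (sval q).1 = (sval p).1.+1 /\
  stage_next (sval p).1 (sval p).2 (sval q).2.
have step p : {q | rel p q}.
  apply: cid; case: p => -[k s] /= ok; have [s' [ok' nx]] := stage_step ok.
  by exists (exist _ (k.+1, s') ok').
have [F [F0 Fn]] := dependent_choice step (exist _ (0%N, s0) ok0).
have Fk k : (sval (F k)).1 = k.
  by elim: k => [|k IH]; [rewrite F0|rewrite (Fn k).1 IH].
exists (fun k => (sval (F k)).2) => k; split; first by have := svalP (F k); rewrite Fk.
by have := (Fn k).2; rewrite Fk.
Qed.

(** The point [f x] lies in all pieces whose index intervals contain [x]. The radius [r] falls
    between the radii of generations [k1] and [k1.+1], and the mass caught is at most the proportion
    of pieces hit in generation [k1.+1]. *)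
Lemma cantor_set D : (forall y, K y -> enorm (y - y0) <= D) ->
  exists f : R -> 'rV[R]_d,
  (forall x, 0 <= x < 1 -> K (f x) /\
     forall N, exists j, [/\ (N <= j)%N, J j & exists2 w,
       w \in stop (scale j) [::] & enorm (f x - wmap w y0) <= 2 * D * rad j]) /\
  (forall h', h' < h -> exists r0 C, [/\ 0 < r0, 0 <= C &
     forall V r, 0 < r < r0 -> (forall x y, V x -> V y -> enorm (x - y) <= r) ->
     (leb_outer (`[0%R, 1%R[%classic `&` f @^-1` V) <= (C * r `^ h')%:E)%E]).
Proof.
move=> hD; have [st stP] := stage_sequence.
have ami := amin_gt0 hS.
have D0 : 0 <= D by apply: le_trans (enorm_ge0 _) (hD _ Ky0).
pose idx k (x : R) := Num.truncn (x * (num (st k))%:R).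
have num_gt0 k : (0 < num (st k))%N by have [[]] := stP k.
have idx_lt k x : 0 <= x < 1 -> (idx k x < num (st k))%N.
  move=> /andP[x0 x1]; rewrite truncn_lt_nat ?mulr_ge0// gtr_pMl//.
  by rewrite ltr0n.
pose A k x := wmap (node (st k) (idx k x)) @` K.
have Ane k x : A k x !=set0.
  by exists (wmap (node (st k) (idx k x)) y0); exists y0.
have Adec x k : 0 <= x < 1 -> A k.+1 x `<=` A k x.
  move=> x01; have [_ [_ _ _ [n [g [n0 numE _ gP _]]]]] := stP k.
  have [_ [u nodeE] _ _] := gP _ (idx_lt k.+1 x x01).
  have iE : (idx k.+1 x %/ n)%N = idx k x.
    rewrite /idx numE natrM mulrA truncn_divn// mulr_ge0//.
    by case/andP: x01.
  rewrite /A nodeE iE => _ [z Kz <-].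
  rewrite wmap_cat; exists (wmap u z) => //.
  by apply: (wmap_subK hK); exists z.
have /choice[f hf] : forall x, exists p, 0 <= x < 1 -> forall k, A k x p.
  move=> x; have [x01|nx] := pselect (0 <= x < 1); last by exists y0.
  have [_ cK _] := hK.
  have [||||p pA] := @nested_compact _ K (A^~ x) cK.
  - by move=> k; exact: (closed_wmapK hS hd hK).
  - by move=> k; exact: Ane.
  - by move=> k; exact: (wmap_subK hK).
  - by move=> k; exact: Adec.
  by exists p.
have lev_ge k : (k <= lev (st k))%N.
  by case: k => // k; have [_ []] := stP k.
exists f; split.
  move=> x x01; split; first by have := hf x x01 0%N; exact: (wmap_subK hK).
  move=> N; have [_ [Jj _ _ [n [g [_ _ _ gP _]]]]] := stP N.
  exists (lev (st N.+1)); split=> //; first exact: ltnW (lev_ge N.+1).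
  have [gs _ _ [z Kz zE]] := gP _ (idx_lt N.+1 x x01).
  exists (g (idx N.+1 x)) => //; rewrite -zE.
  have [z' Kz' <-] := hf x x01 N.+1.
  rewrite (wmap_dist hS) mulrC.
  have [[_ /(_ _ (idx_lt N.+1 x x01)) /andP[_ rle] _ _] _] := stP N.+1.
  apply: ler_pM; rewrite ?enorm_ge0//; first by rewrite ltW// (ratio_gt0 hS).
  apply: le_trans (enorm_triangle y0 _ _) _; rewrite mulr2n mulrDl mul1r.
  by apply: lerD; [exact: hD|rewrite enormBC; exact: hD].
move=> h' hh'; have [k0 hk0] := expo_cvg hh'.
have [C C0 hC] := stop_count hS hK Usub Udisj a0 Uball y0 (ltW t0) ht.
have [c cE c0] : exists2 c, amin `^ t / 2 = c & 0 < c.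
  by exists (amin `^ t / 2) => //; rewrite divr_gt0// powR_gt0.
have Cc0 : 0 < C / c by exact: divr_gt0.
exists (rad (lev (st k0))), (C + C / c); split.
- exact: rad_gt0.
- by rewrite ltW// addr_gt0.
move=> V r /andP[r0 rlt] diamV.
have r1 : r <= 1.
  apply: le_trans (ltW rlt) _; apply: le_trans (rad_le_scale _) _.
  exact: scale_le1.
have [k1 [k01 rk1 rk]] : exists k1, [/\ (k0 <= k1)%N, r < rad (lev (st k1)) &
    rad (lev (st k1.+1)) <= r].
  have ex : exists k, rad (lev (st k)) <= r.
    have [M hM] := scale_small r0; exists M.
    apply: le_trans (rad_le_scale _) _; apply: ltW; apply: hM; exact: lev_ge.
  case: (ex_minnP ex) => k rk kmin.
  have mono n : rad (lev (st n.+1)) <= rad (lev (st n)).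
    have [_ [_ _ + _]] := stP n; exact: le_trans (rad_le_scale _).
  have kk0 : (k0 < k)%N.
    rewrite ltnNge; apply/negP => kk.
    have : rad (lev (st k0)) <= rad (lev (st k)).
      rewrite -(subnKC kk); elim: (k0 - k)%N => [|n IH]; first by rewrite addn0.
      by rewrite addnS; apply: le_trans (mono _) IH.
    by move=> H; have := lt_le_trans rlt (le_trans H rk); rewrite ltxx.
  case: k rk kmin kk0 => // k rk kmin kk0; exists k; split=> //.
  by rewrite ltNge; apply/negP => /kmin; rewrite ltnn.
pose N := num (st k1.+1); pose ell := scale (lev (st k1.+1)).
have N0 : (0 < N)%N by exact: num_gt0.
have NR : 0 < N%:R :> R by rewrite ltr0n.
have ell0 : 0 < ell by exact: scale_gt0.
have [[_ _ _ Nexp1] _] := stP k1.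
have [[_ _ _ Nexp] _] := stP k1.+1.
have [_ [Jj _ _ [n [g [n0 numE Nlow gP ginj]]]]] := stP k1.
rewrite cE in Nlow.
(* Hits are counted on the larger pieces given by [g i], cut at the scale [ell] where [stop_count]
   applies; distinct indices have distinct [g i]. *)
pose B i := `[< wmap (g i) @` K `&` V !=set0 >].
apply: (@le_trans _ _ ((count B (iota 0 N))%:R / N%:R)%:E).
  apply: leb_outer_index => // x [/=]; rewrite in_itv /= => x01 Vfx.
  split=> //; apply/asboolP; exists (f x); split=> //.
  have [_ _ [u uE] _] := gP _ (idx_lt k1.+1 x x01).
  have := hf x x01 k1.+1; rewrite /A uE => -[z Kz <-].
  rewrite wmap_cat; exists (wmap u z) => //.
  by apply: (wmap_subK hK); exists z.
rewrite lee_fin.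
(* [stop_count] needs a radius at least [ell]; enlarging a smaller [r] to [ell] leaves a bounded
   number of hits. *)
pose r2 := Num.max r ell.
have cnt : (count B (iota 0 N))%:R <= C * (r2 / ell) `^ t.
  have := hC ell r2 V _ _ _; rewrite ell0 le_max lexx orbT ge_max r1 scale_le1.
  move=> /(_ isT isT) /=; set s := [seq _ <- _ | _] => H.
  apply: (@le_trans _ _ (size s)%:R); last first.
    by apply: H => x y Vx Vy; rewrite le_max diamV.
  rewrite ler_nat -size_filter -(size_map g); apply: uniq_leq_size.
    rewrite map_inj_in_uniq ?filter_uniq ?iota_uniq// => i i'.
    rewrite !mem_filter !mem_iota /= !add0n => /andP[_ iN] /andP[_ iN'].
    exact: ginj.
  move=> w /mapP[i]; rewrite mem_filter mem_iota /= add0n => /andP[Bi iN] ->.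
  rewrite /s mem_filter; have [gs _ _ _] := gP _ iN.
  by apply/andP; split.
have expge : forall k, (k0 <= k)%N -> r `^ expo k <= r `^ h'.
  move=> k kk; apply: ger_powR; first by rewrite r0 r1.
  exact: le_trans hk0 (expo_mono kk).
have rh0 : 0 <= r `^ h' by exact: powR_ge0.
apply: (@le_trans _ _ (C * (r2 / ell) `^ t / N%:R)).
  by rewrite ler_pM2r ?invr_gt0.
(* For [r < ell] boundedly many pieces are hit, each of mass at most a power [expo k1.+1] of a
   radius not exceeding [r]. For larger [r] the gain comes from the number of children per
   parent. *)
have [er|re] := leP ell r; last first.
  have -> : r2 / ell = 1 by rewrite /r2 max_r ?divff ?gt_eqF// ltW.
  rewrite powR1 mulr1; apply: (@le_trans _ _ (C * r `^ h')); last first.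
    by rewrite ler_wpM2r// lerDl ltW.
  rewrite ler_pM2l//; apply: le_trans Nexp _.
  apply: (@le_trans _ _ (r `^ expo k1.+1)); last by apply: expge; exact: leqW.
  apply: ge0_ler_powR; rewrite ?nnegrE//; try exact: ltW.
  - exact: ltW (expo_gt0 _).
  - exact: ltW (rad_gt0 _).
have -> : r2 = r by rewrite /r2 max_l.
apply: (@le_trans _ _ (C / c * r `^ h')); last first.
  by rewrite ler_wpM2r// lerDr ltW.
have N1R : 0 < (num (st k1))%:R :> R by rewrite ltr0n.
apply: le_trans (_ : C / c * r `^ expo k1 <= _); last first.
  by rewrite ler_pM2l// expge.
have et : expo k1 <= t by exact: le_trans (expo_le _) hlet.
exact: (parent_cell_count C0 c0 N1R r0 ell0 (ltW rk1) et Nexp1 Nlow).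
Qed.

End CantorSubset.

Section CantorNonNull.
Context {R : realType} {d : nat}.

(** Each [A n] pulls back to a null set by mass distribution, and countably many null sets cannot
    cover an interval of length 1. *)
Lemma frostman_avoids (f : R -> 'rV[R]_d) (h : R) (A : nat -> set 'rV[R]_d) :
  (forall h', h' < h -> exists r0 C, [/\ 0 < r0, 0 <= C &
     forall V r, 0 < r < r0 -> (forall x y, V x -> V y -> enorm (x - y) <= r) ->
     (leb_outer (`[0%R, 1%R[%classic `&` f @^-1` V) <= (C * r `^ h')%:E)%E]) ->
  (forall n, exists2 t, 0 <= t < h & hausdorff_measure t (A n) = 0%E) ->
  exists2 x, 0 <= x < 1 & forall n, ~ A n (f x).
Proof.
move=> hf hA; apply: contrapT => nex.
have null n : leb_outer (`[0%R, 1%R[%classic `&` f @^-1` A n) = 0%E.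
  have [t /andP[t0 th] At] := hA n.
  (* The midpoint is used because [mass_distribution] asks for a positive exponent, and [t] may be
     0. *)
  have m1 : t <= (t + h) / 2 by rewrite ler_pdivlMr//; lra.
  have m2 : (t + h) / 2 < h by rewrite ltr_pdivrMr//; lra.
  have m3 : 0 < (t + h) / 2 by lra.
  have [r0 [C [r00 C0 hC]]] := hf _ m2.
  apply: (mass_distribution m3 C0 r00 hC).
  exact: hausdorff_measure0_mono At.
have : (leb_outer (`[0%R, 1%R[%classic : set R) <= 0%:E)%E.
  apply: (@le_trans _ _ (leb_outer
      (\bigcup_n (`[0%R, 1%R[%classic `&` f @^-1` A n)))).
    apply: le_outer_measure => x xI.
    apply: contrapT => nx; apply: nex; exists x => [|n Anx].
      by move: xI; rewrite /= in_itv.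
    by apply: nx; exists n.
  apply: le_trans (outer_measure_sigma_subadditive _ _) _.
  by rewrite eseries0// => n _ _; exact: null.
by rewrite leb_outer_itv// subr0 lee_fin ler10.
Qed.

End CantorNonNull.

(** * Dimension of the self-similar set *)

Section SimilarityDimension.
Context {R : realType} {d m : nat}.
Variables (S : 'I_m -> 'rV[R]_d -> 'rV[R]_d) (alpha : 'I_m -> R).
Hypothesis hS : forall i, contractive_similitude (alpha i) (S i).
Variable K : set 'rV[R]_d.
Hypothesis hd : (0 < d)%N.
Hypothesis hK : self_similar_set S K.
Local Notation wmap := (wmap S).
Local Notation ratio := (ratio alpha).
Local Notation amin := (amin alpha).
Local Notation stop := (stop alpha).

(** Intermediate values: the sum is [m >= 1] at exponent 0, and at most 1 at an integer [n] with
    [amax ^ n <= 1 / m], which is the fuel for the ratio [1 / m]. *)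
Lemma similarity_dimension_exists :
  exists2 t, 0 <= t & \sum_i alpha i `^ t = 1.
Proof.
have m0 : (0 < m)%N.
  case: hK => -[x Kx] _ KE; move: Kx; rewrite KE => -[i _ _].
  exact: leq_ltn_trans (ltn_ord i).
have mR : 0 < m%:R :> R by rewrite ltr0n.
have := stop_fuelP hS [::] (_ : 0 < m%:R^-1 :> R); rewrite invr_gt0 => /(_ mR).
rewrite /fuelled ratio_nil mul1r; set n := stop_fuel _ _ => hn.
have cont : continuous (fun t : R => \sum_i alpha i `^ t).
  elim: (index_enum _) => [|i s IHs] t.
    have -> : (fun t : R => \sum_(i <- [::]) alpha i `^ t) = cst 0.
      by apply/funext => u; rewrite big_nil.
    exact: cvg_cst.
  have -> : (fun t : R => \sum_(j <- i :: s) alpha j `^ t) =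
      (fun t => alpha i `^ t) \+ (fun t => \sum_(j <- s) alpha j `^ t).
    by apply/funext => u; rewrite big_cons.
  apply: cvgD; last exact: IHs.
  have an0 : alpha i != 0 by rewrite gt_eqF// (alpha_gt0 hS).
  rewrite /powR (negbTE an0).
  apply: continuous_cvg; first exact: continuous_expR.
  by apply: cvgMl; exact: cvg_id.
have [||t] := @IVT R (fun t => \sum_i alpha i `^ t) 0 n%:R 1 (ler0n _ _).
- exact: continuous_subspaceT.
- have -> : \sum_i alpha i `^ 0 = m%:R.
    under eq_bigr do rewrite powRr0.
    by rewrite sumr_const card_ord.
  rewrite le_max ler1n m0 andbT ge_min; apply/orP; right.
  apply: (@le_trans _ _ (\sum_(i < m) m%:R^-1)); last first.
    by rewrite sumr_const card_ord -[leLHS]mulr_natl mulfV// gt_eqF.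
  apply: ler_sum => i _; apply: le_trans hn.
  rewrite powR_mulrn ?(ltW (alpha_gt0 hS _))//.
  by apply: lerXn2r; rewrite ?nnegrE ?amax_ge0 ?alpha_le_amax// ltW// (alpha_gt0 hS).
rewrite in_itv /= => /andP[t0 _] tE; by exists t.
Qed.

Variables (t : R).
Hypothesis t0 : 0 <= t.
Hypothesis ht : \sum_i alpha i `^ t = 1.

(** The weights [ratio w ^ t] add up to 1 and none is below [(amin * scale j) ^ t]; dually, none
    exceeds [scale j ^ t]. *)
Lemma stop_size_le j : (size (stop (scale j) [::]))%:R <=
  amin `^ (- t) * (2 `^ t) ^+ j.
Proof.
have ami := amin_gt0 hS.
have s0 : 0 < scale j :> R := scale_gt0 j.
have p0 : 0 < (amin * scale j) `^ t by rewrite powR_gt0// mulr_gt0.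
rewrite -(ler_pM2r p0).
have -> : amin `^ (- t) * (2 `^ t) ^+ j * (amin * scale j) `^ t = 1.
  rewrite powRM ?(ltW ami) ?(ltW s0)// /scale powRXn ?invr_ge0// powRVl//.
  by rewrite powRN exprVn mulrACA mulVf ?gt_eqF ?powR_gt0// mul1r divff.
apply: (@le_trans _ _ (\sum_(w <- stop (scale j) [::]) ratio w `^ t)).
  rewrite -sum1_size natr_sum mulr_suml big_seq [leRHS]big_seq.
  apply: ler_sum => w ws; rewrite mul1r; apply: ge0_ler_powR => //.
  - by rewrite nnegrE mulr_ge0 ?(ltW ami) ?(ltW s0).
  - by rewrite nnegrE ltW// (ratio_gt0 hS).
  - by apply: ltW; apply: (stop0_gt hS hK) => //; rewrite s0 scale_le1.
by rewrite (cut_sum hS ht) ratio_nil powR1.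
Qed.

Lemma stop_size_ge j : (2 `^ t) ^+ j <= (size (stop (scale j) [::]))%:R :> R.
Proof.
have s0 : 0 < scale j :> R := scale_gt0 j.
have -> : (2 `^ t) ^+ j = (scale j `^ t)^-1.
  by rewrite /scale powRXn ?invr_ge0// powRVl// exprVn invrK.
have p0 : 0 < scale j `^ t by rewrite powR_gt0.
rewrite -[leLHS]mul1r ler_pdivrMr//.
have E : \sum_(w <- stop (scale j) [::]) ratio w `^ t = 1.
  by rewrite (cut_sum hS ht) ratio_nil powR1.
rewrite -[leLHS]E -sum1_size natr_sum mulr_suml big_seq [leRHS]big_seq.
apply: ler_sum => w ws; rewrite mul1r; apply: ge0_ler_powR => //.
- by rewrite nnegrE ltW// (ratio_gt0 hS).
- by rewrite nnegrE ltW.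
- exact: (stop_le hS _ ws).
Qed.

Lemma wmapK_diam D y0 rho w : (forall y, K y -> enorm (y - y0) <= D) ->
  0 < rho -> w \in stop rho [::] -> forall x y, (wmap w @` K) x ->
  (wmap w @` K) y -> enorm (x - y) <= 2 * D * rho.
Proof.
move=> hD rho0 ws _ _ [x Kx <-] [y Ky <-]; rewrite (wmap_dist hS) mulrC.
apply: ler_pM; rewrite ?enorm_ge0 ?(ltW (ratio_gt0 hS _))//.
  apply: le_trans (enorm_triangle y0 _ _) _; rewrite mulr2n mulrDl mul1r.
  by apply: lerD; [exact: hD|rewrite enormBC; exact: hD].
exact: (stop_le hS _ ws).
Qed.

Lemma hausdorff_measureK0 t' : t < t' -> hausdorff_measure t' K = 0%E.
Proof.
move=> tt'; have [[y0 Ky0] _ _] := hK.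
have [D D1 hD] := exists_diameter hK y0.
have D0 : 0 < 2 * D by lra.
apply: (@limsup_cover_null _ _ K
    (fun j => [seq wmap w @` K | w <- stop (scale j) [::]])
    (amin `^ (- t)) (2 * D) t t') => //.
- move=> j V /mapP[w ws ->] x y; apply: (wmapK_diam hD _ ws).
  exact: scale_gt0.
- by move=> j; rewrite size_map; exact: stop_size_le.
- move=> J x Kx; have [|w ws wx] := @stop_cover _ _ _ S alpha K hK (scale J) [::] x.
    by exists x.
  by exists J, (wmap w @` K); split=> //; apply: map_f.
Qed.

(** For the lower bound, the Cantor construction is run with [h = t] and every level allowed: were
    [K] null for some [t' < t], some point [f x] of [K] would have to avoid [K]. *)
Lemma hausdorff_dim_self_similar : open_set_condition S ->
  hausdorff_dim K = t%:E.
Proof.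
case=> U [[y1 Uy1] oU Usub Udisj].
have [a a0 Uball] := open_enorm_ball oU Uy1.
have [[y0 Ky0] _ _] := hK; have [D _ hD] := exists_diameter hK y0.
apply/eqP; rewrite eq_le; apply/andP; split.
  apply/lee_addgt0Pr => e e0; rewrite -EFinD.
  apply: hausdorff_dim_le; first by rewrite addr_ge0// ltW.
  by apply: hausdorff_measureK0; rewrite ltrDl.
apply: hausdorff_dim_ge => t' /andP[t'0 t't] Kt'.
have tpos : 0 < t by exact: le_lt_trans t't.
have infT N : exists2 j, (N <= j)%N & [set: nat] j by exists N.
have [f [fK ff]] := cantor_set hS hd hK Usub Udisj a0 Uball ht Ky0 infT tpos
  (lexx t) hD.
have [|x x01 /(_ 0%N)] := @frostman_avoids _ _ f t (fun=> K) ff.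
  by move=> _; exists t' => //; rewrite t'0.
by apply; have [] := fK x x01.
Qed.

End SimilarityDimension.

(** * The generic set *)

Section LipschitzIntegrals.
Context {R : realType} {d : nat} (K : set 'rV[R]_d).
Hypothesis hd : (0 < d)%N.
Hypothesis cK : closed K.
Local Notation T := (borel_rV R d).
Implicit Types (mu nu : prob_on K) (f : 'rV[R]_d -> R).

Lemma measurable_open_rV (A : set 'rV[R]_d) : open A -> measurable (A : set T).
Proof. by move=> oA; apply: sub_sigma_algebra. Qed.

Lemma measurable_closed_rV (A : set 'rV[R]_d) :
  closed A -> measurable (A : set T).
Proof.
move=> cA; rewrite -[A]setCK; apply: measurableC.
by apply: measurable_open_rV; exact: closed_openC.
Qed.

Lemma measurable_ecball x (r : R) : measurable (ecball x r : set T).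
Proof. by apply: measurable_closed_rV; exact: closed_ecball. Qed.

Let mK : measurable (K : set T). Proof. exact: measurable_closed_rV. Qed.

(** The Lipschitz bound holds on [K] only, so a superlevel set is written as the trace on [K] of a
    union [V] of open balls centred in [K], of radius [f x - c] at [x]. *)
Lemma lip1_on_measurable f : lip1_on (K := K) f ->
  measurable_fun (K : set T) (f : T -> R).
Proof.
move=> [_ flip].
apply: (measurability (@RGenOInfty.G R)); first exact: RGenOInfty.measurableE.
move=> _ [_ [c ->] <-].
pose V := [set y | exists x, [/\ K x, c < f x & enorm (y - x) < f x - c]].
have oV : open V.
  apply: open_enormP => // y [x [Kx cx yx]].
  exists (f x - c - enorm (y - x)); first by rewrite subr_gt0.
  move=> z zy; exists x; split=> //.
  by have := enorm_triangle y z x; lra.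
suff -> : K `&` f @^-1` `]c, +oo[ = K `&` V.
  by apply: measurableI => //; exact: measurable_open_rV.
apply/seteqP; split=> y [Ky]; rewrite /= in_itv /= andbT => Hy; split=> //=.
  by exists y; split=> //; rewrite subrr enorm0 subr_gt0.
case: Hy => x [Kx cx yx].
have := flip y x Ky Kx; rewrite ler_norml => /andP[h1 _]; lra.
Qed.

Lemma mass_setT mu : mu K = 1%E.
Proof. exact: prob_onK. Qed.

Lemma bounded_integrable mu f (M : R) : measurable_fun (K : set T) (f : T -> R) ->
  (forall x, K x -> `|f x| <= M) -> mu.-integrable (K : set T) (EFin \o f).
Proof.
move=> mf fM; apply: measurable_bounded_integrable => //.
  exact: le_lt_trans (probability_le1 mu mK) (ltry _).
exists M; split; first exact: num_real.
by move=> N MN x Kx; apply: le_trans (fM _ Kx) (ltW MN).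
Qed.

Lemma lip1_integrable mu f : lip1_on (K := K) f ->
  mu.-integrable (K : set T) (EFin \o f).
Proof.
move=> lf; apply: (@bounded_integrable _ _ 1); first exact: lip1_on_measurable.
exact: lf.1.
Qed.

(** A tent of slope 1 and height [r]. For [r <= 1] it is a test function of [rho], so its integral
    is continuous in the measure, unlike the mass of the ball, which it bounds from below after
    division by [r]. *)
Definition bump (x : 'rV[R]_d) (r : R) (y : 'rV[R]_d) : R :=
  Num.max 0 (r - enorm (y - x)).

Lemma bump_ge0 x r y : 0 <= bump x r y.
Proof. by rewrite le_max lexx. Qed.

Lemma bump_le x r y : 0 <= r -> bump x r y <= r.
Proof. by move=> r0; rewrite ge_max r0 gerBl enorm_ge0. Qed.

Lemma bump_center x r : 0 <= r -> bump x r x = r.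
Proof. by move=> r0; rewrite /bump subrr enorm0 subr0 max_r. Qed.

Lemma bump_out x r y : r < enorm (y - x) -> bump x r y = 0.
Proof. by move=> ry; rewrite /bump max_l// subr_le0 ltW. Qed.

Lemma bump_lip1 x r : 0 <= r <= 1 -> lip1_on (K := K) (bump x r).
Proof.
move=> /andP[r0 r1]; split=> [y _|y z _ _].
  by rewrite ger0_norm ?bump_ge0// (le_trans (bump_le _ _ r0)).
have := enorm_lip y z x; rewrite !ler_norml => /andP[h1 h2].
by rewrite /bump; case: (leP 0 (r - enorm (y - x))) => ?;
  case: (leP 0 (r - enorm (z - x))) => ?; apply/andP; split; lra.
Qed.

Lemma bump_integral_le mu x r : 0 < r <= 1 ->
  ((\int[mu]_(y in K) bump x r y)%:E <= r%:E * mu (ecball x r))%E.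
Proof.
move=> /andP[r0 r1]; have mB := measurable_ecball x r.
have lb : lip1_on (K := K) (bump x r) by apply: bump_lip1; rewrite ltW.
have ib := lip1_integrable mu lb.
rewrite fineK; last exact: integrable_fin_num.
apply: (@le_trans _ _ (\int[mu]_(y in K) (r%:E * (\1_(ecball x r) y)%:E))%E).
  apply: ge0_le_integral => //.
  - by move=> y _; rewrite lee_fin bump_ge0.
  - by case/integrableP: ib.
  - by apply/measurable_EFinP; exact: measurable_funM.
  - move=> y _; rewrite -EFinM lee_fin indicE; case: (boolP (y \in _)) => yB.
      by rewrite mulr1 bump_le// ltW.
    rewrite mulr0 bump_out//; move/negP: yB; rewrite inE /ecball /= => /negP.
    by rewrite -ltNge.
rewrite ge0_integralZl//; last 2 first.
- by apply/measurable_EFinP.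
- by rewrite lee_fin ltW.
rewrite integral_indic// lee_wpmul2l// ?lee_fin ?(ltW r0)//.
by apply: le_measure; rewrite ?inE//; exact: measurableI.
Qed.

Lemma lip1_Rintegral_add1 mu f : lip1_on (K := K) f ->
  \int[mu]_(y in K) (f y + 1) = \int[mu]_(y in K) f y + 1.
Proof.
move=> lf; have intf := lip1_integrable mu lf.
have int1 : mu.-integrable (K : set T) (EFin \o (cst 1 : T -> R)).
  by apply: (@bounded_integrable _ _ 1) => // x _; rewrite normr1.
have mK1 : fine (mu K) = 1 by rewrite mass_setT.
rewrite (RintegralD (f1 := f : T -> R) (f2 := cst 1 : T -> R) mK intf int1).
by congr +%R; rewrite Rintegral_cst// mul1r.
Qed.

Lemma lip1_Rintegral_le mu f : lip1_on (K := K) f ->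
  `|\int[mu]_(y in K) f y| <= 1.
Proof.
move=> lf; have intf := lip1_integrable mu lf.
have int1 : mu.-integrable (K : set T) (EFin \o (cst 1 : T -> R)).
  by apply: (@bounded_integrable _ _ 1) => // x _; rewrite normr1.
have mK1 : fine (mu K) = 1 by rewrite mass_setT.
apply: le_trans (le_normr_Rintegral mK intf) _.
apply: (@le_trans _ _ (\int[mu]_(y in K) (cst 1 y))).
  apply: le_Rintegral => //; last by move=> y Ky; exact: lf.1.
  exact: integrable_norm.
by rewrite Rintegral_cst// mul1r; rewrite mK1.
Qed.

Section AddAtoms.
Variables (mu : prob_on K) (c : R) (x : nat -> 'rV[R]_d) (n : nat).
Hypothesis c0 : 0 <= c.
Hypothesis Kx : forall i, K (x i).

Definition with_atoms : {measure set T -> \bar R} :=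
  measure_add mu (mscale (NngNum c0) (msum (fun i => \d_(x i : T)) n)).

Lemma with_atoms_mass (A : set T) : mu A = 1%E -> (forall i, A (x i)) ->
  with_atoms A = (1 + c * n%:R)%:E.
Proof.
move=> muA Ax.
transitivity (mu A + mscale (NngNum c0) (msum (fun i => \d_(x i : T)) n) A)%E.
  exact: measure_addE.
rewrite muA; have -> : mscale (NngNum c0) (msum (fun i => \d_(x i : T)) n) A =
    (c%:E * \sum_(i < n) \d_(x i : T) A)%E by [].
under eq_bigr do rewrite diracE mem_set//.
by rewrite sumEFin -EFinM sumr_const card_ord -EFinD.
Qed.

Lemma with_atoms_setT : with_atoms setT = (1 + c * n%:R)%:E.
Proof. by apply: with_atoms_mass => //; exact: probability_setT. Qed.

Let mass_gt0 : 0 < 1 + c * n%:R.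
Proof. by rewrite ltr_pwDl// mulr_ge0. Qed.

(** The second argument of [mnormalize] is a default for total mass 0 or infinity; the total mass
    here is [1 + c * n]. *)
Definition normalized_atoms : probability T R := mnormalize with_atoms mu.

Lemma normalized_atomsE (A : set T) :
  normalized_atoms A = (((1 + c * n%:R)^-1)%:E * with_atoms A)%E.
Proof.
rewrite /normalized_atoms /= /mnormalize with_atoms_setT /=.
by rewrite eqe gt_eqF//= muleC.
Qed.

Lemma normalized_atomsK : normalized_atoms K = 1%E.
Proof.
rewrite normalized_atomsE with_atoms_mass//; last exact: prob_onK.
by rewrite -EFinM mulVf// gt_eqF.
Qed.

Definition add_atoms : prob_on K := ProbOn normalized_atomsK.

Lemma add_atoms_integral_ge0 (g : 'rV[R]_d -> R) (M : R) :
  measurable_fun (K : set T) (g : T -> R) -> (forall y, K y -> 0 <= g y <= M) ->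
  \int[add_atoms]_(y in K) g y =
  (\int[mu]_(y in K) g y + c * \sum_(i < n) g (x i)) / (1 + c * n%:R).
Proof.
move=> mg g0M.
have g0 y : K y -> (0 <= (g y)%:E)%E by move=> /g0M /andP[]; rewrite lee_fin.
have mg' : measurable_fun (K : set T) (EFin \o g) by apply/measurable_EFinP.
have intg : mu.-integrable (K : set T) (EFin \o g).
  apply: (@bounded_integrable _ _ M) => // y Ky.
  by have /andP[? ?] := g0M y Ky; rewrite ger0_norm.
have k0 : 0 <= (1 + c * n%:R)^-1 by rewrite invr_ge0 ltW.
have E : (\int[add_atoms]_(y in K) (g y)%:E = ((1 + c * n%:R)^-1)%:E *
    (\int[mu]_(y in K) (g y)%:E + c%:E * \sum_(i < n) (g (x i))%:E))%E.
  transitivity (\int[mscale (NngNum k0) with_atoms]_(y in K) (g y)%:E)%E.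
    apply: eq_measure_integral => A mA AK.
    by rewrite /= normalized_atomsE.
  rewrite ge0_integral_mscale//; congr (_ * _)%E.
  rewrite ge0_integral_measure_add//; congr (_ + _)%E.
  rewrite ge0_integral_mscale//; congr (_ * _)%E.
  rewrite ge0_integral_measure_sum//; apply: eq_bigr => i _.
  by rewrite integral_dirac// diracE mem_set// mul1e.
rewrite /Rintegral E sumEFin -EFinM.
by rewrite -(fineK (integrable_fin_num mK intg)) -EFinD -EFinM /= mulrC.
Qed.

(** The formula is first proved for nonnegative integrands, where sums of measures integrate
    termwise; adding 1 makes a function bounded by 1 nonnegative, and the constant cancels. *)
Lemma add_atoms_integral f : lip1_on (K := K) f ->
  \int[add_atoms]_(y in K) f y =
  (\int[mu]_(y in K) f y + c * \sum_(i < n) f (x i)) / (1 + c * n%:R).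
Proof.
move=> lf; have := @add_atoms_integral_ge0 (fun y => f y + 1) 2.
rewrite !lip1_Rintegral_add1// => H.
have {H}: \int[add_atoms]_(y in K) f y + 1 =
  (\int[mu]_(y in K) f y + 1 + c * \sum_(i < n) (f (x i) + 1)) / (1 + c * n%:R).
  apply: H.
    by apply: measurable_funD => //; exact: lip1_on_measurable.
  move=> y /lf.1; rewrite ler_norml => /andP[h1 h2]; apply/andP; split; lra.
move=> /(congr1 (fun z => z - 1)); rewrite addrK => ->.
rewrite big_split/= sumr_const card_ord.
by field; rewrite gt_eqF.
Qed.

Lemma add_atoms_rho : (rho mu add_atoms <= (2 * (c * n%:R))%:E)%E.
Proof.
apply: ge_ereal_sup => _ [f lf <-]; rewrite lee_fin add_atoms_integral//.
have := lip1_Rintegral_le mu lf; set I := Rintegral _ _ _ => I1.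
set s := \sum_(i < n) _; have s1 : `|s| <= n%:R.
  apply: le_trans (ler_norm_sum _ _ _) _.
  rewrite -[leRHS]mulr1 mulr_natl -[X in _ *+ X]card_ord -sumr_const.
  by apply: ler_sum => i _; exact: lf.1.
set a := c * n%:R; have a0 : 0 <= a by rewrite mulr_ge0.
have cs : `|c * s| <= a by rewrite normrM (ger0_norm c0) ler_wpM2l.
have p0 : 0 < 1 + a by lra.
have -> : I - (I + c * s) / (1 + a) = (I * a - c * s) / (1 + a).
  by field; rewrite gt_eqF.
rewrite normrM normfV (gtr0_norm p0) ler_pdivrMr//.
apply: le_trans (ler_normB _ _) _; rewrite normrM (ger0_norm a0).
have : `|I| * a <= a by rewrite ler_piMl.
by nra.
Qed.

End AddAtoms.

Lemma rho_ball_integral mu nu f (e : R) : lip1_on (K := K) f ->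
  rho_ball mu e nu ->
  `|\int[mu]_(y in K) f y - \int[nu]_(y in K) f y| < e.
Proof.
move=> lf H; rewrite -lte_fin; apply: le_lt_trans H.
by apply: ereal_sup_ubound; exists f.
Qed.

End LipschitzIntegrals.

Section GenericSet.
Context {R : realType} {d m : nat}.
Variables (S : 'I_m -> 'rV[R]_d -> 'rV[R]_d) (alpha : 'I_m -> R).
Hypothesis hS : forall i, contractive_similitude (alpha i) (S i).
Variable K : set 'rV[R]_d.
Hypothesis hd : (0 < d)%N.
Hypothesis hK : self_similar_set S K.
Variables (s : R) (y0 : 'rV[R]_d).
Hypothesis s0 : 0 <= s.
Hypothesis hs : \sum_i alpha i `^ s = 1.
Hypothesis Ky0 : K y0.
Local Notation wmap := (wmap S).
Local Notation amin := (amin alpha).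
Local Notation stop := (stop alpha).

Definition tiny (j : nat) : R := 2^-1 ^+ (j ^ 2).
Definition thr (j : nat) : R := scale j `^ s / j.+1%:R.

Lemma tiny_gt0 j : 0 < tiny j.
Proof. by rewrite exprn_gt0. Qed.

Lemma tiny_le1 j : tiny j <= 1.
Proof. by rewrite exprn_ile1//; lra. Qed.

Lemma thr_gt0 j : 0 < thr j.
Proof. by rewrite divr_gt0// powR_gt0// scale_gt0. Qed.

Let cK : closed K.
Proof. by case: hK => _ c _; apply: compact_closed c; exact: norm_hausdorff. Qed.

Definition good (j : nat) : set (prob_on K) :=
  [set mu : prob_on K | forall w, w \in stop (scale j) [::] ->
    tiny j * thr j < \int[mu]_(y in K) bump (wmap w y0) (tiny j) y].

Let lip_bump j w : lip1_on (K := K) (bump (wmap w y0) (tiny j)).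
Proof. by apply: bump_lip1; rewrite tiny_le1 ltW// tiny_gt0. Qed.

Lemma open_good j : open (good j).
Proof.
rewrite openE => mu mug.
(* Finitely many strict inequalities leave a common margin [e], and a measure at distance less than
   [e] changes each integral by less than [e]. *)
have [e e0 he] : exists2 e : R, 0 < e & forall w, w \in stop (scale j) [::] ->
    e <= \int[mu]_(y in K) bump (wmap w y0) (tiny j) y - tiny j * thr j.
  move: mug; rewrite /good /=; elim: (stop _ _) => [|w l IH] h.
    by exists 1.
  have [w' w'l|e e0 he] := IH; first by apply: h; rewrite inE w'l orbT.
  exists (Num.min e (\int[mu]_(y in K) bump (wmap w y0) (tiny j) y
     - tiny j * thr j)).
    by rewrite lt_min e0 subr_gt0 h// mem_head.
  move=> w'; rewrite inE => /orP[/eqP ->|/he]; rewrite ge_min.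
    by rewrite lexx orbT.
  by move=> ->.
apply/nbhs_ballP; exists e => // nu munu w ws.
have := rho_ball_integral (lip_bump j w) munu.
have := he w ws; rewrite ltr_norml => h1 /andP[h2 h3].
by lra.
Qed.

Lemma good_mass j (mu : prob_on K) w : good j mu -> w \in stop (scale j) [::] ->
  ((thr j)%:E <= mu (ecball (wmap w y0) (tiny j)))%E.
Proof.
move=> mug ws; have t0 := tiny_gt0 j.
have := bump_integral_le hd cK mu (wmap w y0) (_ : 0 < tiny j <= 1).
rewrite t0 tiny_le1 => /(_ isT) H.
have mf : mu (ecball (wmap w y0) (tiny j)) \is a fin_num.
  by apply: fin_num_measure; exact: measurable_ecball.
rewrite -(fineK mf) in H *; rewrite -EFinM !lee_fin in H *.
rewrite -(ler_pM2l t0); apply: le_trans H; apply: ltW; exact: mug.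
Qed.

Lemma good_near (mu : prob_on K) (e : R) N : 0 < e ->
  exists j nu, [/\ (N <= j)%N, good j nu & rho_ball mu e nu].
Proof.
move=> e0; have ami := amin_gt0 hS.
(* The total mass added: it moves the measure by at most [2 * eta < e], and [eta <= 1] keeps the
   normalizing factor [1 + eta] at most 2. *)
pose eta := Num.min 1 (e / 4).
have eta0 : 0 < eta by rewrite lt_min ltr01 divr_gt0.
have eta1 : eta <= 1 by rewrite ge_min lexx.
have eta2 : 2 * eta < e.
  have : eta <= e / 4 by rewrite ge_min lexx orbT.
  by lra.
pose C := amin `^ (- s); have C0 : 0 < C by exact: powR_gt0.
(* There are at most [C * 2 ^ (j s)] atoms, so each weighs at least [eta / (C * 2 ^ (j s))]. This
   exceeds [2 * thr j] once [j + 1 > 2 * C / eta]; the factor 2 pays for the normalization. *)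
pose j := maxn N (Num.truncn (2 * C / eta)).
pose W := stop (scale j) [::].
have n0 : 0 < (size W)%:R :> R.
  by apply: lt_le_trans (stop_size_ge hS s0 hs j); rewrite exprn_gt0// powR_gt0.
pose c := eta / (size W)%:R.
have c0 : 0 <= c by rewrite divr_ge0// ltW.
have cn : c * (size W)%:R = eta by rewrite /c divfK// gt_eqF.
pose x i := wmap (nth [::] W i) y0.
have Kx i : K (x i) by apply: (wmap_subK hK); exists y0.
exists j, (add_atoms mu (size W) c0 Kx); split; first exact: leq_maxl.
  move=> w ws; rewrite add_atoms_integral// cn.
  have t0 := tiny_gt0 j.
  have I0 : 0 <= \int[mu]_(y in K) bump (wmap w y0) (tiny j) y.
    by apply: Rintegral_ge0 => y _; exact: bump_ge0.
  have iW : (index w W < size W)%N by rewrite index_mem.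
  have S0 : tiny j <= \sum_(i < size W) bump (wmap w y0) (tiny j) (x i).
    rewrite (bigD1 (Ordinal iW))//= {1}/x nth_index// bump_center ?(ltW t0)//.
    by rewrite lerDl; apply: sumr_ge0 => i _; exact: bump_ge0.
  rewrite ltr_pdivlMr; last by lra.
  have thrc : 2 * thr j < c.
    rewrite /c ltr_pdivlMr//.
    have sz := stop_size_le hS hK s0 hs j.
    rewrite -/W -/C in sz.
    have p2 : (0 : R) < (2 `^ s) ^+ j by rewrite exprn_gt0// powR_gt0.
    have thrE : thr j = ((2 `^ s) ^+ j)^-1 / j.+1%:R.
      by rewrite /thr /scale powRXn ?invr_ge0// powRVl// exprVn.
    apply: (@le_lt_trans _ _ (2 * thr j * (C * (2 `^ s) ^+ j))).
      by rewrite ler_pM2l// mulr_gt0// thr_gt0.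
    have -> : 2 * thr j * (C * (2 `^ s) ^+ j) = 2 * C / j.+1%:R.
      have gen (p J C' : R) : p != 0 -> J != 0 ->
          2 * (p^-1 / J) * (C' * p) = 2 * C' / J.
        by move=> p0 J0; field; rewrite p0 J0.
      by rewrite thrE gen ?pnatr_eq0// gt_eqF.
    rewrite ltr_pdivrMr// -ltr_pdivrMl// [ltLHS]mulrC.
    apply: lt_le_trans (truncnS_gt _) _.
    by rewrite ler_nat ltnS leq_maxr.
  have : c * tiny j <= c * \sum_(i < size W) bump (wmap w y0) (tiny j) (x i).
    by rewrite ler_wpM2l.
  have : tiny j * thr j * (1 + eta) <= tiny j * thr j * 2.
    by rewrite ler_pM2l; [lra|rewrite mulr_gt0// thr_gt0].
  have : tiny j * (2 * thr j) < tiny j * c by rewrite ltr_pM2l.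
  by lra.
apply: le_lt_trans (add_atoms_rho hd cK mu (size W) c0 Kx) _.
by rewrite cn lte_fin.
Qed.

Definition generic : set (prob_on K) :=
  \bigcap_N \bigcup_(j in [set j | (N <= j)%N]) good j.

Lemma generic_Gdelta_dense : Gdelta_dense generic.
Proof.
exists (fun N => \bigcup_(j in [set j | (N <= j)%N]) good j) => // N; split.
  by apply: bigcup_open => j _; exact: open_good.
move=> O [mu Omu] oO; have : nbhs mu O by exact: open_nbhs_nbhs.
move=> /nbhs_ballP [e /= e0 he].
have [j [nu [Nj gnu munu]]] := good_near mu N e0.
by exists nu; split; [exact: he|exists j].
Qed.

End GenericSet.

(** * Multifractal spectrum *)

Section LocalHolder.
Context {R : realType} {d : nat} (K : set 'rV[R]_d).
Hypothesis hd : (0 < d)%N.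
Implicit Types (mu : prob_on K) (x : 'rV[R]_d) (r h : R).
Local Notation T := (borel_rV R d).

(** With [p = sqrt q], Bernoulli's inequality bounds [(j + 1) * p ^ j], and the remaining factor
    [p ^ j] tends to 0. *)
Lemma linear_exp_small (q e : R) : 0 < q < 1 -> 0 < e ->
  exists N, forall j, (N <= j)%N -> j.+1%:R * q ^+ j < e.
Proof.
move=> /andP[q0 q1] e0; pose p := Num.sqrt q.
have p0 : 0 < p by rewrite sqrtr_gt0.
have pq : p ^+ 2 = q by rewrite sqr_sqrtr// ltW.
have p1 : p < 1.
  rewrite ltNge; apply/negP => p1; have : 1 <= q by rewrite -pq expr2; nra.
  by lra.
pose u := p^-1 - 1.
have u0 : 0 < u by rewrite subr_gt0 invf_gt1.
have bern j : 1 + u * j%:R <= (1 + u) ^+ j.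
  elim: j => [|j IH]; first by rewrite mulr0 addr0 expr0.
  have IH' : (1 + u * j%:R) * (1 + u) <= (1 + u) ^+ j * (1 + u).
    by rewrite ler_wpM2r//; lra.
  rewrite exprSr; apply: le_trans IH'; rewrite -natr1.
  have : 0 <= j%:R :> R by [].
  by nra.
have u1 : 1 + u = p^-1 by rewrite /u; lra.
pose M := 1 + u^-1; have M0 : 0 < M by rewrite addr_gt0// invr_gt0.
have bnd j : j.+1%:R * p ^+ j <= M.
  have pj : 0 < p ^+ j by rewrite exprn_gt0.
  rewrite -ler_pdivlMr// -exprVn -u1.
  apply: (@le_trans _ _ (M * (1 + u * j%:R))); last by rewrite ler_pM2l.
  have -> : M * (1 + u * j%:R) = 1 + u^-1 + u * j%:R + j%:R.
    by rewrite /M; field; rewrite gt_eqF.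
  rewrite -natr1; have : 0 <= u * j%:R by rewrite mulr_ge0// ltW.
  have : 0 < u^-1 by rewrite invr_gt0.
  by lra.
have eM : 0 < e / M by rewrite divr_gt0.
have pn : `|p| < 1 by rewrite gtr0_norm.
have /cvgrPdist_lt /(_ _ eM) [N _ hN] := cvg_expr pn.
exists N => j /hN /=; rewrite sub0r normrN ger0_norm ?exprn_ge0 ?(ltW p0)//.
rewrite ltr_pdivlMr// => lt; apply: le_lt_trans lt.
rewrite -pq -exprM mulnC exprM expr2 mulrA mulrC.
by rewrite ler_pM2l// exprn_gt0.
Qed.

Lemma ecball_sub x y r r' : enorm (x - y) + r <= r' -> ecball x r `<=` ecball y r'.
Proof.
move=> h z; rewrite /ecball /= => zx.
by apply: le_trans h; apply: le_trans (enorm_triangle x z y) _; rewrite addrC lerD2l.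
Qed.

Lemma mass_mono mu (A B : set 'rV[R]_d) : measurable (A : set T) ->
  measurable (B : set T) -> A `<=` B -> (mu A <= mu B)%E.
Proof. by move=> mA mB AB; apply: le_measure; rewrite ?inE. Qed.

Lemma ecball_mass_mono mu x y r r' : ecball x r `<=` ecball y r' ->
  (mu (ecball x r) <= mu (ecball y r'))%E.
Proof. by move=> h; apply: mass_mono => //; exact: measurable_ecball. Qed.

Definition holder_quotient mu x r : \bar R :=
  (lne (mu (ecball x r)) * ((ln r)^-1)%:E)%E.

Lemma holder_quotient_le mu x r h : 0 < r < 1 ->
  ((r `^ h)%:E <= mu (ecball x r))%E -> (holder_quotient mu x r <= h%:E)%E.
Proof.
move=> /andP[r0 r1]; rewrite /holder_quotient.
have mf : mu (ecball x r) \is a fin_num.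
  by apply: fin_num_measure; exact: measurable_ecball.
rewrite -(fineK mf); set p := fine _; rewrite lee_fin => rp.
have p0 : 0 < p by apply: lt_le_trans rp; rewrite powR_gt0.
have -> : lne p%:E = (ln p)%:E by rewrite /lne leNgt p0.
rewrite -EFinM lee_fin.
have lr : ln r < 0 by rewrite ln_lt0// r0.
rewrite -[leRHS](mulfK (ltr0_neq0 lr)) ler_wnM2r ?invr_le0 ?(ltW lr)//.
by rewrite -ln_powR ler_ln ?posrE// powR_gt0.
Qed.

Lemma holder_quotient_ge mu x r h : 0 < r < 1 ->
  (mu (ecball x r) < (r `^ h)%:E)%E -> (h%:E <= holder_quotient mu x r)%E.
Proof.
move=> /andP[r0 r1]; rewrite /holder_quotient.
have mf : mu (ecball x r) \is a fin_num.
  by apply: fin_num_measure; exact: measurable_ecball.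
rewrite -(fineK mf); set p := fine _; rewrite lte_fin => rp.
have lr : ln r < 0 by rewrite ln_lt0// r0.
(* For mass 0 the quotient is [-oo] times a negative number, that is [+oo]. *)
have [ple|p0] := leP p 0.
  have -> : lne p%:E = -oo%E by rewrite /lne ple.
  by rewrite lt0_mulNye ?leey// lte_fin invr_lt0.
have -> : lne p%:E = (ln p)%:E by rewrite /lne leNgt p0.
rewrite -EFinM lee_fin -[leLHS](mulfK (ltr0_neq0 lr)).
rewrite ler_wnM2r ?invr_le0 ?(ltW lr)//.
by rewrite -ln_powR ler_ln ?posrE ?powR_gt0// ltW.
Qed.

Lemma local_holder_le mu x h :
  (forall e delta, 0 < e -> 0 < delta -> exists r, [/\ 0 < r, r < delta &
     ((r `^ (h + e))%:E <= mu (ecball x r))%E]) ->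
  (local_holder mu x <= h%:E)%E.
Proof.
move=> H; rewrite /local_holder limf_einfE; apply: ge_ereal_sup => _ [V FV <-].
apply/lee_addgt0Pr => e e0; rewrite -EFinD.
move: FV => /nbhs_ballP [delta /= delta0 dV].
have m0 : 0 < Num.min delta 1 by rewrite lt_min delta0 ltr01.
have [r [r0 rd rm]] := H e (Num.min delta 1) e0 m0.
move: rd; rewrite lt_min => /andP[rdelta r1].
have r01 : 0 < r < 1 by rewrite r0.
apply: le_trans (holder_quotient_le r01 rm).
apply: ereal_inf_lbound; exists r => //.
by apply: dV => //; rewrite /ball /= sub0r normrN gtr0_norm.
Qed.

Lemma local_holder_leP mu x h : (local_holder mu x <= h%:E)%E ->
  forall e delta, 0 < e -> 0 < delta -> exists r, [/\ 0 < r, r < delta &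
     ((r `^ (h + e))%:E <= mu (ecball x r))%E].
Proof.
move=> H e delta e0 delta0; apply: contrapT => nex.
have : ((h + e)%:E <= local_holder mu x)%E.
  rewrite /local_holder limf_einfE.
  pose V := [set r : R | 0 < r < Num.min delta 1].
  apply: (@le_trans _ _ (ereal_inf [set holder_quotient mu x r | r in V])).
    apply: le_ereal_inf_tmp => _ [r /andP[r0 +] <-]; rewrite lt_min => /andP[rd r1].
    apply: holder_quotient_ge; first by rewrite r0.
    by rewrite ltNge; apply/negP => rm; apply: nex; exists r.
  apply: ereal_sup_ubound; exists V => //.
  apply/nbhs_ballP; exists (Num.min delta 1) => /=.
    by rewrite lt_min delta0 ltr01.
  move=> r; rewrite /ball /= sub0r normrN => rm r0; rewrite /V /= r0.
  by rewrite gtr0_norm in rm.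
move=> /le_trans /(_ H); rewrite lee_fin; lra.
Qed.

Lemma local_holder_le_scales mu x (a b C : R) : 0 <= a -> 0 < b -> 0 < C ->
  (forall N, exists2 j, (N <= j)%N &
     ((scale j `^ a / j.+1%:R)%:E <= mu (ecball x (C * scale j `^ b)))%E) ->
  (local_holder mu x <= (a / b)%:E)%E.
Proof.
move=> a0 b0 C0 H; apply: local_holder_le => e delta e0 delta0.
(* At radius [C * scale j ^ b] the power [a / b + e] equals [c * scale j ^ a * q ^ j], and
   [c * q ^ j] is eventually below [1 / (j + 1)]. *)
pose q : R := 2^-1 `^ (b * e); pose c := C `^ (a / b + e).
have c0 : 0 < c by exact: powR_gt0.
have q0 : 0 < q by exact: powR_gt0.
have be0 : 0 < b * e by exact: mulr_gt0.
have half_lt1 t : 0 < t -> (2^-1 : R) `^ t < 1.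
  move=> t0; rewrite /powR invr_eq0 pnatr_eq0 /= expR_lt1 pmulr_rlt0//.
  by apply: ln_lt0; rewrite invr_gt0 ltr0n invf_lt1// ltr1n.
have q1 : q < 1 by exact: half_lt1.
have ci0 : 0 < c^-1 by rewrite invr_gt0.
have [|N1 hN1] := @linear_exp_small q c^-1 _ ci0; first by rewrite q0.
have dC : 0 < delta / C by exact: divr_gt0.
have pb : 0 < (2^-1 : R) `^ b by exact: powR_gt0.
have [|N2 hN2] := @linear_exp_small (2^-1 `^ b) (delta / C) _ dC.
  by rewrite pb half_lt1.
have [j jN Hj] := H (maxn N1 N2).
have s0 : 0 < scale j :> R := scale_gt0 j.
exists (C * scale j `^ b); split.
- by rewrite mulr_gt0// powR_gt0.
- rewrite mulrC -ltr_pdivlMr// /scale powRXn ?invr_ge0//.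
  apply: le_lt_trans (hN2 j _); last by apply: leq_trans jN; exact: leq_maxr.
  by rewrite ler_peMl ?exprn_ge0 ?powR_ge0// ler1n.
apply: le_trans Hj; rewrite lee_fin powRM ?powR_ge0 ?(ltW C0)//.
rewrite -powRrM; have -> : b * (a / b + e) = a + b * e.
  by field; rewrite gt_eqF.
rewrite (@powRD _ (scale j)); last by rewrite (gt_eqF s0) implybT.
rewrite mulrCA ler_pM2l ?powR_gt0//.
have -> : scale j `^ (b * e) = q ^+ j by rewrite /scale powRXn ?invr_ge0.
have := hN1 j (leq_trans (leq_maxl _ _) jN).
rewrite -/c -[_^-1 in X in X -> _]mul1r ltr_pdivlMr// => lt.
rewrite -[leRHS]mul1r ler_pdivlMr ?ltr0n//; lra.
Qed.

End LocalHolder.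

Section Spectrum.
Context {R : realType} {d m : nat}.
Variables (S : 'I_m -> 'rV[R]_d -> 'rV[R]_d) (alpha : 'I_m -> R).
Hypothesis hS : forall i, contractive_similitude (alpha i) (S i).
Variable K : set 'rV[R]_d.
Hypothesis hd : (0 < d)%N.
Hypothesis hK : self_similar_set S K.
Variables (U : set 'rV[R]_d) (y1 : 'rV[R]_d) (a : R).
Hypothesis Usub : forall i, S i @` U `<=` U.
Hypothesis Udisj : forall i j, i != j -> S i @` U `&` S j @` U = set0.
Hypothesis a0 : 0 < a.
Hypothesis Uball : forall y, enorm (y - y1) < a -> U y.
Variables (s : R) (y0 : 'rV[R]_d).
Hypothesis s0 : 0 <= s.
Hypothesis hs : \sum_i alpha i `^ s = 1.
Hypothesis Ky0 : K y0.
Local Notation wmap := (wmap S).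
Local Notation stop := (stop alpha).
Local Notation good := (good S alpha s y0).
Local Notation generic := (generic S alpha s y0).
Local Notation T := (borel_rV R d).
Implicit Type mu : prob_on K.

Lemma tiny_le (j : nat) (b : R) : b <= j%:R -> tiny j <= scale j `^ b :> R.
Proof.
move=> bj; have s1 : 0 < scale j :> R := scale_gt0 j.
have -> : tiny j = scale j `^ j%:R :> R.
  by rewrite powR_mulrn ?(ltW s1)// /tiny /scale -exprM mulnn.
by apply: ger_powR => //; rewrite s1 scale_le1.
Qed.

(** Used with [b = 1] on all of [K] and with [b = s / h] on the Cantor set. Once [j >= b], the ball
    of radius [tiny j] about [wmap w y0] fits into the ball of radius [(L + 1) * scale j ^ b] about
    [x]. *)
Lemma near_atoms_holder mu x (b L : R) : 0 < b -> 0 <= L ->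
  (forall N, exists j, [/\ (N <= j)%N, good j mu & exists2 w,
     w \in stop (scale j) [::] & enorm (x - wmap w y0) <= L * scale j `^ b]) ->
  (local_holder mu x <= (s / b)%:E)%E.
Proof.
move=> b0 L0 H; have L1 : 0 < L + 1 by lra.
apply: (@local_holder_le_scales _ _ K hd mu x s b (L + 1)) => // N.
have [j [jN gj [w ws xw]]] := H (maxn N (Num.truncn b).+1).
exists j; first by apply: leq_trans jN; exact: leq_maxl.
apply: le_trans (good_mass hd hK gj ws) _.
apply: ecball_mass_mono => //; apply: ecball_sub.
rewrite enormBC mulrDl mul1r lerD//; apply: tiny_le.
apply: le_trans (ltW (truncnS_gt _)) _; rewrite ler_nat.
by apply: leq_trans jN; exact: leq_maxr.
Qed.

Lemma generic_good mu N : generic mu -> exists2 j, (N <= j)%N & good j mu.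
Proof. by move=> /(_ N I) [j Nj gj]; exists j. Qed.

Lemma generic_holder_le mu x : generic mu -> K x -> (local_holder mu x <= s%:E)%E.
Proof.
move=> gmu Kx; have [D D1 hD] := exists_diameter hK y0.
rewrite -(divr1 s); apply: (@near_atoms_holder mu x 1 (2 * D)) => //; first lra.
move=> N; have [j Nj gj] := generic_good N gmu; exists j; split=> //.
have [|w ws wx] := @stop_cover _ _ _ S alpha K hK (scale j) [::] x.
  by exists x.
exists w => //; rewrite powRr1 ?(ltW (scale_gt0 _))//.
apply: (wmapK_diam hS hD _ ws) => //; first exact: scale_gt0.
Qed.

(* Integrate the bounded multiplicity of the covering by the balls. *)
Lemma cell_multiplicity (L : R) : 0 <= L -> exists C : nat, forall mu j,
  (\sum_(w <- stop (scale j) [::]) mu (ecball (wmap w y0) (L * scale j))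
     <= C%:R%:E)%E.
Proof.
move=> L0; have [C hC] := stop_packing hS hK Usub Udisj a0 Uball y0 L0.
exists C => mu j; pose W := stop (scale j) [::].
pose B w := ecball (wmap w y0) (L * scale j) : set T.
have mB w : measurable (B w) by exact: measurable_ecball.
have mI w : measurable_fun setT (fun y : T => (\1_(B w) y : R)%:E).
  by apply/measurable_EFinP.
rewrite -/W; have -> : (\sum_(w <- W) mu (B w) =
    \int[mu]_y (\sum_(w <- W) (\1_(B w) y : R)%:E))%E.
  rewrite ge0_integral_sum//.
  by apply: eq_bigr => w _; rewrite integral_indic// setIT.
apply: (@le_trans _ _ (\int[mu]_y (cst C%:R%:E y))%E); last first.
  rewrite integral_cst// [X in (_ * X <= _)%E]probability_setT mule1//.
apply: ge0_le_integral => //.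
- by move=> y _; apply: sume_ge0 => w _; rewrite lee_fin.
- exact: emeasurable_sum.
move=> y _; rewrite sumEFin lee_fin.
have -> : \sum_(w <- W) \1_(B w) y = (size [seq w <- W | y \in B w])%:R :> R.
  rewrite -sum1_size natr_sum big_filter [RHS]big_mkcond.
  by apply: eq_bigr => w _; rewrite indicE; case: (y \in _).
rewrite ler_nat; apply: (hC (scale j) y) => //.
- by rewrite scale_gt0 scale_le1.
- by rewrite filter_uniq// cut_uniq.
- by move=> w; rewrite mem_filter => /andP[].
- by move=> w; rewrite mem_filter => /andP[/set_mem + _]; rewrite /B /ecball /= enormBC.
Qed.

Lemma dyadic_scale (r : R) : 0 < r -> r < 1 ->
  exists j, scale j.+1 < r /\ r <= scale j.
Proof.
move=> r0 r1; have ex : exists j, (scale j < r)%R.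
  by have [N hN] := scale_small r0; exists N; exact: hN.
case: (ex_minnP ex) => -[|j] jr jmin.
  by move: jr; rewrite /scale expr0; lra.
by exists j; split=> //; rewrite leNgt; apply/negP => /jmin; rewrite ltnn.
Qed.

Lemma scale_lt_mono (i j : nat) : scale i < scale j :> R -> (j < i)%N.
Proof.
move=> ij; rewrite ltnNge; apply/negP => ij'; move: ij; apply/negP.
rewrite -leNgt /scale -(subnKC ij') exprD ler_piMr ?exprn_ge0//.
by rewrite exprn_ile1//; lra.
Qed.

(** A point of exponent at most [g] lies, at arbitrarily deep levels, in a piece surrounded by a
    ball of mass at least about [2 ^ (-j g')]; total mass 1 and bounded multiplicity allow only
    [O(2 ^ (j g'))] such pieces. *)
Lemma holder_sublevel_null mu (g t : R) : 0 <= g -> g < t ->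
  hausdorff_measure t [set x | K x /\ (local_holder mu x <= g%:E)%E] = 0%E.
Proof.
move=> g0 gt; pose e := (t - g) / 2; pose g' := g + e.
have e0 : 0 < e by rewrite divr_gt0// subr_gt0.
have g't : g' < t by rewrite /g' /e; lra.
have g'0 : 0 < g' by rewrite /g'; lra.
have [D D1 hD] := exists_diameter hK y0.
have L0 : 0 <= 2 * D + 1 by lra.
have [C hC] := cell_multiplicity L0.
pose c : R := 2^-1 `^ g'; have c0 : 0 < c by exact: powR_gt0.
(* The extra factor [c] allows for radii that are not dyadic: [scale j.+1 < r] gives
   [c * c ^ j <= r ^ g']. *)
pose heavy j w := ((c * c ^+ j)%:E <=
  mu (ecball (wmap w y0) ((2 * D + 1) * scale j)))%E.
have D0 : 0 < 2 * D by lra.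
apply: (@limsup_cover_null _ _ _ (fun j => [seq wmap w @` K |
   w <- [seq w <- stop (scale j) [::] | heavy j w]]) (C%:R / c) (2 * D) g' t) => //.
- exact: ltW.
- move=> j V /mapP[w]; rewrite mem_filter => /andP[_ ws] -> x y.
  by apply: (wmapK_diam hS hD _ ws); exact: scale_gt0.
- move=> j; rewrite size_map.
  have ccj : 0 < c * c ^+ j by rewrite mulr_gt0// exprn_gt0.
  have -> : C%:R / c * (2 `^ g') ^+ j = C%:R / (c * c ^+ j).
    rewrite invfM -exprVn /c powRVl// invrK mulrA; congr (_ * _).
  rewrite ler_pdivlMr// -lee_fin; apply: le_trans (hC mu j).
  rewrite -sum1_size natr_sum mulr_suml -sumEFin big_filter.
  rewrite [leLHS]big_mkcond; apply: lee_sum => w _; case: ifP => // hw.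
  by rewrite mul1r.
move=> J x [Kx hx].
have [r [r0 rd rm]] := local_holder_leP hd hx e0 (scale_gt0 J).
have r1 : r < 1 by apply: lt_le_trans rd (scale_le1 _).
have [j [jr rj]] := dyadic_scale r0 r1.
have Jj : (J <= j)%N by rewrite -ltnS; apply: scale_lt_mono; exact: lt_trans jr rd.
have [|w ws wx] := @stop_cover _ _ _ S alpha K hK (scale j) [::] x.
  by exists x.
exists j, (wmap w @` K); split=> //; apply: map_f; rewrite mem_filter ws andbT.
rewrite /heavy; apply: (@le_trans _ _ (r `^ g')%:E).
  rewrite lee_fin -exprS /c -powRXn ?invr_ge0// -/(scale _).
  apply: ge0_ler_powR; rewrite ?nnegrE ?(ltW g'0) ?(ltW r0) ?(ltW jr)//.
  exact: ltW (scale_gt0 _).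
apply: le_trans rm _; apply: ecball_mass_mono => //; apply: ecball_sub.
rewrite mulrDl mul1r lerD//; apply: (wmapK_diam hS hD _ ws) => //.
exact: scale_gt0.
Qed.

Lemma spectrum_le mu h : 0 <= h -> (spectrum mu h <= h%:E)%E.
Proof.
move=> h0; apply/lee_addgt0Pr => e e0; rewrite -EFinD.
have he : 0 <= h + e by rewrite addr_ge0// ltW.
apply: hausdorff_dim_le => //.
have hh : h < h + e by rewrite ltrDl.
have /hausdorff_measure0P H := holder_sublevel_null mu h0 hh.
apply/hausdorff_measure0P => delta e' d0 e'0.
have [V [Vd AV Ve]] := H delta e' d0 e'0; exists V; split=> //.
by move=> x [Kx hx]; apply: AV; split=> //; rewrite hx.
Qed.

Lemma spectrum_ge mu h : generic mu -> 0 < h -> h <= s ->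
  (h%:E <= spectrum mu h)%E.
Proof.
move=> gmu h0 hls; have s1 : 0 < s by exact: lt_le_trans hls.
have [D D1 hD] := exists_diameter hK y0.
have D0 : 0 <= 2 * D by lra.
have infJ N : exists2 j, (N <= j)%N & [set j | good j mu] j.
  exact: generic_good.
have [f [fK ff]] := cantor_set hS hd hK Usub Udisj a0 Uball hs Ky0 infJ h0
  hls hD.
have fh x : 0 <= x < 1 -> (local_holder mu (f x) <= h%:E)%E.
  move=> /fK[Kx H].
  have -> : h = s / (s / h) by rewrite invf_div mulrC divfK// gt_eqF.
  by apply: (near_atoms_holder _ D0 H); rewrite divr_gt0.
apply: hausdorff_dim_ge => t /andP[t0 th] Et.
pose gg n : R := h - h / n.+2%:R.
have gg0 n : 0 <= gg n.
  by rewrite subr_ge0 ler_pdivrMr// ler_peMr ?(ltW h0)// ler1n.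
have ggh n : gg n < h by rewrite gtrBl divr_gt0.
(* A point avoiding all [A n.+1] has exponent at least [h], since [gg n] tends to [h]; with [fh] its
   exponent is [h], so it cannot avoid [A 0]. *)
pose A n := if n is n'.+1
  then [set x | K x /\ (local_holder mu x <= (gg n')%:E)%E]
  else level_set mu h.
have [[|n]|x x01 hx] := @frostman_avoids _ _ f h A ff.
- by exists t => //; rewrite t0.
- exists ((gg n + h) / 2); first by have := gg0 n; have := ggh n; lra.
  by apply: holder_sublevel_null => //; have := ggh n; lra.
have [Kx _] := fK x x01.
have := hx 0%N; apply; split=> //.
apply/eqP; rewrite eq_le fh//= leNgt; apply/negP => lt.
have : exists n, (local_holder mu (f x) <= (gg n)%:E)%E.
  move: lt; case: (local_holder mu (f x)) => [v| |].
  - rewrite lte_fin => vh; have vh0 : 0 < h - v by rewrite subr_gt0.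
    exists (Num.truncn (h / (h - v))); rewrite lee_fin /gg lerBrDl -lerBrDr.
    rewrite ler_pdivrMr// mulrC -ler_pdivrMr//.
    by apply: ltW; apply: lt_le_trans (truncnS_gt _) _; rewrite ler_nat.
  - by rewrite ltNge leey.
  - by move=> _; exists 0%N; rewrite leNye.
by case=> n hn; apply: (hx n.+1).
Qed.

Lemma spectrumE mu h : generic mu -> 0 <= h <= s -> spectrum mu h = h%:E.
Proof.
move=> gmu /andP[h0 hls]; apply/eqP; rewrite eq_le spectrum_le//=.
(* At [h = 0] the lower bound is void: every Hausdorff dimension is nonnegative, even that of an
   empty level set. *)
have [->|hn0] := eqVneq h 0.
  apply: hausdorff_dim_ge => t /andP[t0 t1].
  by have := le_lt_trans t0 t1; rewrite ltxx.
by apply: spectrum_ge => //; rewrite lt_neqAle eq_sym hn0.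
Qed.

Lemma level_set_gt mu h : generic mu -> s < h -> level_set mu h = set0.
Proof.
move=> gmu sh; rewrite -subset0 => x [Kx hx].
by have := generic_holder_le gmu Kx; rewrite hx lee_fin leNgt sh.
Qed.

End Spectrum.

(** * L^q spectrum *)

Section IndexNeighbours.
Context {d : nat}.
Implicit Types k : 'rV[int]_d.

Definition neighbours (B : nat) k : seq 'rV[int]_d :=
  [seq k + \row_i ((o i : nat)%:Z - B%:Z)
    | o : {ffun 'I_d -> 'I_(B.*2.+1)} <- enum {ffun 'I_d -> 'I_(B.*2.+1)}].

Lemma size_neighbours B k : size (neighbours B k) = (B.*2.+1 ^ d)%N.
Proof. by rewrite size_map -cardT card_ffun !card_ord. Qed.

Lemma mem_neighbours B k k' :
  (forall i, `|k' ord0 i - k ord0 i| <= B%:Z) -> k' \in neighbours B k.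
Proof.
move=> h; pose o : {ffun 'I_d -> 'I_(B.*2.+1)} :=
  [ffun i => inord (absz (k' ord0 i - k ord0 i + B%:Z))].
apply/mapP; exists o; first by rewrite mem_enum.
apply/rowP => i; rewrite !mxE /o ffunE.
have := h i; set u := k' ord0 i; set v := k ord0 i => uv.
by rewrite inordK; lia.
Qed.

Lemma neighbours_dist B k k' : k' \in neighbours B k ->
  forall i, `|k' ord0 i - k ord0 i| <= B%:Z.
Proof.
move=> /mapP[c _ ->] i; rewrite !mxE; have := ltn_ord (c i).
by rewrite addrAC subrr add0r; move: (nat_of_ord (c i)) => n; lia.
Qed.

End IndexNeighbours.

Section DyadicCubes.
Context {R : realType} {d : nat}.
Hypothesis hd : (0 < d)%N.
Local Notation T := (borel_rV R d).
Implicit Types (x y : 'rV[R]_d) (k : 'rV[int]_d) (j : nat).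

Definition cube_index j x : 'rV[int]_d :=
  \row_i Num.floor (x ord0 i * 2 ^+ j).

Lemma dyadic_cubeE j k x : dyadic_cube j k x <-> cube_index j x = k.
Proof.
have p0 : 0 < 2 ^+ j :> R by rewrite exprn_gt0.
split=> [h|<- i].
  apply/rowP => i; rewrite mxE; apply: floor_def.
  by have := h i; rewrite ler_pdivrMr// ltr_pdivlMr.
by rewrite mxE ler_pdivrMr// ltr_pdivlMr// floor_itv.
Qed.

Lemma open_coord_lt (i : 'I_d) (c : R) : open [set x : 'rV[R]_d | x ord0 i < c].
Proof.
apply: open_enormP => // x xi.
exists (c - x ord0 i); first by rewrite subr_gt0.
move=> y yx; have := coord_le_enorm (y - x) i; rewrite !mxE ler_norml /=.
by move=> /andP[h1 h2]; lra.
Qed.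

Lemma measurable_dyadic_cube j k : measurable (dyadic_cube j k : set T).
Proof.
have -> : dyadic_cube j k = \bigcap_(i in [set: 'I_d])
    (~` [set x : 'rV[R]_d | x ord0 i < (k ord0 i)%:~R / 2 ^+ j] `&`
     [set x : 'rV[R]_d | x ord0 i < (k ord0 i + 1)%:~R / 2 ^+ j]).
  apply/seteqP; split=> [x h i _|x h i].
    have /andP[h1 h2] := h i; split=> //=.
    by apply/negP; rewrite -leNgt.
  have [/= /negP h1 h2] := h i I; rewrite -leNgt in h1.
  by rewrite h1.
apply: fin_bigcap_measurable => // i _; apply: measurableI.
  by apply: measurableC; apply: measurable_open_rV; exact: open_coord_lt.
by apply: measurable_open_rV; exact: open_coord_lt.
Qed.

Lemma cube_index_near j x y (L : R) (B : nat) : L + 1 <= B%:R ->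
  enorm (y - x) <= L * scale j ->
  forall i, `|cube_index j y ord0 i - cube_index j x ord0 i| <= B%:Z.
Proof.
move=> LB yx i; rewrite !mxE.
have p0 : 0 < 2 ^+ j :> R by rewrite exprn_gt0.
have := le_trans (coord_le_enorm (y - x) i) yx; rewrite !mxE.
rewrite /scale exprVn ler_pdivlMr// -{1}(gtr0_norm p0) -normrM mulrBl.
set u := _ * _; set v := x _ _ * _ => uv.
have /andP[u1 u2] := floor_itv u; have /andP[v1 v2] := floor_itv v.
rewrite -(ler_int R) intr_norm rmorphB /=.
move: uv u2 v2; rewrite !rmorphD /= !ler_norml => /andP[h1 h2] h3 h4.
by apply/andP; split; lra.
Qed.

Lemma cube_index_dist j x y (B : nat) :
  (forall i, `|cube_index j y ord0 i - cube_index j x ord0 i| <= B%:Z) ->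
  enorm (y - x) <= d%:R * (B%:R + 1) * scale j.
Proof.
move=> h; apply: le_trans (enorm_le_sum _) _.
have -> : d%:R * (B%:R + 1) * scale j = \sum_(i < d) (B%:R + 1) * scale j :> R.
  by rewrite sumr_const card_ord -[RHS]mulr_natl mulrA.
apply: ler_sum => i _; have := h i; rewrite !mxE => hfl.
have p0 : 0 < 2 ^+ j :> R by rewrite exprn_gt0.
rewrite /scale exprVn ler_pdivlMr// -{1}(gtr0_norm p0) -normrM mulrBl.
set u := _ * _; set v := x _ _ * _; rewrite -/u -/v in hfl.
have /andP[u1 u2] := floor_itv u; have /andP[v1 v2] := floor_itv v.
move: hfl; rewrite -(ler_int R) intr_norm rmorphB /=.
move: u2 v2; rewrite !rmorphD /= !ler_norml => h3 h4 /andP[h1 h2].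
by apply/andP; split; lra.
Qed.

Lemma mass_le_cubes (K : set 'rV[R]_d) (mu : prob_on K) j (A : set 'rV[R]_d)
    (l : seq 'rV[int]_d) : measurable (A : set T) ->
  (forall x, A x -> cube_index j x \in l) ->
  (mu A <= \sum_(k <- undup l) mu (dyadic_cube j k))%E.
Proof.
move=> mA Al; rewrite fsbig_seq ?undup_uniq//.
apply: content_sub_fsum => //.
  by move=> k _; exact: measurable_dyadic_cube.
move=> x /Al xl; exists (cube_index j x); first by rewrite /= mem_undup.
exact/dyadic_cubeE.
Qed.

(** A ball of radius at most the side of the cubes is covered by the [5 ^ d] cubes whose indices are
    within 2 of that of its centre; one of them carries at least the average. *)
Lemma heavy_neighbour (K : set 'rV[R]_d) (mu : prob_on K) j x (r theta : R) :
  r <= scale j -> (theta%:E <= mu (ecball x r))%E ->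
  exists2 k, k \in neighbours 2 (cube_index j x) &
    ((theta / (5 ^ d)%:R)%:E <= mu (dyadic_cube j k))%E.
Proof.
move=> rj th; apply: contrapT => nex.
have Q0 : 0 < (5 ^ d)%:R :> R by rewrite ltr0n expn_gt0.
pose l := neighbours 2 (cube_index j x).
have mE k : mu (dyadic_cube j k) \is a fin_num.
  by apply: fin_num_measure; exact: measurable_dyadic_cube.
have small k : k \in undup l -> fine (mu (dyadic_cube j k)) < theta / (5 ^ d)%:R.
  rewrite mem_undup => kl; rewrite ltNge; apply/negP => H.
  by apply: nex; exists k => //; rewrite -(fineK (mE k)) lee_fin.
have := @mass_le_cubes K mu j (ecball x r) l (measurable_ecball hd x r).
move=> /(_ _)/(le_trans th) H.
have {H}: (theta%:E <= \sum_(k <- undup l) mu (dyadic_cube j k))%E.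
  apply: H => y yx; apply: mem_neighbours.
  apply: (@cube_index_near j x y 1 2); first lra.
  by rewrite mul1r; apply: le_trans rj.
rewrite (eq_bigr (fun k => (fine (mu (dyadic_cube j k)))%:E)); last first.
  by move=> k _; rewrite fineK.
rewrite sumEFin lee_fin.
have l0 : (0 < size (undup l))%N.
  have : cube_index j x \in undup l.
    by rewrite mem_undup; apply: mem_neighbours => i; rewrite subrr normr0.
  by case: (undup l).
have size_l : (size (undup l) <= 5 ^ d)%N.
  by apply: leq_trans (size_undup _) _; rewrite /l size_neighbours.
apply/negP; rewrite -ltNge.
case: (undup l) l0 size_l small => // k0 l' _ size_l small.
have thpos : 0 < theta / (5 ^ d)%:R.
  apply: le_lt_trans (small k0 (mem_head _ _)).
  by rewrite fine_ge0.
rewrite big_cons.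
apply: (@lt_le_trans _ _ (theta / (5 ^ d)%:R + \sum_(k <- l') theta / (5 ^ d)%:R)).
  apply: ltr_leD; first exact: small (mem_head _ _).
  rewrite big_seq [leRHS]big_seq; apply: ler_sum => k kl'.
  by apply/ltW/small; rewrite inE kl' orbT.
rewrite big_const_seq count_predT iter_addr_0 -mulrS -[(size l').+1]/(size (k0 :: l')).
rewrite -[leLHS]mulr_natl mulrCA ger_pMr; last first.
  by rewrite pmulr_lgt0 ?invr_gt0// in thpos.
by rewrite ler_pdivrMr// mul1r ler_nat.
Qed.

End DyadicCubes.

(** * Power sums of probability vectors *)

Section PowerSums.
Context {R : realType}.
Implicit Types (y q : R).

Lemma powR_ge_tangent y q : 0 < y -> q <= 0 -> 1 + q * (y - 1) <= y `^ q.
Proof.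
move=> y0 q0; rewrite /powR gt_eqF//; apply: le_trans (expR_ge1Dx _).
rewrite lerD2l ler_wnM2l//.
have := expR_ge1Dx (ln y); rewrite lnK ?posrE//; lra.
Qed.

(** Concavity from [1 + x <= expR x] alone: in [q] times [e1] plus [1 - q] times [e2] the terms in
    [u] cancel. *)
Lemma powR_le_tangent y q : 0 < y -> 0 <= q <= 1 -> y `^ q <= 1 + q * (y - 1).
Proof.
move=> y0 /andP[q0 q1]; rewrite /powR gt_eqF//.
set u := ln y; have yE : y = expR u by rewrite /u lnK.
rewrite [in leRHS]yE.
have e1 : expR (q * u) * (1 + (1 - q) * u) <= expR u.
  have uE : u = q * u + (1 - q) * u by ring.
  by rewrite [X in _ <= expR X]uE expRD ler_pM2l ?expR_gt0// expR_ge1Dx.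
have e2 : expR (q * u) * (1 - q * u) <= 1.
  have E : expR (q * u) * expR (- (q * u)) = 1 by rewrite -expRD subrr expR0.
  by rewrite -[leRHS]E ler_pM2l ?expR_gt0// expR_ge1Dx.
have q1' : 0 <= 1 - q by lra.
have := ler_wpM2l q0 e1; have := ler_wpM2l q1' e2.
set E := expR (q * u); nra.
Qed.

End PowerSums.

Lemma fiber_count (A B : eqType) (l : seq A) (l' : seq B) (f : A -> B) (M : nat) :
  {in l, forall x, f x \in l'} ->
  (forall k, (size [seq x <- l | f x == k] <= M)%N) ->
  (size l <= M * size l')%N.
Proof.
elim: l' l => [|k l' IH] l fl hM.
  by case: l fl {hM} => // x l /(_ x (mem_head _ _)).
have {}IH : (size [seq x <- l | f x != k] <= M * size l')%N.
  apply: IH => [x|k'].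
    rewrite mem_filter => /andP[xk /fl]; rewrite inE (negbTE xk).
    by [].
  rewrite -filter_predI; apply: leq_trans (hM k').
  by rewrite !size_filter; apply: sub_count => x /andP[].
rewrite mulnS -(count_predC (fun x => f x == k) l) -!size_filter.
by apply: leq_add => //; exact: hM.
Qed.

Section PowerMean.
Context {R : realType} (I : eqType) (l : seq I) (p : I -> R).
Hypothesis p_gt0 : {in l, forall i, 0 < p i}.
Hypothesis p_sum : \sum_(i <- l) p i = 1.
Let n : R := (size l)%:R.

Let n_gt0 : 0 < n.
Proof.
rewrite ltr0n; case: (l) p_sum => //; rewrite big_nil => /esym/eqP.
by rewrite oner_eq0.
Qed.

(** Jensen's inequality by tangents: the numbers [n * p i] have mean 1, so the linear terms cancel
    and the value for equal masses is left. *)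
Let tangent_sum q : \sum_(i <- l) n `^ (- q) * (1 + q * (n * p i - 1)) = n `^ (1 - q).
Proof.
rewrite -mulr_sumr big_split /= -mulr_sumr sumrB -mulr_sumr p_sum.
rewrite big_const_seq count_predT iter_addr_0 -/n mulr1 subrr mulr0 addr0.
rewrite (@powRD _ n 1 (- q)); last by apply/implyP => _; rewrite gt_eqF.
by rewrite powRr1 ?(ltW n_gt0)// mulrC.
Qed.

Let powR_scale q i : i \in l -> p i `^ q = n `^ (- q) * (n * p i) `^ q.
Proof.
move=> il; rewrite powRM ?(ltW n_gt0) ?(ltW (p_gt0 il))// mulrA.
by rewrite powRN mulVf ?mul1r// gt_eqF// powR_gt0.
Qed.

Lemma power_mean_le q : 0 <= q <= 1 -> \sum_(i <- l) p i `^ q <= n `^ (1 - q).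
Proof.
move=> q01; rewrite -tangent_sum big_seq [leRHS]big_seq; apply: ler_sum => i il.
rewrite powR_scale// ler_pM2l ?powR_gt0//; apply: powR_le_tangent => //.
by rewrite mulr_gt0// p_gt0.
Qed.

Lemma power_mean_ge q : q <= 0 -> n `^ (1 - q) <= \sum_(i <- l) p i `^ q.
Proof.
move=> q01; rewrite -tangent_sum big_seq [leRHS]big_seq; apply: ler_sum => i il.
rewrite powR_scale// ler_pM2l ?powR_gt0//; apply: powR_ge_tangent => //.
by rewrite mulr_gt0// p_gt0.
Qed.

End PowerMean.

Section LqSpectrum.
Context {R : realType} {d m : nat}.
Variables (S : 'I_m -> 'rV[R]_d -> 'rV[R]_d) (alpha : 'I_m -> R).
Hypothesis hS : forall i, contractive_similitude (alpha i) (S i).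
Variable K : set 'rV[R]_d.
Hypothesis hd : (0 < d)%N.
Hypothesis hK : self_similar_set S K.
Variables (U : set 'rV[R]_d) (y1 : 'rV[R]_d) (a : R).
Hypothesis Usub : forall i, S i @` U `<=` U.
Hypothesis Udisj : forall i j, i != j -> S i @` U `&` S j @` U = set0.
Hypothesis a0 : 0 < a.
Hypothesis Uball : forall y, enorm (y - y1) < a -> U y.
Variables (s : R) (y0 : 'rV[R]_d).
Hypothesis s0 : 0 <= s.
Hypothesis hs : \sum_i alpha i `^ s = 1.
Hypothesis Ky0 : K y0.
Local Notation wmap := (wmap S).
Local Notation amin := (amin alpha).
Local Notation stop := (stop alpha).
Local Notation good := (good S alpha s y0).
Local Notation generic := (generic S alpha s y0).
Local Notation T := (borel_rV R d).
Implicit Types (mu : prob_on K) (k : 'rV[int]_d) (j : nat).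

Let cK : closed K.
Proof. by case: hK => _ c _; apply: compact_closed c; exact: norm_hausdorff. Qed.

Let mK : measurable (K : set T).
Proof. exact: measurable_closed_rV. Qed.

Definition cube_mass mu j k : R := fine (mu (dyadic_cube j k)).

Definition partition_sum mu j (q : R) : \bar R :=
  (\esum_(Q in dyadic_cubes j `&` [set Q | mu Q != 0]) poweR (mu Q) q)%E.

Lemma cube_massE mu j k : mu (dyadic_cube j k) = (cube_mass mu j k)%:E.
Proof.
rewrite fineK//; apply: fin_num_measure; exact: measurable_dyadic_cube.
Qed.

Lemma cube_mass_ge0 mu j k : 0 <= cube_mass mu j k.
Proof. by rewrite fine_ge0. Qed.

Lemma charged_cubes : exists C : nat, forall mu j, exists l : seq 'rV[int]_d,
  [/\ uniq l, (size l <= C * size (stop (scale j) [::]))%N,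
      forall k, (k \in l) = (0 < cube_mass mu j k),
      \sum_(k <- l) cube_mass mu j k = 1 &
      forall q, partition_sum mu j q = (\sum_(k <- l) cube_mass mu j k `^ q)%:E].
Proof.
have [D D1 hD] := exists_diameter hK y0.
pose B := (Num.truncn (2 * D + 1)).+1.
have BD : 2 * D + 1 <= B%:R by exact: ltW (truncnS_gt _).
exists (B.*2.+1 ^ d)%N => mu j; set W := stop _ _.
pose l1 := flatten [seq neighbours B (cube_index j (wmap w y0)) | w <- W].
pose l := [seq k <- undup l1 | 0 < cube_mass mu j k].
have Kl x : K x -> cube_index j x \in l1.
  move=> Kx; have [|w ws wx] := @stop_cover _ _ _ S alpha K hK (scale j) [::] x.
    by exists x.
  apply/flatten_mapP; exists w => //; apply: mem_neighbours => //.
  apply: (cube_index_near BD); apply: (wmapK_diam hS hD _ ws) => //.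
  exact: scale_gt0.
have mem_l k : (k \in l) = (0 < cube_mass mu j k).
  rewrite mem_filter mem_undup; case: (ltP 0 (cube_mass mu j k)) => // k0.
  rewrite /=; apply: contraT => nk; move: k0; rewrite ltNge => /negP; case.
  rewrite -lee_fin -cube_massE.
  have -> : 0%:E = mu (~` K).
    by rewrite probability_setC// mass_setT subee.
  apply: mass_mono; [exact: measurable_dyadic_cube|exact: measurableC|].
  by move=> x /dyadic_cubeE xk Kx; move: nk; rewrite -xk Kl.
have inj k k' (x : 'rV[R]_d) : dyadic_cube j k x -> dyadic_cube j k' x -> k = k'.
  by move=> /dyadic_cubeE <- /dyadic_cubeE <-.
exists l; split=> //.
- by rewrite filter_uniq// undup_uniq.
- apply: leq_trans (size_subseq (filter_subseq _ _)) _.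
  apply: leq_trans (size_undup _) _.
  rewrite size_flatten /shape -map_comp sumnE big_map.
  rewrite (eq_bigr (fun=> B.*2.+1 ^ d)%N); last by move=> w _; exact: size_neighbours.
  by rewrite big_const_seq count_predT iter_addn_0.
- have -> : \sum_(k <- l) cube_mass mu j k = \sum_(k <- undup l1) cube_mass mu j k.
    rewrite [RHS](bigID (fun k => 0 < cube_mass mu j k))/= big_filter.
    rewrite [X in _ = _ + X]big1 ?addr0// => k; rewrite -leNgt => k0.
    by apply/le_anti; rewrite k0 cube_mass_ge0.
  apply: EFin_inj; rewrite -sumEFin.
  under eq_bigr do rewrite -cube_massE.
  apply/eqP; rewrite eq_le; apply/andP; split; last first.
    by rewrite -(mass_setT mu); apply: mass_le_cubes.
  rewrite fsbig_seq ?undup_uniq// -measure_fin_bigcup//.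
  + apply: probability_le1; apply: fin_bigcup_measurable => // k _.
    exact: measurable_dyadic_cube.
  + by move=> k k' _ _ [x [xk xk']]; exact: (inj k k' x).
  + by move=> k _; exact: measurable_dyadic_cube.
move=> q; rewrite /partition_sum.
(* A charged cube contains a point, hence determines its index; this makes the passage from sets to
   indices injective. *)
rewrite (reindex_esum [set` l] _ (dyadic_cube j)); last first.
  split.
  - move=> k /=; rewrite mem_l => k0; split; first by exists k.
    by rewrite /= cube_massE eqe gt_eqF.
  - move=> k k'; rewrite !inE /= mem_l => k0 _ kk.
    have [x xk] : dyadic_cube (R := R) j k !=set0.
      apply/set0P/eqP => E; move: k0; rewrite /cube_mass E measure0.
      by rewrite ltxx.
    by apply: (inj k k' x) => //; rewrite -kk.
  - move=> Q [[k _ <-] /= k0]; exists k => //=; rewrite mem_l lt0r cube_mass_ge0.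
    by rewrite andbT; move: k0; rewrite cube_massE eqe.
rewrite esum_fset//; last by move=> k _; exact: poweR_ge0.
  rewrite -fsbig_seq ?filter_uniq ?undup_uniq// -sumEFin.
  by apply: eq_bigr => k _; rewrite cube_massE poweR_EFin.
by apply/finite_seqP; exists l.
Qed.

Lemma tiny_le_scale j : tiny j <= scale j :> R.
Proof.
rewrite /tiny /scale; apply: ler_wiXn2l => //; first lra.
by case: j => // j; rewrite -mulnn leq_pmulr.
Qed.

(** Each word is sent to a heavy cube near its point [wmap w y0]; words sent to the same cube have
    close points, so by packing there are at most [M] of them. *)
Lemma heavy_cubes : exists M : nat, forall mu j (l : seq 'rV[int]_d),
  good j mu -> (forall k, (k \in l) = (0 < cube_mass mu j k)) ->
  (size (stop (scale j) [::]) <=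
     M * size [seq k <- l | (thr s j / (5 ^ d)%:R <= cube_mass mu j k)%R])%N.
Proof.
(* Two indices within 2 of that of the same cube are within 4 of each other, hence [4 + 1] from
   [cube_index_dist]. *)
have L0 : 0 <= d%:R * (4%:R + 1) :> R by rewrite mulr_ge0.
have [M hM] := stop_packing hS hK Usub Udisj a0 Uball y0 L0.
exists M => mu j l gj mem_l; set W := stop _ _.
pose l' := [seq k <- l | thr s j / (5 ^ d)%:R <= cube_mass mu j k].
rewrite -/l'.
have thr0 : 0 < thr s j / (5 ^ d)%:R.
  by rewrite divr_gt0 ?thr_gt0// ltr0n expn_gt0.
have /choice[f hf] : forall w, exists k, w \in W ->
    k \in neighbours 2 (cube_index j (wmap w y0)) /\ k \in l'.
  move=> w; have [ws|nw] := boolP (w \in W); last by exists 0.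
  have := heavy_neighbour hd (tiny_le_scale j) (good_mass hd hK gj ws).
  move=> [k kn kth]; exists k => _; split=> //.
  move: kth; rewrite cube_massE lee_fin => kth.
  by rewrite mem_filter kth mem_l (lt_le_trans thr0 kth).
apply: (@fiber_count _ _ W l' f M) => [w /hf[]//|k].
case E : [seq w <- W | f w == k] => [//|w0 l0]; rewrite -E.
have : w0 \in [seq w <- W | f w == k] by rewrite E mem_head.
rewrite mem_filter => /andP[/eqP fw0 w0W].
apply: (hM (scale j) (wmap w0 y0)).
- by rewrite scale_gt0 scale_le1.
- by rewrite filter_uniq// cut_uniq.
- by move=> w; rewrite mem_filter => /andP[].
move=> w; rewrite mem_filter => /andP[/eqP fw wW].
apply: cube_index_dist => i.
have [/neighbours_dist/(_ i) h1 _] := hf w wW.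
have [/neighbours_dist/(_ i) h2 _] := hf w0 w0W.
move: h1 h2; rewrite fw fw0.
by set u := k ord0 i; set v := _ ord0 i; set v' := cube_index _ _ ord0 i; lia.
Qed.

Lemma ln_scale_powR j (u : R) : ln (scale j `^ u) = - (u * (j%:R * ln 2)).
Proof.
rewrite ln_powR /scale lnXn ?invr_gt0// lnV ?posrE//.
by rewrite -mulr_natl; ring.
Qed.

Let ln2_gt0 : 0 < ln 2 :> R.
Proof. by rewrite ln_gt0// ltr1n. Qed.

Lemma Lq_quotientE j (z : R) : 0 < z ->
  (- (lne z%:E * ((j%:R * ln 2)^-1)%:E))%E = (- (ln z / (j%:R * ln 2)))%:E.
Proof. by move=> z0; rewrite /lne leNgt z0. Qed.

Lemma Lq_spectrum_le mu (q v : R) :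
  (forall e N, 0 < e -> exists j z, [/\ (N <= j)%N, (0 < j)%N,
     partition_sum mu j q = z%:E & scale j `^ (v + e) <= z]) ->
  (Lq_spectrum mu q <= v%:E)%E.
Proof.
move=> H; rewrite /Lq_spectrum /limn_einf /limn_esup -/(limf_einf _ _) limf_einfE.
apply: ge_ereal_sup => _ [V [N _ NV] <-].
apply/lee_addgt0Pr => e e0; rewrite -EFinD.
have [j [z [Nj j0 Zz zle]]] := H e N e0.
have p0 : 0 < scale j `^ (v + e) by rewrite powR_gt0// scale_gt0.
have z0 : 0 < z by exact: lt_le_trans zle.
apply: le_trans (_ : ((- (ln z / (j%:R * ln 2)))%:E <= _)%E).
  apply: ereal_inf_lbound; exists j; first exact: NV.
  by rewrite -Lq_quotientE// -Zz.
have jl : 0 < j%:R * ln 2 :> R by rewrite mulr_gt0// ltr0n.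
rewrite lee_fin lerNl ler_pdivlMr// mulNr -ln_scale_powR.
by rewrite ler_ln ?posrE.
Qed.

Lemma Lq_spectrum_ge mu (q v : R) :
  (forall e, 0 < e -> exists N, forall j, (N <= j)%N -> exists z,
     [/\ 0 < z, partition_sum mu j q = z%:E & z <= scale j `^ (v - e)]) ->
  (v%:E <= Lq_spectrum mu q)%E.
Proof.
move=> H; rewrite /Lq_spectrum /limn_einf /limn_esup -/(limf_einf _ _) limf_einfE.
apply/lee_addgt0Pr => e e0; have [N hN] := H e e0.
rewrite -leeBlDr// -EFinB.
(* The index 0 is left out, where the denominator [j * ln 2] vanishes. *)
pose V := [set j | (N.+1 <= j)%N].
apply: le_trans (_ : (ereal_inf [set - (lne (partition_sum mu j q) *
   ((j%:R * ln 2)^-1)%:E) | j in V] <= _)%E); last first.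
  by apply: ereal_sup_ubound; exists V => //; exists N.+1.
apply: le_ereal_inf_tmp => _ [j Nj <-].
have [z [z0 -> zle]] := hN j (ltnW Nj).
rewrite Lq_quotientE// lee_fin.
have jl : 0 < j%:R * ln 2 :> R by rewrite mulr_gt0// ltr0n (leq_ltn_trans _ Nj).
rewrite lerNr ler_pdivrMr// mulNr -ln_scale_powR.
by rewrite ler_ln ?posrE// powR_gt0// scale_gt0.
Qed.

Lemma scale_powR_small (c e : R) : 0 < c -> 0 < e ->
  exists N, forall j, (N <= j)%N -> scale j `^ e <= c / j.+1%:R.
Proof.
move=> c0 e0; have q01 : 0 < (2^-1 : R) `^ e < 1.
  rewrite powR_gt0//= /powR invr_eq0 pnatr_eq0 /= expR_lt1 pmulr_rlt0//.
  by apply: ln_lt0; rewrite invr_gt0 ltr0n invf_lt1// ltr1n.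
have [N hN] := linear_exp_small q01 c0; exists N => j /hN /ltW.
by rewrite /scale powRXn ?invr_ge0// ler_pdivlMr// mulrC.
Qed.

Lemma thr_scale_ge (c e : R) : 0 < c -> 0 < e ->
  exists N, forall j, (N <= j)%N -> scale j `^ (s + e) <= c * thr s j.
Proof.
move=> c0 e0; have [N hN] := scale_powR_small c0 e0; exists N => j /hN h.
have s1 : 0 < scale j :> R := scale_gt0 j.
rewrite (@powRD _ (scale j)); last by apply/implyP => _; rewrite gt_eqF.
by rewrite /thr mulrCA ler_pM2l// powR_gt0.
Qed.

Lemma scale_powR_le_mono j (u v : R) : v <= u -> scale j `^ u <= scale j `^ v.
Proof. by apply: ger_powR; rewrite scale_gt0 scale_le1. Qed.

Lemma stop_size_scale j :
  scale j `^ (- s) <= (size (stop (scale j) [::]))%:R.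
Proof.
apply: le_trans (stop_size_ge hS s0 hs j).
by rewrite powRN /scale powRXn ?invr_ge0// powRVl// exprVn invrK.
Qed.

Lemma subset_partition_sum mu j (q : R) (l l' : seq 'rV[int]_d) :
  {subset l' <= l} -> uniq l' ->
  \sum_(k <- l') cube_mass mu j k `^ q <= \sum_(k <- l) cube_mass mu j k `^ q.
Proof.
elim: l l' => [|k l IH] l' sub ul'.
  by case: l' sub {ul'} => // k l' /(_ k (mem_head _ _)).
rewrite big_cons; have {}IH : \sum_(i <- rem k l') cube_mass mu j i `^ q <=
    \sum_(i <- l) cube_mass mu j i `^ q.
  apply: IH; last exact: rem_uniq.
  move=> i; rewrite mem_rem_uniq// inE => /andP[ik /sub].
  by rewrite inE (negbTE ik).
have [kl|nk] := boolP (k \in l'); last first.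
  by rewrite rem_id// in IH; apply: le_trans IH _; rewrite lerDr powR_ge0.
by rewrite (big_rem k kl) /= lerD2l.
Qed.

(** The constants [5 ^ d] and [M.+1] and the factor [j + 1] are swallowed by [scale j ^ e]; [M.+1]
    replaces [M] so as to be invertible. *)
Lemma heavy_cubes_scale (e : R) : 0 < e ->
  exists N, forall mu j (l : seq 'rV[int]_d), (N <= j)%N -> good j mu ->
    (forall k, (k \in l) = (0 < cube_mass mu j k)) ->
    scale j `^ (s + e) <= thr s j / (5 ^ d)%:R /\
    scale j `^ (e - s) <=
      (size [seq k <- l | thr s j / (5 ^ d)%:R <= cube_mass mu j k])%:R.
Proof.
move=> e0; have [M hM] := heavy_cubes.
have c0 : 0 < (5 ^ d)%:R^-1 :> R by rewrite invr_gt0 ltr0n expn_gt0.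
have [N1 hN1] := thr_scale_ge c0 e0.
have M0 : 0 < M.+1%:R^-1 :> R by rewrite invr_gt0 ltr0n.
have [N2 hN2] := scale_powR_small M0 e0.
exists (maxn N1 N2) => mu j l; rewrite geq_max => /andP[jN1 jN2] gj mem_l.
split; first by rewrite mulrC; exact: hN1.
have s1 : 0 < scale j :> R := scale_gt0 j.
rewrite (@powRD _ (scale j)); last by apply/implyP => _; rewrite gt_eqF.
set n := size _; have szM : (size (stop (scale j) [::]) <= M.+1 * n)%N.
  by apply: leq_trans (hM mu j l gj mem_l) _; rewrite leq_mul2r leqnSn orbT.
have szM' : scale j `^ (- s) <= M.+1%:R * n%:R.
  by apply: le_trans (stop_size_scale j) _; rewrite -natrM ler_nat.
have e1 : scale j `^ e <= M.+1%:R^-1.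
  apply: le_trans (hN2 j jN2) _; rewrite ler_pdivrMr ?ltr0n// ler_peMr ?(ltW M0)//.
  by rewrite ler1n.
apply: le_trans (ler_pM (powR_ge0 _ _) (powR_ge0 _ _) e1 szM') _.
by rewrite mulKf// pnatr_eq0.
Qed.

Lemma Lq_spectrum_le1 mu (q : R) : generic mu -> q <= 1 ->
  (Lq_spectrum mu q <= (s * (q - 1))%:E)%E.
Proof.
move=> gmu q1; apply: Lq_spectrum_le => e N e0.
(* For [q >= 0] the loss is [e'] in the number of heavy cubes plus [e' * q] in the powers of their
   masses; for [q < 0] it is [e' * (1 - q)]. Either way it equals [e]. *)
pose e' := e / (1 + `|q|); have q0 : 0 < 1 + `|q| by rewrite ltr_pwDl.
have e'0 : 0 < e' by rewrite divr_gt0.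
have e'E : e' * (1 + `|q|) = e by rewrite divfK// gt_eqF.
have [N1 hN1] := heavy_cubes_scale e'0.
have [C hC] := charged_cubes.
have [j jN gj] := generic_good (maxn (maxn N N1) 1) gmu.
move: jN; rewrite !geq_max => /andP[/andP[NJ N1j] j0].
have [l [ul szl mem_l sum_l Zl]] := hC mu j.
have [h1 h2] := hN1 mu j l N1j gj mem_l.
exists j, (\sum_(k <- l) cube_mass mu j k `^ q); split=> //.
set l' := [seq k <- l | _] in h2.
have s1 : 0 < scale j :> R := scale_gt0 j.
have cond x : (x == 0 :> R) ==> (scale j != 0 :> R).
  by apply/implyP => _; rewrite gt_eqF.
have p_gt0 : {in l, forall k, 0 < cube_mass mu j k} by move=> k; rewrite mem_l.
(* For [q >= 0] the heavy cubes alone suffice. For [q < 0] their masses give no lower bound; only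
   the number of charged cubes is used, through the power mean. *)
have [q_ge0|q_lt0] := leP 0 q.
  rewrite ger0_norm// in e'E.
  apply: (@le_trans _ _ (scale j `^ (e' - s) * (scale j `^ (s + e')) `^ q)).
    rewrite -powRrM -powRD ?cond//; apply: scale_powR_le_mono.
    by rewrite -e'E; nra.
  apply: le_trans (_ : \sum_(k <- l') cube_mass mu j k `^ q <= _); last first.
    apply: subset_partition_sum; last exact: filter_uniq.
    by move=> k; rewrite mem_filter => /andP[].
  apply: (@le_trans _ _ (\sum_(k <- l') (scale j `^ (s + e')) `^ q)).
    rewrite big_const_seq count_predT iter_addr_0 -[leRHS]mulr_natl.
    by rewrite ler_wpM2r// powR_ge0.
  rewrite big_seq [leRHS]big_seq; apply: ler_sum => k.
  rewrite mem_filter => /andP[hk _]; apply: ge0_ler_powR => //.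
  - by rewrite nnegrE powR_ge0.
  - by rewrite nnegrE cube_mass_ge0.
  - exact: le_trans h1 hk.
rewrite ltr0_norm// in e'E.
have q'0 : 0 <= 1 - q by lra.
apply: le_trans (power_mean_ge p_gt0 sum_l (ltW q_lt0)).
apply: (@le_trans _ _ ((scale j `^ (e' - s)) `^ (1 - q))).
  rewrite -powRrM; apply: scale_powR_le_mono; rewrite -e'E; nra.
apply: ge0_ler_powR; rewrite ?nnegrE ?powR_ge0 ?ler0n//.
apply: le_trans h2 _; rewrite ler_nat.
exact: size_subseq (filter_subseq _ _).
Qed.

Lemma Lq_spectrum_le0 mu (q : R) : generic mu -> 1 < q ->
  (Lq_spectrum mu q <= 0%:E)%E.
Proof.
move=> gmu q1; apply: Lq_spectrum_le => e N e0.
have q0 : 0 < q by lra.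
(* One cube of mass at least [scale j ^ (s + 1)] contributes [scale j ^ ((s + 1) * q)], which by
   this choice is at least [scale i ^ e] for [i = j * n]; requiring [n <= j] makes [tiny j] at most
   [scale i]. *)
pose n := (Num.truncn ((s + 1) * q / e)).+1.
have nE : (s + 1) * q <= e * n%:R.
  by rewrite [leRHS]mulrC -ler_pdivrMr// ltW// truncnS_gt.
have [N1 hN1] := heavy_cubes_scale ltr01.
have [C hC] := charged_cubes.
have [j jN gj] := generic_good (maxn (maxn N N1) (maxn n 1)) gmu.
move: jN; rewrite !geq_max => /andP[/andP[NJ N1j] /andP[nj j0]].
pose i := (j * n)%N.
have [lj [_ _ mem_lj _ _]] := hC mu j.
have [h1 _] := hN1 mu j lj N1j gj mem_lj.
have [l [ul szl mem_l sum_l Zl]] := hC mu i.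
exists i, (\sum_(k <- l) cube_mass mu i k `^ q); split=> //.
- by apply: leq_trans NJ _; rewrite leq_pmulr.
- by rewrite muln_gt0 j0.
have [|w ws _] := @stop_cover _ _ _ S alpha K hK (scale j) [::] y0.
  by exists y0.
have tj : tiny j <= scale i :> R.
  rewrite /tiny /scale; apply: ler_wiXn2l; [|lra|].
    by rewrite invr_ge0.
  by rewrite -mulnn leq_mul2l nj orbT.
have [k _ kth] := heavy_neighbour hd tj (good_mass hd hK gj ws).
rewrite cube_massE lee_fin in kth.
have sk : scale j `^ (s + 1) <= cube_mass mu i k by exact: le_trans h1 kth.
have k0 : 0 < cube_mass mu i k.
  by apply: lt_le_trans sk; rewrite powR_gt0// scale_gt0.
apply: (@le_trans _ _ ((scale j `^ (s + 1)) `^ q)).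
  have -> : scale i = scale j `^ n%:R :> R.
    by rewrite powR_mulrn ?(ltW (scale_gt0 _))// /scale -exprM.
  rewrite -!powRrM; apply: scale_powR_le_mono.
  by rewrite add0r [leRHS]mulrC.
apply: (@le_trans _ _ (cube_mass mu i k `^ q)).
  apply: ge0_ler_powR; rewrite ?nnegrE ?powR_ge0 ?cube_mass_ge0 ?(ltW q0)//.
have := @subset_partition_sum mu i q l [:: k].
rewrite big_seq1; apply=> // k'; rewrite inE => /eqP ->.
by rewrite mem_l.
Qed.

(** For [q] in [0,1] the power sum is largest when the mass is spread equally over the charged
    cubes, whose number is [O(2 ^ (j s))]; the loss [e * (1 - q)] is at most [e]. *)
Lemma Lq_spectrum_ge1 mu (q : R) : 0 <= q <= 1 ->
  ((s * (q - 1))%:E <= Lq_spectrum mu q)%E.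
Proof.
move=> q01; have /andP[q0 q1] := q01; apply: Lq_spectrum_ge => e e0.
have [C hC] := charged_cubes.
have ami := amin_gt0 hS.
pose c := C.+1%:R * amin `^ (- s).
have c0 : 0 < c by rewrite mulr_gt0 ?powR_gt0// ltr0n.
have ci : 0 < c^-1 by rewrite invr_gt0.
have [N hN] := scale_powR_small ci e0; exists N => j Nj.
have [l [ul szl mem_l sum_l Zl]] := hC mu j.
exists (\sum_(k <- l) cube_mass mu j k `^ q).
have p_gt0 : {in l, forall k, 0 < cube_mass mu j k} by move=> k; rewrite mem_l.
have s1 : 0 < scale j :> R := scale_gt0 j.
split=> //.
  case: l {szl Zl mem_l ul} sum_l p_gt0 => [|k l] sum_l p_gt0.
    by move: sum_l; rewrite big_nil => /esym/eqP; rewrite oner_eq0.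
  rewrite big_cons ltr_pwDl ?powR_gt0 ?p_gt0 ?mem_head//.
  by apply: sumr_ge0 => k' _; exact: powR_ge0.
apply: le_trans (power_mean_le p_gt0 sum_l q01) _.
have q'0 : 0 <= 1 - q by lra.
apply: (@le_trans _ _ ((scale j `^ (- s - e)) `^ (1 - q))); last first.
  rewrite -powRrM; apply: scale_powR_le_mono; nra.
apply: ge0_ler_powR; rewrite ?nnegrE ?powR_ge0 ?ler0n//.
rewrite (@powRD _ (scale j)); last by apply/implyP => _; rewrite gt_eqF.
apply: (@le_trans _ _ (c * scale j `^ (- s))).
  apply: (@le_trans _ _ (C.+1%:R * (size (stop (scale j) [::]))%:R)).
    by rewrite -natrM ler_nat; apply: leq_trans szl _; rewrite leq_mul2r leqnSn orbT.
  rewrite /c -mulrA ler_pM2l ?ltr0n//.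
  apply: le_trans (stop_size_le hS hK s0 hs j) _.
  rewrite le_eqVlt; apply/orP; left; apply/eqP; congr (_ * _).
  by rewrite powRN /scale powRXn ?invr_ge0// powRVl// exprVn invrK.
rewrite mulrC ler_wpM2l ?powR_ge0// powRN.
rewrite -[leLHS]invrK lef_pV2 ?posrE ?powR_gt0//.
apply: le_trans (hN j Nj) _; rewrite ler_pdivrMr ?ltr0n// ler_peMr ?(ltW ci)//.
by rewrite ler1n.
Qed.

Lemma Lq_spectrumE mu (q : R) : generic mu -> 0 <= q <= 1 ->
  Lq_spectrum mu q = (s * (q - 1))%:E.
Proof.
move=> gmu q01; have /andP[_ q1] := q01.
by apply/eqP; rewrite eq_le Lq_spectrum_le1//= Lq_spectrum_ge1.
Qed.

(** The value [h] is attained at [q = 1]. Elsewhere upper bounds on the spectrum suffice: the excess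
    over [h] is at least [(1 - q) * (s - h)] below 1 and [(q - 1) * h] above 1. *)
Lemma legendre_Lq_spectrum mu (h : R) : generic mu -> 0 <= h <= s ->
  legendre (Lq_spectrum mu) h = h%:E.
Proof.
move=> gmu /andP[h0 hs1]; apply/eqP; rewrite eq_le; apply/andP; split.
  apply: ereal_inf_lbound; exists 1 => //.
  rewrite Lq_spectrumE ?ler01 ?lexx// subrr mulr0 mul1r.
  by rewrite sube0.
apply: le_ereal_inf_tmp => _ [q _ <-].
have [q1|q1] := leP q 1.
  apply: (@le_trans _ _ ((q * h)%:E - (s * (q - 1))%:E)%E); last first.
    by apply: leeB => //; exact: Lq_spectrum_le1.
  by rewrite -EFinB lee_fin; nra.
apply: (@le_trans _ _ ((q * h)%:E - 0%:E)%E); last first.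
  by apply: leeB => //; exact: Lq_spectrum_le0.
by rewrite -EFinB lee_fin; nra.
Qed.

End LqSpectrum.

Theorem theorem1p1 (R : realType) (d : nat) (hd : (0 < d)%N) (m : nat)
  (S : 'I_m -> 'rV[R]_d -> 'rV[R]_d) (alpha : 'I_m -> R)
  (hS : forall i, contractive_similitude (alpha i) (S i))
  (K : set 'rV[R]_d) (hK : self_similar_set S K)
  (hosc : open_set_condition S)
  (s : R) (hs : hausdorff_dim K = s%:E) :
  exists Omega : set (prob_on K),
    Gdelta_dense Omega /\
    forall mu : prob_on K, Omega mu ->
      [/\ forall h : R, s < h -> level_set mu h = set0,
          forall h : R, 0 <= h <= s -> spectrum mu h = h%:E,
          forall q : R, 0 <= q <= 1 -> Lq_spectrum mu q = (s * (q - 1))%:E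
        & forall h : R, 0 <= h <= s ->
            spectrum mu h = legendre (Lq_spectrum mu) h].
Proof.
(* Identifying [s] with the similarity dimension turns the hypothesis on [hausdorff_dim K] into
   [sum alpha_i ^ s = 1]. *)
have [t t0 ht] := similarity_dimension_exists hS hK.
have := hausdorff_dim_self_similar hS hd hK t0 ht hosc.
rewrite hs => -[st]; rewrite -{t}st in t0 ht.
have [U [[y1 Uy1] oU Usub Udisj]] := hosc.
have [a a0 Uball] := open_enorm_ball oU Uy1.
have [[y0 Ky0] _ _] := hK.
exists (@generic R d m S alpha K s y0); split.
  exact: generic_Gdelta_dense.
move=> mu gmu.
have spE h : 0 <= h <= s -> spectrum mu h = h%:E.
  exact: (spectrumE hS hd hK Usub Udisj a0 Uball t0 ht Ky0 gmu).
split=> //.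
- by move=> h; apply: (level_set_gt hS hd hK t0 Ky0 gmu).
- by move=> q; apply: (Lq_spectrumE hS hd hK Usub Udisj a0 Uball t0 ht Ky0 gmu).
move=> h h01; rewrite spE//; apply/esym.
exact: (legendre_Lq_spectrum hS hd hK Usub Udisj a0 Uball t0 ht Ky0 gmu h01).
Qed.
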